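(* Let $p\in[2,\infty)$, $\delta\in[0,\infty)$ and $q=p/(p-1)$. The optimization problems $V^\infty_{p,\delta}$ and $P_{q,\delta}$ admit unique optimizers $\alpha$ and $Y$, respectively. Writing $X=X^\alpha$ and $Y(t)=\mathbb{E}[Y\,|\,\mathcal{F}(t)]$, we have $$0<\|X(1)\|_p<\infty,\qquad\int_0^1\|Y(t)\|_2\,dt<\infty,\qquad\|Y(t)\|_2>0\ \text{ for }t>0,$$ and the following relations hold almost surely: $$Y=\frac{X(1)|X(1)|^{p-2}}{\|X(1)\|_p^{p-1}},\qquad\alpha(t)=-\lambda(t)Y(t)\ \text{ for a.e. }t\in(0,1),$$ where $\lambda(t)\in(0,\infty)$ is defined by $$\lambda(t)=\min\Big(\frac{c_0}{\|Y(t)\|_2},\frac1\delta\Big),\qquad t\in(0,1),$$ with the minimum interpreted as $\lambda(t)=c_0/\|Y(t)\|_2$ if $\delta=0$. Lastly, $t\mapsto\lambda(t)$ is continuous, and if $\delta>0$ it is bounded from above.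
   Context: Fix a complete probability space $(\Omega,\mathcal{F},\mathbb{P})$ supporting a standard one-dimensional Brownian motion $B=(B(t))_{t\in[0,1]}$ started at zero, and let $\mathbb{F}=(\mathcal{F}(t))_{t\in[0,1]}$ be the completed filtration generated by $B$. Let $c_0=\sqrt{2/\pi}$. Let $\mathbb{A}$ be the set of $\mathbb{F}$-progressively measurable real processes $\alpha=(\alpha(t))_{t\in[0,1]}$ with $\|\alpha(t)\|_2\le c_0$ for a.e. $t\in[0,1]$, and set $X^\alpha(t)=\int_0^t\alpha(s)\,ds+B(t)$. Here $\|\cdot\|_r$ is the $L^r(\mathbb{P})$ norm. Define $$V^\infty_{p,\delta}=\inf_{\alpha\in\mathbb{A}}\Big\{\|X^\alpha(1)\|_p+\frac{\delta}{2}\mathbb{E}\int_0^1\alpha(t)^2\,dt\Big\},\qquad \varphi_\delta(y)=\sup_{|a|\le c_0}\Big(ay-\frac{\delta}{2}a^2\Big),\quad y\ge0,$$ and $$P_{q,\delta}=\sup_Y\Big\{\mathbb{E}[YB(1)]-\int_0^1\varphi_\delta\big(\|\mathbb{E}[Y\,|\,\mathcal{F}(t)]\|_2\big)\,dt\Big\},$$ the supremum being over random variables $Y:\Omega\to\mathbb{R}$ with $\|Y\|_q\le1$ and $\mathbb{E}[|Y|\sqrt{\log(1+|Y|)}]<\infty$ (the latter is automatic for $q>1$). The objective is interpreted as $-\infty$ when the time integral is $+\infty$, with $\varphi_\delta(\infty)=\infty$. Optimizers $\alpha$ are identified up to $dt\otimes\mathbb{P}$-null sets, and $Y$ up to $\mathbb{P}$-null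 sets. *)

(* Defs.v *)
From HB Require Import structures.
From mathcomp Require Import all_boot all_order all_algebra.
From mathcomp Require Import all_classical all_reals all_analysis.
Set Implicit Arguments.
Unset Strict Implicit.
Unset Printing Implicit Defensive.
Import Order.TTheory GRing.Theory Num.Theory.
Import numFieldNormedType.Exports.
Local Open Scope classical_set_scope.
Local Open Scope ring_scope.

(* Processes are functions [R -> T -> R], time first; only the times in [0, 1]
   matter. *)

Section brownian_motion.
Context d (T : measurableType d) (R : realType) (P : probability T R).
Implicit Types B alpha : R -> T -> R.

Definition history B (t : R) : set (set T) :=
  <<s [set A | exists (s : R) (U : set R),
         [/\ 0 <= s <= t, measurable U & A = B s @^-1` U]]>>.

(* The second parameter of [normal_prob] is the standard deviation. *)
Record standard_brownian_motion B : Prop := StandardBrownianMotion {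
  bm_measurable : forall t : R, 0 <= t <= 1 -> measurable_fun setT (B t) ;
  bm_start : {ae P, forall w, B 0 w = 0} ;
  bm_increment : forall s t : R, 0 <= s -> s < t -> t <= 1 ->
    forall U : set R, measurable U ->
      P ((B t \- B s) @^-1` U) = normal_prob 0 (Num.sqrt (t - s)) U ;
  bm_independent : forall s t : R, 0 <= s -> s < t -> t <= 1 ->
    forall (A : set T) (U : set R), history B s A -> measurable U ->
      P (A `&` (B t \- B s)%R @^-1` U) =
      (P A * P ((B t \- B s)%R @^-1` U))%E ;
  bm_continuous :
    {ae P, forall w, {within `[0, 1], continuous (fun t => B t w)}} }.

Definition filtration B (t : R) : set (set T) :=
  <<s history B t `|` P.-negligible >>.

Definition progressive B alpha :=
  forall t : R, 0 <= t <= 1 ->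
    measurable_fun
      (`[0, t] `*` setT : set (R * g_sigma_algebraType (filtration B t)))
      (fun z => alpha z.1 z.2).

End brownian_motion.

Section conditional_expectation.
Context d (T : measurableType d) (R : realType) (P : probability T R).

(* [Z] is a version of the conditional expectation of [Y] given the
   sigma-algebra [G]. *)
Definition is_condexp (G : set (set T)) (Y Z : T -> R) :=
  [/\ measurable_fun (setT : set (g_sigma_algebraType G)) Z,
      P.-integrable setT (EFin \o Z) &
      forall A, G A ->
        (\int[P]_(w in A) (Z w)%:E = \int[P]_(w in A) (Y w)%:E)%E].

(* An arbitrary version; versions agree almost surely. *)
Definition condexp (G : set (set T)) (Y : T -> R) : T -> R :=
  xget (fun=> 0) [set Z | is_condexp G Y Z].

(* [Yt] is a progressively measurable version of the process E[Y | F(t)]; joint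
   measurability is what gives a meaning to the pathwise statements
   "almost surely, for a.e. t" about this process. *)
Definition martingale_version (B : R -> T -> R) (Y : T -> R)
    (Yt : R -> T -> R) :=
  progressive P B Yt /\
  forall t : R, 0 <= t <= 1 -> is_condexp (filtration P B t) Y (Yt t).

End conditional_expectation.

Section problems.
Context d (T : measurableType d) (R : realType) (P : probability T R).
Variables (B : R -> T -> R) (delta : R).
Local Notation mu := (@lebesgue_measure R).

Definition c0 : R := Num.sqrt (2 / pi).

Definition norm (r : R) (X : T -> R) : \bar R := Lnorm P r%:E (EFin \o X).

Definition control (alpha : R -> T -> R) :=
  progressive P B alpha /\
  {ae mu, forall t : R, 0 <= t <= 1 -> (norm 2 (alpha t) <= c0%:E)%E}.

Definition state (alpha : R -> T -> R) (t : R) (w : T) : R :=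
  Rintegral mu `[0, t] (fun s => alpha s w) + B t w.

Definition primal_cost (p : R) (alpha : R -> T -> R) : \bar R :=
  (norm p (state alpha 1) +
   (delta / 2)%:E * \int[P]_w \int[mu]_(t in `[0%R, 1%R]) (alpha t w ^+ 2)%:E)%E.

Definition primal_value (p : R) : \bar R :=
  ereal_inf [set primal_cost p alpha | alpha in control].

Definition primal_optimizer (p : R) (alpha : R -> T -> R) :=
  control alpha /\ primal_cost p alpha = primal_value p.

(* Extended to [y = +oo] by the same formula; see [phi_pinfty]. *)
Definition phi (y : \bar R) : \bar R :=
  ereal_sup [set (a%:E * y - (delta / 2 * a ^+ 2)%:E)%E |
             a in [set a : R | `|a| <= c0]].

Definition dual_feasible (q : R) (Y : T -> R) :=
  [/\ measurable_fun setT Y, (norm q Y <= 1)%E &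
      (\int[P]_w (`|Y w| * Num.sqrt (ln (1 + `|Y w|)))%:E < +oo)%E].

(* The expectation is finite for feasible [Y], so the difference is [-oo] when
   the time integral is [+oo]. *)
Definition dual_gain (Y : T -> R) : \bar R :=
  ('E_P[Y \* B 1] -
   \int[mu]_(t in `[0%R, 1%R]) phi (norm 2 (condexp P (filtration P B t) Y)))%E.

Definition dual_value (q : R) : \bar R :=
  ereal_sup [set dual_gain Y | Y in dual_feasible q].

Definition dual_optimizer (q : R) (Y : T -> R) :=
  dual_feasible q Y /\ dual_gain Y = dual_value q.

(* When [norm 2 (Yt t)] is 0 or [+oo] this is 0, so the assertion
   [0 < lambda Yt t] includes that the norm is positive and finite. *)
Definition lambda (Yt : R -> T -> R) (t : R) : R :=
  let l := c0 / fine (norm 2 (Yt t)) in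
  if delta == 0 then l else Num.min l delta^-1.

Lemma phi_pinfty : phi +oo%E = +oo%E.
Proof.
have c0_gt0 : 0 < c0 by rewrite sqrtr_gt0 divr_gt0// pi_gt0.
apply/eqP; rewrite -leye_eq; apply: ereal_sup_ubound.
exists c0; first by rewrite /= ger0_norm// ltW.
by rewrite gt0_muley ?lte_fin.
Qed.

End problems.

(* Main.v *)
(* Weak duality: for a control alpha with terminal state X = A + B(1), A being
   the integral of alpha, and a feasible Y, one has
     cost(alpha) - gain(Y) = (|X|_p - E[X Y]) + int_0^1 g(t) dt,
     g(t) = E[alpha(t) Y(t)] + (delta/2) |alpha(t)|_2^2 + phi(|Y(t)|_2),
   because E[A Y] = int E[alpha(t) Y(t)] dt, which is obtained from
   Y(s) in L^2 (s < 1) by letting s tend to 1.  Both terms are nonnegative; the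
   first vanishes only if Y is the Hoelder dual of X, the second only if
   alpha = - lambda Y.  Hence a pair with cost = gain satisfies all the stated
   relations, and each of its members is the only optimizer.

   A primal optimizer exists: among nearly optimal controls those of nearly
   minimal energy form a Cauchy sequence by the parallelogram identity, even if
   delta = 0.  With Y the Hoelder dual of its terminal state, the first variation
   of the cost towards bounded truncations of - lambda Y gives gain(Y) >= cost(alpha).

   Positivity: let tau be the last time at which Y(tau) = 0, and suppose tau > 0.
   Replacing Y by its conditional expectation given the increments of B after
   tau does not decrease the gain, so by uniqueness Y, and then X, is a function
   of these increments and is independent of F(tau).  As alpha is proportional
   to Y after tau, E[X | F(tau)] is the state at time tau, which is therefore
   constant.  This is impossible: the integral of a control up to tau is too
   small in L^2 to compensate B(tau), since c_0 < 1.

   Joint measurability and continuity of t |-> |Y(t)|_2 come from the uniform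
   L^1-continuity of t |-> E[Y | F(t)], valid in the Brownian filtration: an
   event of F(1) is nearly determined by the path with its increments over a
   short interval [s, t] removed, and for events determined by such a path,
   conditioning on F(s) and on F(t) is the same. *)
Require Import Defs.
From mathcomp Require Import all_boot all_order all_algebra.
From mathcomp Require Import all_classical all_reals all_analysis.
From mathcomp Require Import measurable_realfun ring lra.
Set Implicit Arguments.
Unset Strict Implicit.
Unset Printing Implicit Defensive.
Import Order.TTheory GRing.Theory Num.Theory.
Import numFieldNormedType.Exports.
Local Open Scope classical_set_scope.
Local Open Scope ring_scope.

(** * Real-valued integrals *)

(** Since [q <= 2], the dual variable lies in L^q but perhaps not in L^2, while a control is bounded
    only in L^2, so E[A Y] and the time integral cannot be exchanged directly. The link is t |->
    |Y(t)|_2: it is nondecreasing, and integrable as soon as the gain is not -oo, hence finite for t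
    < 1. Before this integrability is known only bounded controls can be paired with Y, which is why
    strong duality goes through truncations and ends with Fatou.

    If [delta = 0], the cost does not see the energy. Energy is therefore minimized as a second
    criterion, and in the limit the norm and the energy are bounded separately.

    Uniqueness needs no strict convexity: every optimal control attains equality with the same Y,
    and every optimal dual variable with the same terminal state.

    In the positivity argument the gain does not decrease because conditioning on the increments
    after tau commutes with conditioning on F(t), so that all norms |Y(t)|_2 shrink, while the
    pairing with B(1) is unchanged because Y(tau) = 0. The value of c_0 enters only through 0 < c_0
    < 1, that is, through pi > 2. *)

Section real_integral.
Context d (T : measurableType d) (R : realType) (mu : {measure set T -> \bar R}).
Variables (D : set T).
Hypothesis mD : measurable D.
Implicit Types (f g h : T -> R).

(** Functions stay real-valued, so that identities between integrals can be settled by [ring] and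
    [lra]; extended reals return only where finiteness is at stake. *)
Definition intg f : Prop := mu.-integrable D (EFin \o f).

Local Notation I f := (Rintegral mu D f).

Lemma intg_meas f : intg f -> measurable_fun D f.
Proof. by move=> /integrableP[/measurable_EFinP]. Qed.

Lemma intg_eq f g : {in D, f =1 g} -> intg f -> intg g.
Proof. by move=> fg; apply: eq_integrable => // x xD /=; rewrite fg. Qed.

Lemma intg_le g f : measurable_fun D f -> (forall x, D x -> `|f x| <= g x) ->
  intg g -> intg f.
Proof.
move=> mf fg; apply: le_integrable => //; first exact/measurable_EFinP.
move=> x Dx /=; rewrite lee_fin (le_trans (fg x Dx))// ler_norm //.
Qed.

Lemma intgD f g : intg f -> intg g -> intg (fun x => f x + g x).
Proof. by move=> fi gi; have := integrableD mD fi gi; apply: eq_integrable. Qed.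

Lemma intgB f g : intg f -> intg g -> intg (fun x => f x - g x).
Proof. by move=> fi gi; have := integrableB mD fi gi; apply: eq_integrable. Qed.

Lemma intgZ k f : intg f -> intg (fun x => k * f x).
Proof. by move=> fi; have := integrableZl mD k fi; apply: eq_integrable. Qed.

Lemma intgN f : intg f -> intg (fun x => - f x).
Proof.
by move=> /(intgZ (-1)); apply: intg_eq => x _; rewrite mulN1r.
Qed.

Lemma intg_abs f : intg f -> intg (fun x => `|f x|).
Proof. by move=> fi; have := integrable_abse fi; apply: eq_integrable. Qed.

Lemma intg_ge0 f : measurable_fun D f -> (forall x, D x -> 0 <= f x) ->
  (\int[mu]_(x in D) (f x)%:E < +oo)%E -> intg f.
Proof.
move=> mf f0 fi; apply/integrableP; split; first exact/measurable_EFinP.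
rewrite (eq_integral (EFin \o f))// => x; rewrite inE => Dx /=.
by rewrite ger0_norm ?f0.
Qed.

Lemma intgE f : intg f -> (\int[mu]_(x in D) (f x)%:E)%E = (I f)%:E.
Proof. by move=> fi; rewrite /Rintegral fineK// integrable_fin_num. Qed.

Lemma IntD f g : intg f -> intg g -> I (fun x => f x + g x) = I f + I g.
Proof. by move=> fi gi; rewrite RintegralD. Qed.

Lemma IntB f g : intg f -> intg g -> I (fun x => f x - g x) = I f - I g.
Proof. by move=> fi gi; rewrite RintegralB. Qed.

Lemma IntZ k f : intg f -> I (fun x => k * f x) = k * I f.
Proof. by move=> fi; rewrite RintegralZl. Qed.

Lemma IntN f : intg f -> I (fun x => - f x) = - I f.
Proof.
move=> fi; rewrite -mulN1r -IntZ//.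
by apply: eq_Rintegral => x _; rewrite mulN1r.
Qed.

Lemma Int_le f g : intg f -> intg g -> (forall x, D x -> f x <= g x) ->
  I f <= I g.
Proof. by move=> fi gi fg; exact: le_Rintegral. Qed.

Lemma Int_norm f : intg f -> `|I f| <= I (fun x => `|f x|).
Proof. by move=> fi; exact: le_normr_Rintegral. Qed.

Lemma Int_ae f g : measurable_fun D f -> measurable_fun D g ->
  {ae mu, forall x, D x -> f x = g x} -> I f = I g.
Proof.
move=> mf mg fg; congr fine; apply: ae_eq_integral => //.
- exact/measurable_EFinP.
- exact/measurable_EFinP.
- by apply: filterS fg => x /= h Dx; rewrite h.
Qed.

Lemma intg_ae f g : measurable_fun D g ->
  {ae mu, forall x, D x -> f x = g x} -> intg f -> intg g.
Proof.
move=> mg fg fi; apply/integrableP; split; first exact/measurable_EFinP.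
have /integrableP[_] := fi; apply: le_lt_trans.
rewrite le_eqVlt; apply/orP; left; apply/eqP; apply: ae_eq_integral => //.
- by apply: measurableT_comp => //; exact/measurable_EFinP.
- by apply: measurableT_comp => //; exact: measurable_int fi.
- by apply: filterS fg => x /= h Dx; rewrite h.
Qed.

Lemma Int_le_ae f g : intg f -> intg g ->
  {ae mu, forall x, D x -> f x <= g x} -> I f <= I g.
Proof.
move=> fi gi fg.
have mm : measurable_fun D (fun x => Order.max (f x) (g x)).
  by apply: measurable_maxr; exact: intg_meas.
have ae1 : {ae mu, forall x, D x -> g x = Order.max (f x) (g x)}.
  by apply: filterS fg => x h Dx; rewrite max_r// h.
rewrite (Int_ae (intg_meas gi) mm)//.
apply: Int_le => //; first exact: intg_ae gi.
by move=> x _; rewrite le_max lexx.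
Qed.

(** The equality cases of the development (Hölder's inequality, the relation between control and
    martingale, uniqueness of conditional expectations) all take this form: a nonnegative integrand
    whose integral is at most 0. *)
Lemma Int_eq0_ae f : intg f -> {ae mu, forall x, D x -> 0 <= f x} -> I f <= 0 ->
  {ae mu, forall x, D x -> f x = 0}.
Proof.
move=> fi f0 If.
have ae1 : {ae mu, forall x, D x -> f x = `|f x|}.
  by apply: filterS f0 => x h Dx; rewrite ger0_norm// h.
have := (ae_eq_integral_abs mu mD (measurable_int _ fi)).1 _.
case=> [|N [mN N0 sub]]; last first.
  exists N; split => // x /= nx; apply: sub => /= h; apply: nx => Dx.
  by have := h Dx => -[].
transitivity (I f)%:E.
  rewrite (Int_ae (intg_meas fi) _ ae1); last first.
    by apply: measurableT_comp => //; exact: intg_meas.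
  by rewrite -intgE//; exact: intg_abs.
congr EFin; apply/eqP; rewrite eq_le If /=.
rewrite (Int_ae (intg_meas fi) _ ae1); last first.
  by apply: measurableT_comp => //; exact: intg_meas.
by apply: Rintegral_ge0 => x _; exact: normr_ge0.
Qed.

Lemma Int_dominated (f_ : nat -> T -> R) f g :
  (forall n, measurable_fun D (f_ n)) -> measurable_fun D f ->
  {ae mu, forall x, D x -> f_ ^~ x @ \oo --> f x} ->
  intg g -> (forall n, {ae mu, forall x, D x -> `|f_ n x| <= g x}) ->
  [/\ intg f, (fun n => I (fun x => `|f_ n x - f x|)) @ \oo --> 0 &
      (fun n => I (f_ n)) @ \oo --> I f].
Proof.
move=> mf_ mf cv gi dom.
have [] := @dominated_convergence _ _ _ mu D mD (fun n => EFin \o f_ n)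
  (EFin \o f) (EFin \o g) _ _ _ gi _.
- by move=> n; exact/measurable_EFinP.
- exact/measurable_EFinP.
- by apply: filterS cv => x h Dx; apply: cvg_EFin; [exact: nearW|exact: h].
- have : {ae mu, forall x, forall n, D x -> `|f_ n x| <= g x}.
    by apply: ae_foralln => n; exact: dom.
  by apply: filterS => x h n Dx; rewrite /= lee_fin h.
move=> fi c1 c2; split => //.
- have h n : intg (f_ n).
    apply: (@intg_ae (fun x => Order.max (- g x) (Order.min (f_ n x) (g x)))) => //.
      apply: filterS (dom n) => x /[apply]; rewrite ler_norml => /andP[h1 h2].
      by rewrite min_l// max_r.
    apply: (@intg_le (fun x => `|g x|)).
    + apply: measurable_maxr; last first.
        by apply: measurable_minr => //; exact: intg_meas gi.
      by apply: measurableT_comp => //; exact: intg_meas.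
    + move=> x Dx; have := ler_norm (g x); have := ler_norm (- g x).
      rewrite normrN => h1 h2; rewrite ler_norml; apply/andP; split.
        by rewrite le_max; apply/orP; left; rewrite lerN2.
      by rewrite ge_max h1 /= ge_min h2 orbT.
    + exact: intg_abs.
  apply: (@cvg_trans _ (fine \o (fun n => \int[mu]_(x in D) `|(EFin \o f_ n) x - (EFin \o f) x|)%E @ \oo)); last exact: fine_cvg c1.
  by apply: near_eq_cvg; apply: nearW => n /=; congr fine.
- have h : (fun n => I (f_ n)) = fine \o (fun n => \int[mu]_(x in D) (EFin \o f_ n) x)%E by [].
  rewrite h; apply: fine_cvg; rewrite /Rintegral fineK//; exact: integrable_fin_num.
Qed.

(** The bound is stated in the extended reals because it usually serves to prove that the limit is
    integrable, before its real integral has a meaning. *)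
Lemma Int_fatou (f_ : nat -> T -> R) f (c : \bar R) :
  (forall n, measurable_fun D (f_ n)) -> measurable_fun D f ->
  (forall n x, D x -> 0 <= f_ n x) ->
  {ae mu, forall x, D x -> f_ ^~ x @ \oo --> f x} ->
  (forall n, (\int[mu]_(x in D) (f_ n x)%:E <= c)%E) ->
  (\int[mu]_(x in D) (f x)%:E <= c)%E.
Proof.
move=> mf_ mf f0 cv le.
have mf_' n : measurable_fun D (EFin \o f_ n) by exact/measurable_EFinP.
rewrite (@ae_eq_integral _ _ _ mu D (fun x => limn_einf (fun n => (f_ n x)%:E)))//.
- apply: le_trans (fatou mu mD mf_' _) _; first by move=> n x Dx; rewrite /= lee_fin f0.
  rewrite limn_einf_lim; apply: lime_le; first exact: is_cvg_einfs.
  apply: nearW => n; apply: le_trans (le n).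
  by apply: ereal_inf_lbound; exists n => //=.
- exact/measurable_EFinP.
- under eq_fun do rewrite -[limn_einf _]oppeK -limn_esupN.
  apply: measurableT_comp => //; apply: measurable_fun_limn_esup => n.
  by apply: measurableT_comp => //; exact: mf_'.
- apply: filterS cv => x h Dx; apply/esym.
  rewrite is_cvg_limn_einfE; last by apply/cvg_ex; exists (f x)%:E; apply: cvg_EFin; [exact: nearW|exact: h].
  by apply: cvg_lim => //; apply: cvg_EFin; [exact: nearW|exact: h].
Qed.

Lemma intg_bounded f g M : intg f -> measurable_fun D g ->
  (forall x, D x -> `|g x| <= M) -> intg (fun x => f x * g x).
Proof.
move=> fi mg gM; apply: (@intg_le (fun x => M * `|f x|)).
- by apply: measurable_funM => //; exact: intg_meas.
- by move=> x Dx; rewrite normrM mulrC ler_wpM2r// gM.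
- by apply: intgZ; exact: intg_abs.
Qed.

End real_integral.

(** * Conditional expectation *)

Import HBNNSimple.

(** Measure-theoretic induction, stated through approximants. Their bound by [|f|] provides the
    dominating function for the passage to the limit. It is applied with [T] carrying a smaller
    sigma-algebra, so that the approximants are measurable for it as well. *)
Lemma simple_approx d (T : measurableType d) (R : realType)
    (Q : (T -> R) -> Prop) :
  (forall A, measurable A -> Q \1_A) ->
  (forall f g, Q f -> Q g -> Q (fun x => f x + g x)) ->
  (forall c f, Q f -> Q (fun x => c * f x)) ->
  forall f : T -> R, measurable_fun setT f ->
  exists f_ : nat -> T -> R,
    [/\ forall n, Q (f_ n), forall x, f_ ^~ x @ \oo --> f x &
        forall n x, `|f_ n x| <= `|f x|].
Proof.
move=> Q1 QD QZ.
have Q0 : Q (fun=> 0).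
  have := QZ 0 _ (Q1 _ measurableT); congr Q; apply/funext => x.
  by rewrite mul0r.
have pos (f : T -> R) : measurable_fun setT f -> (forall x, 0 <= f x) ->
    exists f_ : nat -> T -> R,
    [/\ forall n, Q (f_ n), forall x, f_ ^~ x @ \oo --> f x &
        forall n x, 0 <= f_ n x <= f x].
  move=> mf f0; have mf' : measurable_fun setT (EFin \o f) by exact/measurable_EFinP.
  pose h := nnsfun_approx measurableT mf'.
  have ch x : h ^~ x @ \oo --> f x.
    have : (EFin \o h ^~ x) @ \oo --> (f x)%:E.
      by apply: cvg_nnsfun_approx => // y _ /=; rewrite lee_fin.
    by move/fine_cvg.
  exists (fun n => h n); split => //.
  - move=> n.
    have -> : (h n : T -> R) = (fun x => \sum_(y <- finmap.enum_fset (fset_set (range (h n))))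
        y * \1_(h n @^-1` [set y]) x).
      by apply/funext => x; rewrite fimfunE fsbig_finite.
    elim: (finmap.enum_fset _) => [|y s IH].
      by under eq_fun do rewrite big_nil.
    by under eq_fun do rewrite big_cons; apply: QD => //; exact/QZ/Q1.
  - move=> n x; apply/andP; split; first exact: fun_ge0.
    have nd : nondecreasing_seq (h ^~ x).
      move=> a b ab; have := @nd_nnsfun_approx _ _ _ _ measurableT _ mf' _ _ ab.
      by move=> /lefP; apply.
    rewrite -(cvg_lim _ (ch x))//; apply: nondecreasing_cvgn_le => //.
    by apply/cvg_ex; exists (f x); exact: ch.
move=> f mf.
have [p [Qp cp p0]] : exists f_ : nat -> T -> R,
    [/\ forall n, Q (f_ n), forall x, f_ ^~ x @ \oo --> f^\+ x &
        forall n x, 0 <= f_ n x <= f^\+ x].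
  by apply: pos; [exact: measurable_funrpos|move=> x; exact: funrpos_ge0].
have [m [Qm cm m0]] : exists f_ : nat -> T -> R,
    [/\ forall n, Q (f_ n), forall x, f_ ^~ x @ \oo --> f^\- x &
        forall n x, 0 <= f_ n x <= f^\- x].
  by apply: pos; [exact: measurable_funrneg|move=> x; exact: funrneg_ge0].
exists (fun n x => p n x - m n x); split.
- move=> n; have := QD _ _ (Qp n) (QZ (-1) _ (Qm n)); congr Q.
  by apply/funext => x; rewrite mulN1r.
- move=> x; have -> : f x = f^\+ x - f^\- x.
    by rewrite -[in LHS](funrposBneg f).
  exact: cvgB.
- move=> n x; have /andP[p1 p2] := p0 n x; have /andP[m1 m2] := m0 n x.
  have <- : f^\+ x + f^\- x = `|f x|.
    by have /(congr1 (fun g => g x)) := funrposDneg f.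
  by rewrite ler_norml; apply/andP; split; lra.
Qed.

Definition sub_sigma d (T : measurableType d) (G : set (set T)) :=
  sigma_algebra setT G /\ G `<=` measurable.

Notation gmeas G Z := (measurable_fun (setT : set (g_sigma_algebraType G)) Z).

Section sub_sigma_theory.
Context d (T : measurableType d) (R : realType).
Implicit Types (G H : set (set T)) (Z : T -> R).

Lemma sub_sigma_gen (A : set (set T)) : A `<=` measurable -> sub_sigma <<s A >>.
Proof.
move=> Am; split; first exact: smallest_sigma_algebra.
by apply: smallest_sub => //; exact: sigma_algebra_measurable.
Qed.

(** The type [g_sigma_algebraType G] carries the sigma-algebra generated by [G]; when [G] is already
    one, nothing is added, and membership in [G] and measurability can be exchanged freely. *)
Lemma gmeas_measE G (A : set T) : sub_sigma G ->
  (measurable (A : set (g_sigma_algebraType G))) = G A.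
Proof. by move=> [sG _]; rewrite -[in RHS](sigma_algebra_id sG). Qed.

Lemma gmeas_sub G H Z : sub_sigma G -> sub_sigma H -> G `<=` H ->
  gmeas G Z -> gmeas H Z.
Proof.
move=> sG sH GH mZ mT B mB; have := mZ measurableT B mB.
by rewrite gmeas_measE// gmeas_measE//; exact: GH.
Qed.

Lemma gmeas_meas G Z : sub_sigma G -> gmeas G Z -> measurable_fun setT Z.
Proof.
move=> sG mZ mT B mB; have := mZ measurableT B mB.
by rewrite gmeas_measE//; exact: sG.2.
Qed.

Lemma gmeas_indic G A : sub_sigma G -> G A -> gmeas G (\1_A : T -> R).
Proof. by move=> sG GA; apply: measurable_indic; rewrite gmeas_measE. Qed.

Lemma sub_sigmaI G A B : sub_sigma G -> G A -> G B -> G (A `&` B).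
Proof.
move=> sG; rewrite -!(gmeas_measE _ sG); exact: measurableI.
Qed.

Lemma sub_sigmaT G : sub_sigma G -> G setT.
Proof. by move=> sG; rewrite -(gmeas_measE _ sG); exact: measurableT. Qed.

End sub_sigma_theory.

Section condexp_existence.
Context d (T : measurableType d) (R : realType) (P : probability T R).
Variables (G : set (set T)).
Hypothesis sG : sub_sigma G.

(** Radon-Nikodym for the charge A |-> int_A Y against P, both restricted to [G]. The restriction is
    written as the push-forward under the identity map from [T] to [T] equipped with [G]. *)
Lemma condexp_exists (Y : T -> R) : intg P setT Y ->
  exists Z, is_condexp P G Y Z.
Proof.
move=> iY; pose gT := g_sigma_algebraType G.
have mid : measurable_fun setT (id : T -> gT).
  by move=> _ B mB; rewrite setTI; apply: sG.2; rewrite -gmeas_measE.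
pose X : {RV P >-> gT} := mfun_Sub (mem_set mid).
pose PG : probability gT R := distribution P X.
unshelve epose (nu := (@pushforward _ _ T gT R (induced_charge iY) (id : T -> gT) : {charge set gT -> \bar R})).
  exact: mid.
have nuPG : nu `<< PG.
  apply/null_content_dominatesP => A mA A0; apply: null_set_integral => //.
  - by apply: sG.2; rewrite -gmeas_measE.
  - exact/measurable_funTS/(measurable_int _ iY).
pose f := Radon_Nikodym nu PG.
have fi : PG.-integrable setT f by exact: Radon_Nikodym_integrable.
have mf : measurable_fun setT f by exact: measurable_int fi.
have ff x : f x \is a fin_num by exact: Radon_Nikodym_fin_num.
have mZ : gmeas G (fine \o f) by exact: measurableT_comp.
have fE : EFin \o (fine \o f) = f by apply/funext => x /=; rewrite fineK.
have fiP : P.-integrable setT f.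
  apply/integrableP; split; first by rewrite -fE; apply/measurable_EFinP; exact: gmeas_meas mZ.
  have /integrableP[_] := fi.
  rewrite ge0_integral_pushforward//; first exact: measurableT_comp.
exists (fine \o f); split => //; first by rewrite fE.
move=> A GA; have mA : measurable (A : set gT) by rewrite gmeas_measE.
transitivity (nu A) => //.
rewrite (Radon_Nikodym_integral nuPG mA) /PG.
rewrite /distribution integral_pushforward//=.
- by apply: eq_integral => x _; rewrite fineK.
- by apply: (integrableS measurableT _ _ fiP) => //; exact: sG.2.
Qed.
End condexp_existence.

Section condexp_theory.
Context d (T : measurableType d) (R : realType) (P : probability T R).
Local Notation E f := (Rintegral P setT f).
Local Notation pint := (intg P setT).
Implicit Types (G H : set (set T)) (D X Y Z xi : T -> R).

Lemma intg_indic X A : pint X -> measurable A -> pint (fun w => X w * \1_A w).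
Proof.
move=> Xi mA; apply: (intg_bounded measurableT (M := 1)) => // w _.
by rewrite indicE; case: (_ \in _); rewrite ?normr1 ?normr0.
Qed.

Lemma E_indic X A : E (fun w => X w * \1_A w) = Rintegral P A X.
Proof.
by rewrite [RHS]Rintegral_mkcond; apply: eq_Rintegral => w _; rewrite patch_indic.
Qed.

Lemma is_condexpP G Y Z : sub_sigma G -> pint Y ->
  is_condexp P G Y Z <->
  [/\ gmeas G Z, pint Z & forall A, G A ->
      E (fun w => Z w * \1_A w) = E (fun w => Y w * \1_A w)].
Proof.
move=> sG Yi; split=> -[mZ Zi h]; split => // A GA.
  by rewrite !E_indic /Rintegral h.
have mA := sG.2 _ GA.
have iA X : pint X -> intg P A X by move=> Xi; exact: (integrableS measurableT _ _ Xi).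
rewrite (intgE mA (iA _ Zi)) (intgE mA (iA _ Yi)); congr EFin.
by rewrite -(E_indic Z) -(E_indic Y) h.
Qed.

(** Linearity extends the hypothesis to simple factors; dominated convergence with dominating
    function [|D * xi|] reaches [xi], so integrability of the product alone suffices. *)
Lemma orthogonal_indic G D xi : sub_sigma G -> pint D ->
  (forall A, G A -> E (fun w => D w * \1_A w) = 0) ->
  gmeas G xi -> pint (fun w => D w * xi w) -> E (fun w => D w * xi w) = 0.
Proof.
move=> sG Di D0 mxi Dxi.
pose Q (f : T -> R) := [/\ gmeas G f, pint (fun w => D w * f w) &
  E (fun w => D w * f w) = 0].
have [|||f_ [Qf cf bf]] := @simple_approx _ (g_sigma_algebraType G) R Q _ _ _ xi mxi.
- move=> A; rewrite gmeas_measE// => GA; split.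
  + exact: gmeas_indic.
  + by apply: intg_indic => //; exact: sG.2.
  + exact: D0.
- move=> f g [mf fi f0] [mg gi g0]; split.
  + exact: measurable_funD.
  + have := intgD measurableT fi gi; apply: intg_eq => //.
    by move=> w _; rewrite mulrDr.
  + rewrite -[RHS]addr0 -{1}f0 -g0 -IntD//.
    by apply: eq_Rintegral => w _; rewrite mulrDr.
- move=> c f [mf fi f0]; split.
  + exact: measurable_funM.
  + have := intgZ measurableT c fi; apply: intg_eq => //.
    by move=> w _; rewrite mulrCA.
  + rewrite -[RHS](mulr0 c) -f0 -IntZ//.
    by apply: eq_Rintegral => w _; rewrite mulrCA.
have [] := @Int_dominated _ _ _ P setT measurableT
    (fun n w => D w * f_ n w) (fun w => D w * xi w) (fun w => `|D w * xi w|)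
    _ _ _ (intg_abs measurableT Dxi) _.
- by move=> n; have [_ + _] := Qf n; exact: intg_meas.
- exact: (intg_meas Dxi).
- by apply: nearW => w _ /=; apply: cvgMr; exact: cf.
- by move=> n; apply: nearW => w _; rewrite !normrM ler_wpM2l.
move=> _ _; have -> : (fun n => E (fun w => D w * f_ n w)) = (fun=> 0).
  by apply/funext => n; have [] := Qf n.
by move/cvg_lim => <- //; exact: lim_cst.
Qed.

(** The main computing tool. Integrability of the two products is left as a hypothesis because it
    comes from different sources: boundedness, Cauchy-Schwarz or Hölder. *)
Lemma condexp_pull_out G Y Z xi : sub_sigma G -> pint Y -> is_condexp P G Y Z ->
  gmeas G xi -> pint (fun w => Y w * xi w) -> pint (fun w => Z w * xi w) ->
  E (fun w => Z w * xi w) = E (fun w => Y w * xi w).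
Proof.
move=> sG Yi /(is_condexpP _ sG Yi)[mZ Zi h] mxi Yxi Zxi.
apply/eqP; rewrite -subr_eq0 -IntB//; apply/eqP.
transitivity (E (fun w => (Z w - Y w) * xi w)).
  by apply: eq_Rintegral => w _; rewrite mulrBl.
apply: (@orthogonal_indic G) => //; first exact: intgB.
- move=> A GA; have mA := sG.2 _ GA.
  transitivity (E (fun w => Z w * \1_A w - Y w * \1_A w)).
    by apply: eq_Rintegral => w _; rewrite mulrBl.
  by rewrite IntB ?h ?subrr//; exact: intg_indic.
- have := intgB measurableT Zxi Yxi; apply: intg_eq => // w _.
  by rewrite mulrBl.
Qed.

Lemma condexp_pull_out_bounded G Y Z xi M : sub_sigma G -> pint Y ->
  is_condexp P G Y Z -> gmeas G xi -> (forall w, `|xi w| <= M) ->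
  E (fun w => Z w * xi w) = E (fun w => Y w * xi w).
Proof.
move=> sG Yi YZ mxi xiM; have [_ Zi _] := YZ.
apply: condexp_pull_out YZ _ _ _ => //;
  by apply: (intg_bounded measurableT (M := M)) => //; exact: gmeas_meas mxi.
Qed.

Lemma condexp_mean G Y Z : sub_sigma G -> pint Y -> is_condexp P G Y Z ->
  E Z = E Y.
Proof.
move=> sG Yi [_ Zi /(_ setT (sub_sigmaT sG))].
by rewrite (intgE measurableT Zi) (intgE measurableT Yi) => -[].
Qed.

(** Testing against the sign of [Z], which is [G]-measurable and bounded by 1, turns E|Z| into an
    expectation of [Y] times a sign. *)
Lemma condexp_L1 G Y Z : sub_sigma G -> pint Y -> is_condexp P G Y Z ->
  E (fun w => `|Z w|) <= E (fun w => `|Y w|).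
Proof.
move=> sG Yi YZ; have [mZ Zi _] := YZ.
pose A := [set w | 0 <= Z w].
have GA : G A.
  have := mZ measurableT `[0, +oo[%classic (measurable_itv _).
  rewrite setTI gmeas_measE//; congr (G _); apply/seteqP.
  by split => w /=; rewrite in_itv/= andbT.
pose xi w : R := 2 * \1_A w - 1.
have xiE w : xi w = if 0 <= Z w then 1 else -1.
  rewrite /xi indicE; case: ifPn => h.
    by rewrite mem_set//= mulr1; lra.
  by rewrite memNset//=; [rewrite mulr0; lra|exact/negP].
have xi1 w : `|xi w| <= 1 by rewrite xiE; case: ifP; rewrite ?normrN normr1.
have mxi : gmeas G xi.
  by apply: measurable_funB => //; apply: measurable_funM => //; exact: gmeas_indic.
have -> : E (fun w => `|Z w|) = E (fun w => Z w * xi w).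
  apply: eq_Rintegral => w _; rewrite xiE; case: ifPn => h.
    by rewrite ger0_norm// mulr1.
  by rewrite ltr0_norm ?ltNge// mulrN1.
rewrite (condexp_pull_out_bounded sG Yi YZ mxi xi1).
apply: Int_le => //.
- by apply: (intg_bounded measurableT (M := 1)) => //; exact: gmeas_meas mxi.
- exact: intg_abs.
- move=> w _; apply: le_trans (ler_norm _) _.
  by rewrite normrM ler_piMr.
Qed.

Lemma condexp_sub G Y Y' Z Z' : sub_sigma G -> pint Y -> pint Y' ->
  is_condexp P G Y Z -> is_condexp P G Y' Z' ->
  is_condexp P G (fun w => Y w - Y' w) (fun w => Z w - Z' w).
Proof.
move=> sG Yi Yi' /(is_condexpP _ sG Yi)[mZ Zi h] /(is_condexpP _ sG Yi')[mZ' Zi' h'].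
apply/is_condexpP => //; first exact: intgB.
split; [exact: measurable_funB|exact: intgB|move=> A GA].
have mA := sG.2 _ GA.
under eq_Rintegral do rewrite mulrBl; under [RHS]eq_Rintegral do rewrite mulrBl.
by rewrite IntB ?IntB ?h ?h'//; exact: intg_indic.
Qed.

Lemma condexpZ G c Y Z : sub_sigma G -> pint Y -> is_condexp P G Y Z ->
  is_condexp P G (fun w => c * Y w) (fun w => c * Z w).
Proof.
move=> sG Yi /(is_condexpP _ sG Yi)[mZ Zi h].
apply/is_condexpP => //; first exact: intgZ.
split; [exact: measurable_funM|exact: intgZ|move=> A GA].
have mA := sG.2 _ GA.
under eq_Rintegral do rewrite -mulrA; under [RHS]eq_Rintegral do rewrite -mulrA.
by rewrite !IntZ ?h//; exact: intg_indic.
Qed.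

Lemma condexpD G Y Y' Z Z' : sub_sigma G -> pint Y -> pint Y' ->
  is_condexp P G Y Z -> is_condexp P G Y' Z' ->
  is_condexp P G (fun w => Y w + Y' w) (fun w => Z w + Z' w).
Proof.
move=> sG Yi Yi' YZ YZ'.
have := condexp_sub sG Yi (intgZ measurableT (-1) Yi') YZ (condexpZ (-1) sG Yi' YZ').
by under eq_fun do rewrite mulN1r opprK; under [X in is_condexp _ _ _ X]eq_fun do rewrite mulN1r opprK.
Qed.

Lemma condexp_unique G Y Z Z' : sub_sigma G -> pint Y ->
  is_condexp P G Y Z -> is_condexp P G Y Z' -> {ae P, forall w, Z w = Z' w}.
Proof.
move=> sG Yi YZ YZ'; have ZZ := condexp_sub sG Yi Yi YZ YZ'.
have := condexp_L1 sG (intgB measurableT Yi Yi) ZZ.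
have [_ Zi _] := ZZ.
under [X in _ <= X]eq_Rintegral do rewrite subrr normr0.
rewrite Rintegral_cst// mul0r => h.
have pos : {ae P, forall w, setT w -> 0 <= `|Z w - Z' w|} by apply: aeW.
have := Int_eq0_ae measurableT (intg_abs measurableT Zi) pos h.
apply: filterS => w /(_ I)/eqP.
by rewrite normr_eq0 subr_eq0 => /eqP.
Qed.

Lemma condexp_L1_dist G Y Y' Z Z' : sub_sigma G -> pint Y -> pint Y' ->
  is_condexp P G Y Z -> is_condexp P G Y' Z' ->
  E (fun w => `|Z w - Z' w|) <= E (fun w => `|Y w - Y' w|).
Proof.
move=> sG Yi Yi' YZ YZ'.
exact: (condexp_L1 sG (intgB measurableT Yi Yi') (condexp_sub sG Yi Yi' YZ YZ')).
Qed.

Lemma condexp_id G Y : gmeas G Y -> pint Y -> is_condexp P G Y Y.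
Proof. by []. Qed.

Lemma condexp_tower G H Y Z W : sub_sigma G -> sub_sigma H -> H `<=` G ->
  is_condexp P G Y Z -> is_condexp P H Y W <-> is_condexp P H Z W.
Proof.
move=> sG sH HG [mZ Zi h]; split=> -[mW Wi k]; split => // A HA; rewrite k//.
  by rewrite h//; exact: HG.
by rewrite -h//; exact: HG.
Qed.

Lemma condexp_congr_ae G Y Z Z' : sub_sigma G -> gmeas G Z' ->
  {ae P, forall w, Z w = Z' w} -> is_condexp P G Y Z -> is_condexp P G Y Z'.
Proof.
move=> sG mZ' ZZ' [mZ Zi h].
have mZT := gmeas_meas sG mZ; have mZT' := gmeas_meas sG mZ'.
split => //.
  by apply: (intg_ae measurableT mZT' _ Zi); apply: filterS ZZ' => w.
move=> A GA; rewrite -h//; apply: ae_eq_integral => //.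
- exact: sG.2.
- by apply/measurable_EFinP; exact: measurable_funTS.
- by apply/measurable_EFinP; exact: measurable_funTS.
- by apply: filterS ZZ' => w /= -> _.
Qed.

(** Dynkin's theorem: the events orthogonal to [D] are closed under complements and disjoint
    countable unions. The condition [E D = 0] stands for the whole space, which need not belong to
    the pi-system. *)
Lemma orthogonal_pi (C : set (set T)) D : setI_closed C -> C `<=` measurable ->
  pint D -> E D = 0 -> (forall A, C A -> E (fun w => D w * \1_A w) = 0) ->
  forall A, <<s C >> A -> E (fun w => D w * \1_A w) = 0.
Proof.
move=> CI Cm Di D0 DC.
pose Q := [set A | measurable A /\ E (fun w => D w * \1_A w) = 0].
suff : <<s C >> `<=` Q by move=> h A /h [].
rewrite -(setI_closed_g_dynkin_g_sigma_algebra CI).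
apply: smallest_sub; last by move=> A CA; split; [exact: Cm|exact: DC].
split.
- split => //; rewrite -[RHS]D0; apply: eq_Rintegral => w _.
  by rewrite indicT mulr1.
- move=> A [mA A0]; split; first exact: measurableC.
  transitivity (E (fun w => D w - D w * \1_A w)).
    by apply: eq_Rintegral => w _; rewrite !indicE in_setC; case: (_ \in _);
      rewrite /= ?mulr1 ?mulr0 ?subrr ?subr0.
  by rewrite IntB ?D0 ?A0 ?subr0//; exact: intg_indic.
- move=> F tF FQ; have mF k : measurable (F k) by have [] := FQ k.
  have mU : measurable (\bigcup_k F k) by exact: bigcup_measurable.
  split => //; rewrite E_indic /Rintegral integral_bigcup//=; last first.
    by apply: integrableS Di.
  rewrite eseries0// => k _ _.
  rewrite (@intgE _ _ _ _ _ (mF k)); last exact: (integrableS measurableT _ _ Di).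
  by rewrite -E_indic; have [_ ->] := FQ k.
Qed.

Lemma condexp_pi (C : set (set T)) Y Z : setI_closed C -> C `<=` measurable ->
  pint Y -> gmeas <<s C >> Z -> pint Z -> E Z = E Y ->
  (forall A, C A -> E (fun w => Z w * \1_A w) = E (fun w => Y w * \1_A w)) ->
  is_condexp P <<s C >> Y Z.
Proof.
move=> CI Cm Yi mZ Zi ZY h; apply/is_condexpP => //; first exact: sub_sigma_gen.
split => // A CA.
have mA : measurable A by have [_] := sub_sigma_gen Cm; exact.
apply/eqP; rewrite -subr_eq0 -IntB//; [|exact: intg_indic..]; apply/eqP.
under eq_Rintegral do rewrite -mulrBl.
apply: (orthogonal_pi CI Cm) CA => //; first exact: intgB.
- by rewrite IntB// ZY subrr.
- move=> B CB; have mB := Cm _ CB; under eq_Rintegral do rewrite mulrBl.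
  by rewrite IntB ?h ?subrr//; exact: intg_indic.
Qed.

End condexp_theory.

(** * Hoelder duality *)

Section real_powers.
Context (R : realType).
Implicit Types (p q x y : R).

(** The derivative of |x|^p / p, that is, the duality map of L^p before normalization. The factor
    [x] in front gives the value 0 at 0 for every exponent. *)
Definition dualf p x := x * `|x| `^ (p - 2).

Lemma mulr_dualf p x : 1 < p -> x * dualf p x = `|x| `^ p.
Proof.
move=> p1; rewrite /dualf mulrA -expr2 -real_normK ?num_real// expr2.
have e : p - 2 = p - 1 - 1 by ring.
rewrite -mulrA e mulr_powRB1// ?subr_gt0// mulr_powRB1//; lra.
Qed.

Lemma norm_dualf p x : 1 < p -> `|dualf p x| = `|x| `^ (p - 1).
Proof.
move=> p1; rewrite /dualf normrM (ger0_norm (powR_ge0 _ _)).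
have e : p - 2 = p - 1 - 1 by ring.
by rewrite e mulr_powRB1// subr_gt0.
Qed.

Lemma young p q x y : 0 < p -> 0 < q -> p^-1 + q^-1 = 1 ->
  `|x * y| <= `|x| `^ p / p + `|y| `^ q / q.
Proof. by move=> p0 q0 pq; rewrite normrM conjugate_powR. Qed.

(** After the substitution a = exp(s/p), b = exp(t/q), Young's inequality is convexity of exp at the
    mean m = s/p + t/q. The tangent at m lies strictly below exp away from m, so equality forces s =
    m = t. *)
Lemma young_eq_pos p q (a b : R) : 0 < p -> 0 < q -> p^-1 + q^-1 = 1 ->
  0 < a -> 0 < b -> a * b = a `^ p / p + b `^ q / q -> a `^ p = b `^ q.
Proof.
move=> p0 q0 pq a0 b0.
rewrite /powR !gt_eqF//.
set s := p * ln a; set t := q * ln b.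
pose m := s / p + t / q.
have -> : a * b = expR m.
  by rewrite /m /s /t !(mulrC _ (ln _)) !mulfK ?gt_eqF// expRD !lnK.
move=> h.
have es : expR s = expR m * expR (s - m) by rewrite -expRD; congr expR; ring.
have et : expR t = expR m * expR (t - m) by rewrite -expRD; congr expR; ring.
have m0 := expR_gt0 m.
have pi0 : 0 < p^-1 by rewrite invr_gt0.
have qi0 : 0 < q^-1 by rewrite invr_gt0.
have key : (s - m) * p^-1 + (t - m) * q^-1 = 0.
  have -> : (s - m) * p^-1 + (t - m) * q^-1 = (s / p + t / q) - m * (p^-1 + q^-1) by ring.
  by rewrite pq mulr1 subrr.
have one : 1 = expR (s - m) * p^-1 + expR (t - m) * q^-1.
  apply: (mulfI (lt0r_neq0 m0)); rewrite mulr1 {1}h es et; ring.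
have [sm|sm] := eqVneq (s - m) 0.
  move: key; rewrite sm mul0r add0r => /eqP; rewrite mulf_eq0 (gt_eqF qi0) orbF => /eqP tm.
  by rewrite es et sm tm.
have := expR_gt1Dx sm; have := expR_ge1Dx (t - m) => h1 h2; exfalso.
have : (1 + (s - m)) * p^-1 < expR (s - m) * p^-1 by rewrite ltr_pM2r.
have : (1 + (t - m)) * q^-1 <= expR (t - m) * q^-1 by rewrite ler_pM2r.
rewrite !mulrDl !mul1r; lra.
Qed.

(** The right-hand side is positive when [x] is not 0, so equality without absolute values fixes the
    sign of [y] as well as its modulus. *)
Lemma young_eq p q x y : 1 < p -> 0 < q -> p^-1 + q^-1 = 1 ->
  x * y = `|x| `^ p / p + `|y| `^ q / q -> y = dualf p x.
Proof.
move=> p1 q0 pq h; have p0 : 0 < p by lra.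
have [x0|x0] := eqVneq x 0.
  move: h; rewrite /dualf x0 !mul0r normr0 powR0 ?gt_eqF// mul0r add0r => /esym/eqP.
  rewrite mulf_eq0 invr_eq0 (gt_eqF q0) orbF powR_eq0 => /andP[/eqP/normr0P/eqP->//].
have xp : 0 < `|x| by rewrite normr_gt0.
have xpp : 0 < `|x| `^ p / p by rewrite divr_gt0// powR_gt0.
have yq : 0 <= `|y| `^ q / q by rewrite divr_ge0 ?powR_ge0 ?ltW.
have xy : 0 < x * y by lra.
have y0 : y != 0 by apply: contraTN xy => /eqP ->; rewrite mulr0 ltxx.
have yp : 0 < `|y| by rewrite normr_gt0.
have e : `|x| * `|y| = `|x| `^ p / p + `|y| `^ q / q by rewrite -normrM gtr0_norm.
have ab := young_eq_pos p0 q0 pq xp yp e.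
have yE : `|y| = `|x| `^ (p - 1).
  have -> : `|y| = (`|y| `^ q) `^ q^-1 by rewrite -powRrM divff ?gt_eqF// powRr1.
  rewrite -ab -powRrM; congr powR.
  have -> : q^-1 = 1 - p^-1 by lra.
  by rewrite mulrBr mulr1 divff ?gt_eqF.
have xyE : x * y = `|x| `^ p by rewrite -(gtr0_norm xy) normrM yE mulr_powRB1// normr_ge0.
apply: (mulfI x0); rewrite xyE mulr_dualf//.
Qed.

Lemma powRV (a r : R) : 0 <= a -> a^-1 `^ r = (a `^ r)^-1.
Proof. by move=> a0; rewrite -powR_inv1// powRAC powR_inv1// powR_ge0. Qed.

Lemma powR_mono p q x : 0 <= x -> 0 <= p -> p <= q -> x `^ p <= 1 + x `^ q.
Proof.
move=> x0 p0 pq; have [x1|x1] := leP 1 x.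
  by apply: le_trans (ler_powR x1 pq) _; lra.
have : x `^ p <= 1.
  have [->|p0'] := eqVneq p 0; first by rewrite powRr0.
  rewrite -[X in _ <= X](_ : 1 `^ p = 1); last by rewrite powR1.
  by apply: ge0_ler_powR; rewrite ?nnegrE//; exact: ltW.
have := powR_ge0 x q; lra.
Qed.

Lemma powR_add_le p x y : 0 <= p ->
  `|x + y| `^ p <= 2 `^ p * (`|x| `^ p + `|y| `^ p).
Proof.
move=> p0; have m0 : 0 <= Order.max `|x| `|y| by rewrite le_max normr_ge0.
have h : `|x + y| <= 2 * Order.max `|x| `|y|.
  apply: le_trans (ler_normD _ _) _.
  have : `|x| <= Order.max `|x| `|y| by rewrite le_max lexx.
  have : `|y| <= Order.max `|x| `|y| by rewrite le_max lexx orbT.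
  lra.
apply: (@le_trans _ _ ((2 * Order.max `|x| `|y|) `^ p)).
  by apply: ge0_ler_powR => //; rewrite ?nnegrE ?mulr_ge0.
rewrite powRM// ler_pM2l ?powR_gt0//.
by have [h1|h1] := leP `|x| `|y|; [rewrite lerDr|rewrite lerDl]; exact: powR_ge0.
Qed.

Lemma powR2 x : `|x| `^ 2 = x ^+ 2.
Proof. by rewrite powR_mulrn// real_normK// num_real. Qed.

End real_powers.

Section moments.
Context d (T : measurableType d) (R : realType) (P : probability T R).
Local Notation E f := (Rintegral P setT f).
Local Notation pint := (intg P setT).
Implicit Types (X Y Z : T -> R) (p q : R).

Definition Lp p X := measurable_fun setT X /\ pint (fun w => `|X w| `^ p).

Definition L2 X := measurable_fun setT X /\ pint (fun w => X w ^+ 2).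

Lemma Lp2 X : Lp 2 X <-> L2 X.
Proof. by rewrite /Lp /L2; under eq_fun do rewrite powR2. Qed.

Lemma meas_absp p X : measurable_fun setT X ->
  measurable_fun setT (fun w => `|X w| `^ p).
Proof.
move=> mX; apply: (measurableT_comp (measurable_powR p)).
exact: measurableT_comp.
Qed.

Lemma meas_sq X : measurable_fun setT X -> measurable_fun setT (fun w => X w ^+ 2).
Proof. by move=> mX; exact: measurable_funX. Qed.

Lemma pint_cst (c : R) : pint (fun=> c).
Proof. exact: finite_measure_integrable_cst. Qed.

Lemma E_cst (c : R) : E (fun=> c) = c.
Proof. by rewrite Rintegral_cst//= probability_setT mulr1. Qed.

Lemma Lp_le p X Y : 0 <= p -> measurable_fun setT X -> (forall w, `|X w| <= `|Y w|) ->
  Lp p Y -> Lp p X.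
Proof.
move=> p0 mX XY [mY Yi]; split => //.
apply: (intg_le measurableT (meas_absp p mX)) Yi => w _.
rewrite ger0_norm ?powR_ge0//; apply: ge0_ler_powR => //; exact: nnegrE.
Qed.

Lemma LpD p X Y : 0 <= p -> Lp p X -> Lp p Y -> Lp p (fun w => X w + Y w).
Proof.
move=> p0 [mX Xi] [mY Yi]; have mXY := measurable_funD mX mY; split => //.
apply: (intg_le measurableT (meas_absp p mXY) _ (intgZ measurableT (2 `^ p) (intgD measurableT Xi Yi))).
move=> w _; rewrite ger0_norm ?powR_ge0//; exact: powR_add_le.
Qed.

Lemma LpZ p c X : 0 <= p -> Lp p X -> Lp p (fun w => c * X w).
Proof.
move=> p0 [mX Xi]; have mcX : measurable_fun setT (fun w => c * X w) by exact: measurable_funM.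
split => //; apply: (intg_eq measurableT _ (intgZ measurableT (`|c| `^ p) Xi)).
by move=> w _; rewrite normrM powRM.
Qed.

Lemma LpN p X : 0 <= p -> Lp p X -> Lp p (fun w => - X w).
Proof.
move=> p0 /(LpZ (-1) p0); congr Lp; apply/funext => w; by rewrite mulN1r.
Qed.

Lemma LpB p X Y : 0 <= p -> Lp p X -> Lp p Y -> Lp p (fun w => X w - Y w).
Proof. by move=> p0 Xp Yp; apply: LpD => //; exact: LpN. Qed.

Lemma Lp_bounded p X M : 0 <= p -> measurable_fun setT X -> (forall w, `|X w| <= M) ->
  Lp p X.
Proof.
move=> p0 mX XM; split => //.
apply: (intg_le measurableT (meas_absp p mX) _ (pint_cst (M `^ p))) => w _.
rewrite ger0_norm ?powR_ge0//; apply: ge0_ler_powR; rewrite ?nnegrE//.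
exact: le_trans (XM w).
Qed.

Lemma Lp_cst p c : 0 <= p -> Lp p (fun=> c).
Proof. by move=> p0; apply: (@Lp_bounded _ _ `|c|). Qed.

Lemma Lp_mono p q X : 0 <= p -> p <= q -> Lp q X -> Lp p X.
Proof.
move=> p0 pq [mX Xi]; split => //.
apply: (intg_le measurableT (meas_absp p mX) _ (intgD measurableT (pint_cst 1) Xi)) => w _.
by rewrite ger0_norm ?powR_ge0//; exact: powR_mono.
Qed.

Lemma Lp_pint p X : 1 <= p -> Lp p X -> pint X.
Proof.
move=> p1 /(Lp_mono ler01 p1)[mX Xi].
apply: (intg_le measurableT mX _ Xi) => w _; by rewrite powRr1.
Qed.

Lemma Lp_mul p q X Y : 0 < p -> 0 < q -> p^-1 + q^-1 = 1 -> Lp p X -> Lp q Y ->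
  pint (fun w => X w * Y w).
Proof.
move=> p0 q0 pq [mX Xi] [mY Yi].
apply: (intg_le measurableT (measurable_funM mX mY) _
  (intgD measurableT (intgZ measurableT p^-1 Xi) (intgZ measurableT q^-1 Yi))) => w _.
by rewrite ![_^-1 * _]mulrC; exact: young.
Qed.

Lemma norm_lty p X : p != 0 -> measurable_fun setT X -> (norm P p X < +oo)%E -> Lp p X.
Proof.
move=> p0 mX Xoo; split => //; apply: (intg_ge0 (meas_absp p mX)).
  by move=> w _; exact: powR_ge0.
have := poweR_lty p Xoo; rewrite /norm powR_Lnorm//.
Qed.

Lemma normE p X : p != 0 -> Lp p X -> norm P p X = ((E (fun w => `|X w| `^ p)) `^ p^-1)%:E.
Proof.
move=> p0 [mX Xi]; rewrite /norm unlock -poweR_EFin -(intgE measurableT Xi).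
by congr (_ `^ _)%E; apply: eq_integral => w _.
Qed.

Lemma norm_le1 p X : 0 < p -> measurable_fun setT X ->
  (norm P p X <= 1)%E <-> Lp p X /\ E (fun w => `|X w| `^ p) <= 1.
Proof.
move=> p0 mX; have p0' : p != 0 by rewrite gt_eqF.
have E0 : 0 <= E (fun w => `|X w| `^ p) by apply: Rintegral_ge0 => w _; exact: powR_ge0.
split=> [h|[Xp h]].
  have Xp : Lp p X by apply: norm_lty => //; apply: le_lt_trans h _; rewrite ltry.
  split => //; move: h; rewrite normE// lee_fin => h.
  have := @ge0_ler_powR _ p (ltW p0) _ _ _ _ h.
  rewrite -powRrM mulVf// powRr1// powR1; apply; rewrite nnegrE//; exact: powR_ge0.
rewrite normE// lee_fin -[X in _ <= X](_ : 1 `^ p^-1 = 1); last by rewrite powR1.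
by apply: ge0_ler_powR; rewrite ?nnegrE ?invr_ge0// ltW.
Qed.

Lemma hoelder_unit p q X Y : 1 < p -> 0 < q -> p^-1 + q^-1 = 1 -> Lp p X -> Lp q Y ->
  E (fun w => `|Y w| `^ q) <= 1 ->
  E (fun w => X w * Y w) <= (E (fun w => `|X w| `^ p)) `^ p^-1.
Proof.
move=> p1 q0 pq [mX Xi] [mY Yi] Y1; have p0 : 0 < p by lra.
have XYi := Lp_mul p0 q0 pq (conj mX Xi) (conj mY Yi).
set m := E (fun w => `|X w| `^ p).
have m0 : 0 <= m by apply: Rintegral_ge0 => w _; exact: powR_ge0.
(* Young's inequality is applied to X/c and Y. The norm of [X] may vanish, so the scale [c]
   approaches it from above instead of being equal to it. *)
have key (c : R) : 0 < c -> m <= c `^ p -> E (fun w => X w * Y w) <= c.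
  move=> c0 mc.
  have h : E (fun w => c^-1 * (X w * Y w)) <=
      E (fun w => (p^-1 * (c `^ p)^-1) * `|X w| `^ p + q^-1 * `|Y w| `^ q).
    apply: Int_le => //; first exact: intgZ.
      by apply: intgD => //; exact: intgZ.
    move=> w _; apply: le_trans (ler_norm _) _; rewrite mulrA.
    apply: le_trans (young _ _ p0 q0 pq) _.
    rewrite normrM powRM// (gtr0_norm (_ : 0 < c^-1)) ?invr_gt0//.
    have -> : c^-1 `^ p = (c `^ p)^-1 by apply: powRV; exact: ltW.
    by rewrite [X in X <= _](_ : _ = p^-1 / c `^ p * `|X w| `^ p + q^-1 * `|Y w| `^ q)//; ring.
  move: h; rewrite IntZ// IntD ?IntZ//; [|exact: intgZ..].
  rewrite -/m => h.
  have cp : 0 < c `^ p by exact: powR_gt0.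
  have h2 : p^-1 / c `^ p * m <= p^-1.
    rewrite -mulrA; apply: ler_piMr; first by rewrite invr_ge0 ltW.
    by rewrite mulrC ler_pdivrMr ?mul1r.
  have h3 : q^-1 * E (fun w => `|Y w| `^ q) <= q^-1.
    by apply: ler_piMr; first by rewrite invr_ge0 ltW.
  have : c^-1 * E (fun w => X w * Y w) <= 1 by lra.
  by rewrite mulrC ler_pdivrMr// mul1r.
apply/ler_addgt0Pr => e e0; apply: key; first by apply: ltr_wpDl => //; exact: powR_ge0.
have {1}-> : m = (m `^ p^-1) `^ p by rewrite -powRrM mulVf ?gt_eqF// powRr1.
apply: ge0_ler_powR; first exact: ltW.
- by rewrite nnegrE powR_ge0.
- by rewrite nnegrE addr_ge0 ?powR_ge0 ?ltW.
- by rewrite lerDl ltW.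
Qed.

(** The defect [D] in Young's inequality for X/N and Y is nonnegative and has expectation at most 0,
    so it vanishes almost surely and [young_eq] applies pointwise. *)
Lemma hoelder_unit_eq p q X Y : 1 < p -> 0 < q -> p^-1 + q^-1 = 1 -> Lp p X -> Lp q Y ->
  E (fun w => `|Y w| `^ q) <= 1 -> let N := (E (fun w => `|X w| `^ p)) `^ p^-1 in
  0 < N -> N <= E (fun w => X w * Y w) ->
  {ae P, forall w, Y w = dualf p (X w) / N `^ (p - 1)}.
Proof.
move=> p1 q0 pq [mX Xi] [mY Yi] Y1 N N0 h; have p0 : 0 < p by lra.
have XYi := Lp_mul p0 q0 pq (conj mX Xi) (conj mY Yi).
have NE : E (fun w => `|X w| `^ p) = N `^ p.
  rewrite /N -powRrM mulVf ?gt_eqF// powRr1//.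
  by apply: Rintegral_ge0 => w _; exact: powR_ge0.
have Np : 0 < N `^ p by exact: powR_gt0.
have Ni : N^-1 `^ p = (N `^ p)^-1.
  exact: powRV (ltW N0).
pose D w := (p^-1 / N `^ p * `|X w| `^ p + q^-1 * `|Y w| `^ q) - N^-1 * (X w * Y w).
have DE w : D w = (`|N^-1 * X w| `^ p / p + `|Y w| `^ q / q) - (N^-1 * X w) * Y w.
  rewrite /D normrM powRM// (gtr0_norm (_ : 0 < N^-1)) ?invr_gt0// Ni; ring.
have D0 w : 0 <= D w.
  by rewrite DE subr_ge0; apply: le_trans (ler_norm _) _; exact: young.
have i1 : pint (fun w => p^-1 / N `^ p * `|X w| `^ p + q^-1 * `|Y w| `^ q).
  by apply: intgD => //; exact: intgZ.
have i2 : pint (fun w => N^-1 * (X w * Y w)) by exact: intgZ.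
have Di : pint D by exact: intgB.
have ED : E D <= 0.
  rewrite IntB// IntZ// IntD ?IntZ//; [|exact: intgZ..].
  rewrite NE mulfVK ?gt_eqF// subr_le0.
  have : q^-1 * E (fun w => `|Y w| `^ q) <= q^-1 by apply: ler_piMr; first by rewrite invr_ge0 ltW.
  have : 1 <= N^-1 * E (fun w => X w * Y w) by rewrite mulrC ler_pdivlMr ?mul1r.
  lra.
have := Int_eq0_ae measurableT Di (aeW P (fun w _ => D0 w)) ED.
apply: filterS => w /(_ I); rewrite DE => /subr0_eq/esym/(young_eq p1 q0 pq) ->.
rewrite /dualf normrM powRM// (gtr0_norm (_ : 0 < N^-1)) ?invr_gt0//.
have -> : N^-1 `^ (p - 2) = (N `^ (p - 2))^-1.
  exact: powRV (ltW N0).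
have -> : N `^ (p - 1) = N * N `^ (p - 2).
  have -> : p - 2 = p - 1 - 1 by ring.
  by rewrite mulr_powRB1 ?ltW// subr_gt0.
by rewrite invfM; ring.
Qed.

(** Contraction in L^r by self-testing: [Y] is paired with the dual power of [Z], cut off to the
    event {|Z| <= n} of [G] so as to be bounded. Young's inequality then lets the terms in [Z] be
    absorbed, and Fatou removes the cut-off. *)
Lemma condexp_Lp (G : set (set T)) r Y Z : sub_sigma G -> 1 < r -> Lp r Y ->
  is_condexp P G Y Z ->
  Lp r Z /\ E (fun w => `|Z w| `^ r) <= E (fun w => `|Y w| `^ r).
Proof.
move=> sG r1 Yr YZ; have [mZ Zi _] := YZ; have [mY Yi] := Yr.
have Y1 := Lp_pint (ltW r1) Yr.
have mZT := gmeas_meas sG mZ.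
have r0 : 0 < r by lra.
pose A n := [set w | `|Z w| <= n%:R].
have GA n : G (A n).
  have := mZ measurableT `[- n%:R, n%:R]%classic (measurable_itv _).
  rewrite setTI gmeas_measE//; congr (G _); apply/seteqP.
  by split => w; rewrite /A /= in_itv/= ler_norml.
have mA n : measurable (A n) by exact: sG.2.
pose s n w := dualf r (Z w) * \1_(A n) w.
have An n w : \1_(A n) w = (`|Z w| <= n%:R)%R%:R :> R.
  by rewrite indicE; congr (nat_of_bool _)%:R; apply/idP/idP; rewrite inE /A.
have sM n w : `|s n w| <= n%:R `^ (r - 1).
  rewrite /s normrM norm_dualf// An; have [h|h] := leP `|Z w| n%:R; rewrite /= ?mulr1n ?mulr0n.
    rewrite normr1 mulr1; apply: ge0_ler_powR; rewrite ?nnegrE//; lra.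
  by rewrite normr0 mulr0 powR_ge0.
have ms n : gmeas G (s n).
  apply: measurable_funM; last exact: gmeas_indic.
  apply: measurable_funM => //; apply: (measurableT_comp (measurable_powR _)).
  exact: measurableT_comp.
have q0 : 0 < 1 - r^-1 by rewrite subr_gt0 invf_lt1.
have pq : (((1 - r^-1)^-1)^-1 + r^-1) = 1 by rewrite invrK subrK.
have bound n : E (fun w => `|Z w| `^ r * \1_(A n) w) <= E (fun w => `|Y w| `^ r).
  set a := E _; have ai : pint (fun w => `|Z w| `^ r * \1_(A n) w).
    apply: (intg_le measurableT _ _ (pint_cst (n%:R `^ r))).
      by apply: measurable_funM => //; exact: meas_absp.
    move=> w _; rewrite An; have [h|h] := leP `|Z w| n%:R; rewrite /= ?mulr1n ?mulr0n.
      rewrite mulr1 ger0_norm ?powR_ge0//.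
      by apply: ge0_ler_powR; rewrite ?nnegrE// ltW.
    by rewrite mulr0 normr0 powR_ge0.
  have : a = E (fun w => Y w * s n w).
    rewrite -(condexp_pull_out_bounded sG Y1 YZ (ms n) (sM n)).
    by apply: eq_Rintegral => w _; rewrite /s mulrA mulr_dualf.
  move=> aE.
  (* The conjugate exponent of r is 1/(1 - 1/r), and the power of [s n] with this exponent is |Z|^r
     on the event. The left-hand side equals [a], so (1 - 1/r) [a] can be subtracted from both
     sides. *)
  have : E (fun w => Y w * s n w) <=
      E (fun w => r^-1 * `|Y w| `^ r + (1 - r^-1) * (`|Z w| `^ r * \1_(A n) w)).
    apply: Int_le => //.
    - apply: (intg_bounded measurableT Y1 (gmeas_meas sG (ms n))) => w _; exact: sM.
    - by apply: intgD => //; exact: intgZ.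
    move=> w _; apply: le_trans (ler_norm _) _.
    have q0' : 0 < (1 - r^-1)^-1 by rewrite invr_gt0.
    have pq' : r^-1 + ((1 - r^-1)^-1)^-1 = 1 by rewrite addrC.
    apply: le_trans (young (Y w) (s n w) r0 q0' pq') _.
    rewrite invrK mulrC lerD2l mulrC ler_pM2l//.
    rewrite /s normrM norm_dualf// An; have [h|h] := leP `|Z w| n%:R; rewrite /= ?mulr1n ?mulr0n.
      rewrite normr1 !mulr1 -powRrM.
      have -> : (r - 1) * (1 - r^-1)^-1 = r.
        have -> : 1 - r^-1 = (r - 1) / r by rewrite mulrBl mul1r divff ?gt_eqF.
        by rewrite invf_div mulrC mulfVK// gt_eqF// subr_gt0.
      exact: lexx.
    by rewrite normr0 !mulr0 powR0// invr_neq0// gt_eqF.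
  rewrite -aE IntD ?IntZ//; [|exact: intgZ..]; rewrite -/a => h.
  have : r^-1 * a <= r^-1 * E (fun w => `|Y w| `^ r) by lra.
  by rewrite ler_pM2l// invr_gt0.
have fat : (\int[P]_w (`|Z w| `^ r)%:E <= (E (fun w => `|Y w| `^ r))%:E)%E.
  apply: (@Int_fatou _ _ _ P setT measurableT (fun n w => `|Z w| `^ r * \1_(A n) w)).
  - by move=> n; apply: measurable_funM => //; exact: meas_absp.
  - exact: meas_absp.
  - by move=> n w _; rewrite mulr_ge0 ?powR_ge0.
  - apply: aeW => w _; apply: cvg_near_cst.
    have := nbhs_infty_ger `|Z w|; apply: filterS => n /= h.
    by rewrite An h mulr1.
  - move=> n; rewrite intgE ?lee_fin//.
    apply: (intg_le measurableT _ _ (pint_cst (n%:R `^ r))).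
      by apply: measurable_funM => //; exact: meas_absp.
    move=> w _; rewrite An; have [h|h] := leP `|Z w| n%:R; rewrite /= ?mulr1n ?mulr0n.
      rewrite mulr1 ger0_norm ?powR_ge0//.
      by apply: ge0_ler_powR; rewrite ?nnegrE// ltW.
    by rewrite mulr0 normr0 powR_ge0.
have Zr : Lp r Z.
  split => //; apply: (intg_ge0 (meas_absp r mZT)) => [w _|]; first exact: powR_ge0.
  by apply: le_lt_trans fat _; rewrite ltry.
by split => //; rewrite -lee_fin -(intgE measurableT Zr.2).
Qed.

End moments.

(** * Square-integrable variables and the normal law *)

Section square_integrable.
Context d (T : measurableType d) (R : realType) (P : probability T R).
Local Notation E f := (Rintegral P setT f).
Local Notation pint := (intg P setT).
Local Notation L2 := (L2 P).
Implicit Types (X Y Z : T -> R) (p q : R).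

Lemma L2_pint X : L2 X -> pint X.
Proof. by move=> /Lp2; apply: Lp_pint; rewrite ler1n. Qed.

Lemma L2D X Y : L2 X -> L2 Y -> L2 (fun w => X w + Y w).
Proof. by move=> /Lp2 h /Lp2 k; apply/Lp2; exact: LpD. Qed.

Lemma L2B X Y : L2 X -> L2 Y -> L2 (fun w => X w - Y w).
Proof. by move=> /Lp2 h /Lp2 k; apply/Lp2; exact: LpB. Qed.

Lemma L2Z c X : L2 X -> L2 (fun w => c * X w).
Proof. by move=> /Lp2 h; apply/Lp2; exact: LpZ. Qed.

Lemma L2_bounded X M : measurable_fun setT X -> (forall w, `|X w| <= M) -> L2 X.
Proof. by move=> mX h; apply/Lp2; exact: Lp_bounded h. Qed.

Lemma L2_mul X Y : L2 X -> L2 Y -> pint (fun w => X w * Y w).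
Proof.
move=> /Lp2 h /Lp2 k; apply: (@Lp_mul _ _ _ P 2 2) => //.
by rewrite -mulr2n -[_ *+ 2]mulr_natr mulVf.
Qed.

Lemma E_sq_ge0 X : 0 <= E (fun w => X w ^+ 2).
Proof. by apply: Rintegral_ge0 => w _; exact: sqr_ge0. Qed.

Lemma E_sqD X Y c : L2 X -> L2 Y -> E (fun w => (X w + c * Y w) ^+ 2) =
  E (fun w => X w ^+ 2) + 2 * c * E (fun w => X w * Y w) + c ^+ 2 * E (fun w => Y w ^+ 2).
Proof.
move=> X2 Y2; have XY := L2_mul X2 Y2.
transitivity (E (fun w => (X w ^+ 2 + (2 * c) * (X w * Y w)) + c ^+ 2 * Y w ^+ 2)).
  by apply: eq_Rintegral => w _; ring.
rewrite IntD ?IntD ?IntZ//; try exact: X2.2; try exact: Y2.2; try exact: intgZ.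
- by apply: intgD => //; [exact: X2.2|exact: intgZ].
- by apply: intgZ => //; exact: Y2.2.
Qed.

Lemma cauchy_schwarz_sq X Y : L2 X -> L2 Y ->
  (E (fun w => X w * Y w)) ^+ 2 <= E (fun w => X w ^+ 2) * E (fun w => Y w ^+ 2).
Proof.
move=> X2 Y2; have := fun c : R => E_sq_ge0 (fun w => X w + c * Y w).
move=> h0; have {h0} := fun c : R => eq_ind _ (fun z => 0 <= z) (h0 c) _ (E_sqD c X2 Y2).
 set a := E _; set b := E _; set e := E _ => h.
have a0 : 0 <= a by exact: E_sq_ge0.
have e0 : 0 <= e by exact: E_sq_ge0.
have [ez|en] := eqVneq e 0.
  have [->|bn] := eqVneq b 0; first by rewrite expr0n /= mulr_ge0.
  (* With E[Y^2] = 0 the quadratic in c is affine, and this value of c would make it equal to -1. *)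
  have := h (- (a + 1) / (2 * b)); rewrite ez mulr0 addr0.
  have -> : 2 * (- (a + 1) / (2 * b)) * b = - (a + 1) by field.
  lra.
have ep : 0 < e by rewrite lt_neqAle eq_sym en.
have := h (- b / e).
have -> : a + 2 * (- b / e) * b + (- b / e) ^+ 2 * e = a - b ^+ 2 / e by field.
by rewrite subr_ge0 ler_pdivrMr.
Qed.

Lemma cauchy_schwarz X Y : L2 X -> L2 Y ->
  `|E (fun w => X w * Y w)| <=
  Num.sqrt (E (fun w => X w ^+ 2)) * Num.sqrt (E (fun w => Y w ^+ 2)).
Proof.
move=> X2 Y2; rewrite -sqrtrM ?E_sq_ge0// -sqrtr_sqr ler_wsqrtr//.
exact: cauchy_schwarz_sq.
Qed.

Lemma norm2E X : L2 X -> norm P 2 X = (Num.sqrt (E (fun w => X w ^+ 2)))%:E.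
Proof.
move=> X2; rewrite normE//; last exact/Lp2.
rewrite powR12_sqrt; last by apply: Rintegral_ge0 => w _; exact: powR_ge0.
by congr (Num.sqrt _)%:E; apply: eq_Rintegral => w _; rewrite powR2.
Qed.

Lemma norm2_lty X : measurable_fun setT X -> (norm P 2 X < +oo)%E -> L2 X.
Proof. by move=> mX h; apply/Lp2; exact: norm_lty. Qed.

Lemma condexp_L2 (G : set (set T)) Y Z : sub_sigma G -> L2 Y -> is_condexp P G Y Z ->
  L2 Z /\ E (fun w => Z w ^+ 2) <= E (fun w => Y w ^+ 2).
Proof.
move=> sG /Lp2 Y2 YZ; have [|Z2] := condexp_Lp sG _ Y2 YZ; first by rewrite ltr1n.
by under eq_Rintegral do rewrite powR2; under [X in _ <= X]eq_Rintegral do rewrite powR2; split => //; exact/Lp2.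
Qed.

End square_integrable.

(** * Moments of the normal law from likelihood ratios *)

Section normal_law.
Context d (T : measurableType d) (R : realType) (P : probability T R).
Local Notation E f := (Rintegral P setT f).
Local Notation pint := (intg P setT).
Variables (W : T -> R) (s : R).
Hypotheses (mW : measurable_fun setT W) (s0 : 0 < s).
Hypothesis lawW : forall U, measurable U -> P (W @^-1` U) = normal_prob 0 s U.

Let pdf m t x : R := normal_pdf m t x.

Lemma normal_pdf_pos m t x : 0 < t -> 0 < pdf m t x.
Proof.
move=> t0; rewrite /pdf normal_pdfE ?gt_eqF// mulr_gt0 ?expR_gt0//.
by rewrite normal_peak_gt0// gt_eqF.
Qed.

Lemma integral_normal_density (f : R -> R) : measurable_fun setT f -> (forall x, 0 <= f x) ->
  (\int[P]_w (f (W w))%:E =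
   \int[@lebesgue_measure R]_x (f x * pdf 0 s x)%:E)%E.
Proof.
move=> mf f0; have mf' : measurable_fun setT (EFin \o f) by exact/measurable_EFinP.
pose nu : probability _ R := normal_prob 0 s.
have dom : nu `<< (@lebesgue_measure R) by exact: normal_prob_dominates.
transitivity (\int[nu]_x (f x)%:E)%E.
  have mW' : measurable_fun setT (W : T -> measurableTypeR R) by exact: mW.
  have f0' : {in setT, forall y, (0 <= (EFin \o f) y)%E} by move=> y _; rewrite /= lee_fin.
  have := @ge0_integral_pushforward _ _ _ (measurableTypeR R) _ _ mW' P setT (EFin \o f) measurableT mf' f0'.
  rewrite preimage_setT => <-.
  by apply: (@eq_measure_integral _ (measurableTypeR R)) => U mU _; exact: lawW.
rewrite -(Radon_Nikodym_SigmaFinite.change_of_variables dom)//.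
apply: ae_eq_integral => //.
- apply: emeasurable_funM => //.
  exact: measurable_int (Radon_Nikodym_SigmaFinite.f_integrable dom).
- by apply/measurable_EFinP; apply: measurable_funM => //; exact: measurable_normal_pdf.
have : ae_eq (@lebesgue_measure R) setT (Radon_Nikodym_SigmaFinite.f nu (@lebesgue_measure R)) (EFin \o pdf 0 s).
  apply: integral_ae_eq => //.
  - exact: Radon_Nikodym_SigmaFinite.f_integrable.
  - by apply/measurable_EFinP; exact: measurable_normal_pdf.
  - by move=> A _ mA; rewrite -Radon_Nikodym_SigmaFinite.f_integral.
by apply: filterS => x /[apply] /= ->; rewrite EFinM.
Qed.

(** The likelihood ratio of two normal laws has expectation 1. Shifting the mean gives exponentials
    of [W], changing the variance gives exponentials of its square, and every moment bound below is
    read off from these two. *)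
Lemma normal_ratio m t : 0 < t ->
  pint (fun w => pdf m t (W w) / pdf 0 s (W w)) /\
  E (fun w => pdf m t (W w) / pdf 0 s (W w)) = 1.
Proof.
move=> t0.
have mr : measurable_fun setT (fun x => pdf m t x / pdf 0 s x).
  apply: measurable_funM; first exact: measurable_normal_pdf.
  have -> : (fun x => (pdf 0 s x)^-1) = (fun x => (normal_peak s)^-1 * expR (x ^+ 2 / (s ^+ 2 *+ 2))).
    apply/funext => x; rewrite /pdf normal_pdfE ?gt_eqF// invfM; congr (_ * _).
    by rewrite /normal_fun -expRN subr0 mulNr opprK.
  apply: measurable_funM => //; apply: measurableT_comp => //.
  by apply: measurable_funM => //; exact: measurable_funX.
have r0 x : 0 <= pdf m t x / pdf 0 s x by rewrite divr_ge0// ltW// normal_pdf_pos.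
have h := integral_normal_density mr r0.
have h1 : (\int[P]_w (pdf m t (W w) / pdf 0 s (W w))%:E = 1)%E.
  rewrite h -[RHS](@integral_normal_pdf R m t); apply: eq_integral => x _.
  by rewrite divfK// gt_eqF// normal_pdf_pos.
have i : pint (fun w => pdf m t (W w) / pdf 0 s (W w)).
  apply: (intg_ge0 (measurableT_comp mr mW)) => [w _|]; first exact: r0.
  by rewrite h1 ltry.
by split => //; have := h1; rewrite (intgE measurableT i) => -[].
Qed.

Lemma normal_exp_linear m :
  pint (fun w => expR (m * W w)) /\ E (fun w => expR (m * W w)) = expR (m ^+ 2 * s ^+ 2 / 2).
Proof.
have [i e] := normal_ratio (m * s ^+ 2) s0.
have rE x : expR (m * x) = expR (m ^+ 2 * s ^+ 2 / 2) * (pdf (m * s ^+ 2) s x / pdf 0 s x).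
  rewrite /pdf !normal_pdfE ?gt_eqF// -mulf_div divff ?gt_eqF ?normal_peak_gt0 ?gt_eqF// mul1r.
  rewrite /normal_fun -expRN -!expRD; congr expR.
  by rewrite -(mulr_natr (s ^+ 2)); field; rewrite gt_eqF.
have fE : (fun w => expR (m * W w)) = (fun w => expR (m ^+ 2 * s ^+ 2 / 2) * (pdf (m * s ^+ 2) s (W w) / pdf 0 s (W w))).
  by apply/funext => w; exact: rE.
by rewrite fE; split; [exact: intgZ|rewrite IntZ// e mulr1].
Qed.

Lemma normal_exp_square t : 0 < t ->
  pint (fun w => expR ((s ^- 2 - t ^- 2) / 2 * W w ^+ 2)) /\
  E (fun w => expR ((s ^- 2 - t ^- 2) / 2 * W w ^+ 2)) = t / s.
Proof.
move=> t0; have [i e] := normal_ratio 0 t0.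
have pk u : 0 < u -> normal_peak u = u^-1 * (Num.sqrt (pi *+ 2))^-1 :> R.
  move=> u0; rewrite /normal_peak -mulrnAr sqrtrM ?sqr_ge0// sqrtr_sqr gtr0_norm//.
  by rewrite invfM.
have pkp : 0 < (Num.sqrt (pi *+ 2))^-1 :> R by rewrite invr_gt0 sqrtr_gt0 mulrn_wgt0// pi_gt0.
have rE x : expR ((s ^- 2 - t ^- 2) / 2 * x ^+ 2) = t / s * (pdf 0 t x / pdf 0 s x).
  rewrite /pdf !normal_pdfE ?gt_eqF// -mulf_div !pk// -mulf_div divff ?gt_eqF// mulr1.
  have -> : t^-1 / s^-1 = s / t by rewrite invrK mulrC.
  rewrite [RHS]mulrA (_ : t / s * (s / t) = 1) ?mul1r; last by field; rewrite !gt_eqF.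
  rewrite /normal_fun -expRN -!expRD; congr expR.
  by rewrite -(mulr_natr (s ^+ 2)) -(mulr_natr (t ^+ 2)); field; rewrite !gt_eqF.
have fE : (fun w => expR ((s ^- 2 - t ^- 2) / 2 * W w ^+ 2)) = (fun w => t / s * (pdf 0 t (W w) / pdf 0 s (W w))).
  by apply/funext => w; exact: rE.
by rewrite fE; split; [exact: intgZ|rewrite IntZ// e mulr1].
Qed.

(** From ln x <= x one gets |W|^p <= exp(p|W|), and ab <= a^2 + 3b^2/8 with a = ps, b = |W|/s bounds
    the exponent. The choice t = 2s makes exp(3b^2/8) one of the integrable exponentials of
    [normal_exp_square]. *)
Lemma normal_Lp p : 0 <= p -> Lp P p W.
Proof.
move=> p0; split => //; pose t := 2 * s; have t0 : 0 < t by rewrite mulr_gt0.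
have [i _] := normal_exp_square t0.
apply: (intg_le measurableT (meas_absp p mW) _ (intgZ measurableT (expR (p ^+ 2 * s ^+ 2)) i)) => w _.
rewrite ger0_norm ?powR_ge0// -expRD.
have [->|x0] := eqVneq (W w) 0.
  rewrite normr0 expr0n /= mulr0 addr0; apply: (@le_trans _ _ 1).
    by have [->|pn] := eqVneq p 0; [rewrite powRr0|rewrite powR0].
  by rewrite -[leLHS]expR0 ler_expR mulr_ge0 ?sqr_ge0.
have xp : 0 < `|W w| by rewrite normr_gt0.
rewrite /powR gt_eqF// ler_expR.
apply: (@le_trans _ _ (p * `|W w|)); first by rewrite ler_wpM2l// ltW// ln_sublinear.
rewrite -[W w ^+ 2]real_normK ?num_real//.
have -> : (s ^- 2 - t ^- 2) / 2 * `|W w| ^+ 2 = 3 / 8 * (`|W w| / s) ^+ 2.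
  by rewrite /t; field; rewrite gt_eqF.
have -> : p * `|W w| = (p * s) * (`|W w| / s) by field; rewrite gt_eqF.
rewrite -exprMn; set a := p * s; set b := `|W w| / s.
have := sqr_ge0 (a - b / 2); have := sqr_ge0 b; rewrite !expr2; nra.
Qed.

Lemma expR_le1D2x (y : R) : 0 <= y -> y <= 2^-1 -> expR y <= 1 + 2 * y.
Proof.
move=> y0 y2; have h := expR_ge1Dx (- y); have e0 := expR_gt0 y.
have e : expR y * expR (- y) = 1 by rewrite -expRD subrr expR0.
have : expR y * (1 - y) <= 1 by rewrite -[leRHS]e ler_pM2l.
nra.
Qed.

(** If the mean mu were not 0, then 1 + y <= exp(y) at y = c mu W would give 1 + c mu^2 <= exp(c^2
    mu^2 s^2 / 2): a gain of first order in c against a loss of second order, impossible for small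
    c. *)
Lemma normal_mean : E W = 0.
Proof.
have Wi : pint W by apply: (Lp_pint (p := 1)) => //; exact: normal_Lp.
apply/eqP/negPn/negP => mu0; set mu := E W in mu0 *.
(* Small enough for c s^2 < 1, which yields the contradiction, and for c |mu| s <= 1, which keeps
   the exponent within the range of [expR_le1D2x]. *)
pose c := (2 * s ^+ 2 + `|mu| * s + 1)^-1.
have den : 0 < 2 * s ^+ 2 + `|mu| * s + 1.
  by apply: ltr_wpDl => //; apply: addr_ge0; apply: mulr_ge0; rewrite ?sqr_ge0// ltW.
have c0 : 0 < c by rewrite invr_gt0.
have [i e] := normal_exp_linear (c * mu).
have h : 1 + c * mu * mu <= expR ((c * mu) ^+ 2 * s ^+ 2 / 2).
  rewrite -e -[X in X + _](E_cst P) -IntZ// -IntD//; [|exact: pint_cst|exact: intgZ].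
  apply: Int_le => //; first by apply: intgD => //; [exact: pint_cst|exact: intgZ].
  by move=> w _; exact: expR_ge1Dx.
have cden : c * (2 * s ^+ 2 + `|mu| * s + 1) = 1 by rewrite mulVf// gt_eqF.
have ms : 0 <= `|mu| * s by rewrite mulr_ge0// ltW.
have cs : c * s ^+ 2 < 1 by have := sqr_ge0 s; nra.
have cm : c * (`|mu| * s) <= 1 by have := sqr_ge0 s; nra.
have cm0 : 0 <= c * (`|mu| * s) by rewrite mulr_ge0// ltW.
have sq : (c * mu) ^+ 2 * s ^+ 2 = (c * (`|mu| * s)) ^+ 2.
  by rewrite !exprMn real_normK ?num_real//; ring.
have : expR ((c * mu) ^+ 2 * s ^+ 2 / 2) <= 1 + 2 * ((c * mu) ^+ 2 * s ^+ 2 / 2).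
  apply: expR_le1D2x; rewrite sq; first by rewrite divr_ge0// sqr_ge0.
  have : (c * (`|mu| * s)) ^+ 2 <= 1 by rewrite expr_le1.
  lra.
have mm : 0 < mu ^+ 2 by rewrite lt_neqAle sqr_ge0 eq_sym sqrf_eq0 mu0.
have cmm : 0 < c * mu ^+ 2 by rewrite mulr_gt0.
move=> k; have : c * mu ^+ 2 <= (c * mu ^+ 2) * (c * s ^+ 2).
  have -> : c * mu ^+ 2 * (c * s ^+ 2) = 2 * ((c * mu) ^+ 2 * s ^+ 2 / 2) by field.
  by rewrite (_ : c * mu ^+ 2 = c * mu * mu); [lra|ring].
by rewrite leNgt gtr_pMr// cs.
Qed.

(** The variance is compared with (1-h)s: taking expectations in 1 - aW^2 <= exp(-aW^2), where the
    right-hand side has expectation 1 - h, bounds E[W^2] from below, and h tends to 0. *)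
Lemma normal_sq_ge : s ^+ 2 <= E (fun w => W w ^+ 2).
Proof.
have W2 : L2 P W by apply/Lp2; exact: normal_Lp.
set v := E _; have s2 : 0 < s ^+ 2 by rewrite exprn_gt0.
have key (h : R) : 0 < h -> h < 1 -> s ^+ 2 * (1 - 2 * h) <= v.
  move=> h0 h1; pose r := 1 - h; have r0 : 0 < r by rewrite /r; lra.
  have [i e] := normal_exp_square (mulr_gt0 r0 s0).
  pose a := (r ^- 2 - 1) / (2 * s ^+ 2).
  have aE : (s ^- 2 - (r * s) ^- 2) / 2 = - a.
    by rewrite /a; field; rewrite !gt_eqF.
  move: e i; rewrite aE mulfK ?gt_eqF// => e i.
  have : 1 + (- a) * v <= r.
    rewrite -e -[X in X + _](E_cst P) -IntZ//; last exact: W2.2.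
    rewrite -IntD//; [|exact: pint_cst|by apply: intgZ => //; exact: W2.2].
    apply: Int_le => //; first by apply: intgD => //; [exact: pint_cst|by apply: intgZ => //; exact: W2.2].
    by move=> w _; exact: expR_ge1Dx.
  have -> : - a = - ((2 - h) * h) / (2 * s ^+ 2 * r ^+ 2).
    by rewrite /a /r; field; rewrite -/r !gt_eqF.
  have den : 0 < 2 * s ^+ 2 * r ^+ 2 by rewrite !mulr_gt0// exprn_gt0.
  rewrite mulrAC => le1.
  have : 1 - r <= (2 - h) * h * v / (2 * s ^+ 2 * r ^+ 2).
    by move: le1; rewrite !mulNr; lra.
  rewrite ler_pdivlMr// /r opprB addrCA subrr addr0 => le2.
  have : 2 * s ^+ 2 * (1 - h) ^+ 2 <= (2 - h) * v.
    rewrite -(ler_pM2l h0) (le_trans le2)// le_eqVlt; apply/orP; left; apply/eqP; ring.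
  have : s ^+ 2 * (1 - 2 * h) * (2 - h) <= 2 * s ^+ 2 * (1 - h) ^+ 2.
    have -> : 2 * s ^+ 2 * (1 - h) ^+ 2 = s ^+ 2 * (1 - 2 * h) * (2 - h) + s ^+ 2 * h by ring.
    by rewrite lerDl mulr_ge0// ltW.
  move=> l1 l2; have := le_trans l1 l2.
  by rewrite mulrC ler_pM2l//; lra.
apply/ler_addgt0Pr => e e0.
pose h := Order.min 2^-1 (e / (2 * s ^+ 2)).
have h0 : 0 < h by rewrite lt_min invr_gt0 ltr0n/= divr_gt0// mulr_gt0.
have h1 : h < 1 by rewrite gt_min; apply/orP; left; lra.
have h2 : h <= e / (2 * s ^+ 2) by rewrite ge_min lexx orbT.
have := key h h0 h1; move: h2; rewrite ler_pdivlMr ?mulr_gt0//; lra.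
Qed.

(** Here y <= exp(y) is used at y = 3W^2/(8s^2), where exp(y) has expectation 2; this gives 16/3,
    rounded up to 8. A crude constant is enough, as the bound only serves as a modulus of continuity
    in time. *)
Lemma normal_sq_le : E (fun w => W w ^+ 2) <= 8 * s ^+ 2.
Proof.
have W2 : L2 P W by apply/Lp2; exact: normal_Lp.
have t0 : 0 < 2 * s by rewrite mulr_gt0.
have [i e] := normal_exp_square t0.
have : E (fun w => W w ^+ 2) <=
    E (fun w => (8 / 3 * s ^+ 2) * expR ((s ^- 2 - (2 * s) ^- 2) / 2 * W w ^+ 2)).
  apply: Int_le => //; [exact: W2.2|exact: intgZ|move=> w _].
  have h := expR_ge1Dx ((s ^- 2 - (2 * s) ^- 2) / 2 * W w ^+ 2).
  have h' : (s ^- 2 - (2 * s) ^- 2) / 2 * W w ^+ 2 <= expR ((s ^- 2 - (2 * s) ^- 2) / 2 * W w ^+ 2) by lra.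
  rewrite [leLHS](_ : _ = (8 / 3 * s ^+ 2) * ((s ^- 2 - (2 * s) ^- 2) / 2 * W w ^+ 2)).
    by rewrite ler_pM2l// mulr_gt0// exprn_gt0.
  by field; rewrite gt_eqF.
rewrite IntZ// e mulfK ?gt_eqF// => /le_trans; apply.
have := sqr_ge0 s; lra.
Qed.

End normal_law.

(** * The Brownian filtration *)

Section brownian_filtration.
Context d (T : measurableType d) (R : realType) (P : probability T R).
Variables (B : R -> T -> R).
Hypotheses (P_complete : measure_is_complete P) (BM : standard_brownian_motion P B).
Local Notation E f := (Rintegral P setT f).
Local Notation pint := (intg P setT).
Local Notation F := (filtration P B).
Implicit Types (s t u v : R) (A C : set T).

Lemma history_measurable t : 0 <= t <= 1 -> history B t `<=` measurable.
Proof.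
move=> /andP[t0 t1]; apply: smallest_sub; first exact: sigma_algebra_measurable.
move=> _ [s [U [/andP[s0 st] mU ->]]]; rewrite -[X in measurable X]setTI.
by apply: (bm_measurable BM) => //; rewrite s0 (le_trans st).
Qed.

Lemma sub_sigma_history t : 0 <= t <= 1 -> sub_sigma (history B t).
Proof.
by move=> t01; split; [exact: smallest_sigma_algebra|exact: history_measurable].
Qed.

Lemma history_le s t : s <= t -> history B s `<=` history B t.
Proof.
move=> st; apply: smallest_sub; first exact: smallest_sigma_algebra.
move=> _ [r [U [/andP[r0 rs] mU ->]]]; apply: sub_sigma_algebra.
by exists r, U; rewrite r0 (le_trans rs).
Qed.

Lemma sub_sigma_F t : 0 <= t <= 1 -> sub_sigma (F t).
Proof.
move=> t01; apply: sub_sigma_gen; rewrite subUset; split; last exact: P_complete.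
exact: history_measurable.
Qed.

Lemma history_F t : history B t `<=` F t.
Proof. by move=> A hA; apply: sub_sigma_algebra; left. Qed.

Lemma F_le s t : s <= t -> F s `<=` F t.
Proof.
move=> st; apply: smallest_sub; first exact: smallest_sigma_algebra.
move=> A [hA|nA]; apply: sub_sigma_algebra; [left|by right].
exact: history_le hA.
Qed.

Lemma gmeas_history s t : 0 <= t <= 1 -> 0 <= s <= t -> gmeas (history B t) (B s).
Proof.
move=> t01 st _ U mU; rewrite setTI gmeas_measE//; last exact: sub_sigma_history.
by apply: sub_sigma_algebra; exists s, U.
Qed.

Lemma gmeas_F s t : 0 <= t <= 1 -> 0 <= s <= t -> gmeas (F t) (B s).
Proof.
move=> t01 st; apply: gmeas_sub (gmeas_history t01 st).
- exact: sub_sigma_history.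
- exact: sub_sigma_F.
- exact: history_F.
Qed.

Definition incr_algebra t u : set (set T) :=
  <<s [set A | exists r (U : set R),
        [/\ t <= r <= u, measurable U & A = (B r \- B t) @^-1` U]]>>.

Lemma incr_algebra_gen_measurable t u : 0 <= t -> u <= 1 ->
  [set A | exists r (U : set R),
    [/\ t <= r <= u, measurable U & A = (B r \- B t) @^-1` U]] `<=` measurable.
Proof.
move=> t0 u1 _ [r [U [/andP[tr ru] mU ->]]].
rewrite -[X in measurable X]setTI; apply: measurable_funB => //.
- by apply: (bm_measurable BM); rewrite (le_trans t0)//= (le_trans ru).
- by apply: (bm_measurable BM); rewrite t0 (le_trans tr)// (le_trans ru).
Qed.

Lemma sub_sigma_incr t u : 0 <= t -> u <= 1 -> sub_sigma (incr_algebra t u).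
Proof. by move=> t0 u1; apply: sub_sigma_gen; exact: incr_algebra_gen_measurable. Qed.

Lemma gmeas_incr t u r : 0 <= t -> u <= 1 -> t <= r <= u ->
  gmeas (incr_algebra t u) (B r \- B t).
Proof.
move=> t0 u1 ru _ U mU; rewrite setTI gmeas_measE//; last exact: sub_sigma_incr.
by apply: sub_sigma_algebra; exists r, U.
Qed.

Lemma incr_algebra_le t u v : u <= v -> incr_algebra t u `<=` incr_algebra t v.
Proof.
move=> uv; apply: smallest_sub; first exact: smallest_sigma_algebra.
move=> _ [r [U [/andP[r0 rs] mU ->]]]; apply: sub_sigma_algebra.
by exists r, U; rewrite r0 (le_trans rs).
Qed.

Lemma incr_algebra_history t u : 0 <= t -> u <= 1 -> t <= u -> incr_algebra t u `<=` history B u.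
Proof.
move=> t0 u1 tu; have u0 := le_trans t0 tu.
apply: smallest_sub; first exact: smallest_sigma_algebra.
move=> _ [r [U [/andP[tr ru] mU ->]]].
have u01 : 0 <= u <= 1 by rewrite u0.
rewrite -(gmeas_measE _ (sub_sigma_history u01)) -[X in measurable X]setTI.
by apply: measurable_funB => //; apply: gmeas_history => //; rewrite ?t0 ?(le_trans t0).
Qed.

(** Events of finitely many increments along an increasing list of times, built from the last time
    backwards. The recursion matches the axiom of independence, which concerns a single increment
    and the history before it. *)
Fixpoint chain t (l : seq R) : set (set T) :=
  if l is u :: l' then
    <<s [set A | exists2 U : set R, measurable U &
          exists2 C, chain u l' C & A = (B u \- B t) @^-1` U `&` C]>>
  else [set setT].

Lemma chainT t l : chain t l setT.
Proof. by case: l => //= u l; exact: (@measurableT _ (g_sigma_algebraType _)). Qed.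

Lemma chainI t l A C : chain t l A -> chain t l C -> chain t l (A `&` C).
Proof.
case: l => [|u l] /=; first by move=> -> ->; rewrite setTI.
exact: (@measurableI _ (g_sigma_algebraType _)).
Qed.

Lemma chain_history t l u : 0 <= t -> path <=%R t l -> (forall v, v \in l -> v <= u) ->
  t <= u -> u <= 1 -> chain t l `<=` history B u.
Proof.
elim: l t => [|v l IH] t t0 /=.
  by move=> _ _ _ _ A ->; exact: (@measurableT _ (g_sigma_algebraType _)).
move=> /andP[tv vl] lu tu u1; have u01 : 0 <= u <= 1 by rewrite (le_trans t0).
apply: smallest_sub; first exact: smallest_sigma_algebra.
move=> _ [U mU [C hC ->]].
have vu : v <= u by apply: lu; rewrite inE eqxx.
apply: (@measurableI _ (g_sigma_algebraType _)).
- apply: (@incr_algebra_history t u) => //.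
  by apply: sub_sigma_algebra; exists v, U; rewrite tv vu.
- apply: (IH v _ vl) => //; first exact: le_trans tv.
  by move=> w wl; apply: lu; rewrite inE wl orbT.
Qed.

Lemma chain_measurable t l : 0 <= t -> path <=%R t l -> (forall v, v \in l -> v <= 1) ->
  t <= 1 -> chain t l `<=` measurable.
Proof.
move=> t0 tl l1 t1 A /(@chain_history t l 1 t0 tl l1 t1 (lexx _)).
by apply: history_measurable; rewrite lexx ler01.
Qed.

Lemma sub_sigma_chain t u l : 0 <= t -> path <=%R t (u :: l) ->
  (forall v, v \in u :: l -> v <= 1) -> t <= 1 -> sub_sigma (chain t (u :: l)).
Proof.
move=> t0 tl l1 t1; split; first exact: smallest_sigma_algebra.
exact: chain_measurable.
Qed.

Lemma E_indicI A C : E (fun w => \1_A w * \1_C w) = E \1_(A `&` C).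
Proof. by apply: eq_Rintegral => w _; rewrite !indicE in_setI; case: (w \in A); rewrite ?mul1r ?mul0r. Qed.

Lemma E_indicE A : measurable A -> E \1_A = fine (P A).
Proof. by move=> mA; rewrite /Rintegral integral_indic// setIT. Qed.

Lemma pint_indic A : measurable A -> pint \1_A.
Proof. by move=> mA; have := @integrable_indic _ _ _ P A mA. Qed.

Lemma E_centered A C c : measurable A -> measurable C ->
  E (fun w => (\1_A w - c) * \1_C w) = E \1_(A `&` C) - c * E \1_C.
Proof.
move=> mA mC; have i := pint_indic mC.
rewrite -E_indicI -IntZ// -IntB//; [|exact: intg_indic (pint_indic mA) mC|exact: intgZ].
by apply: eq_Rintegral => w _; rewrite mulrBl.
Qed.

Lemma incr_indep1 s t A U : 0 <= s -> s <= t -> t <= 1 -> history B s A -> measurable U ->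
  E \1_(A `&` (B t \- B s) @^-1` U) = E \1_A * E \1_((B t \- B s) @^-1` U).
Proof.
move=> s0 st t1 hA mU; have s1 := le_trans st t1; have t0 := le_trans s0 st.
have mA : measurable A by apply: (history_measurable _ hA); rewrite s0.
have mD : measurable ((B t \- B s) @^-1` U).
  apply: (@incr_algebra_gen_measurable s t) => //.
  by exists t, U; rewrite st lexx.
rewrite !E_indicE//; last exact: measurableI.
have [e|st'] := eqVneq s t; last first.
  by rewrite (bm_independent BM)// ?fineM ?fin_num_measure// lt_neqAle st'.
subst t; have [U0|U0] := pselect (U 0).
  rewrite (_ : _ @^-1` U = setT) ?setIT ?probability_setT/= ?mulr1//.
  by apply/seteqP; split => w //= _; rewrite subrr.
rewrite (_ : _ @^-1` U = set0) ?setI0 ?measure0/= ?mulr0//.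
by apply/seteqP; split => w //=; rewrite subrr.
Qed.

(** On a generator, the first increment is moved to the side of the history: together with [A] it
    belongs to the history up to [u], so the induction hypothesis splits off the later increments,
    and one use of the axiom separates [A] from the first increment. *)
Lemma chain_indep l t A C : 0 <= t -> path <=%R t l -> (forall v, v \in l -> v <= 1) ->
  t <= 1 -> history B t A -> chain t l C ->
  E \1_(A `&` C) = E \1_A * E \1_C.
Proof.
elim: l t A C => [|u l IH] t A C t0.
  move=> _ _ _ _ ->; by rewrite setIT (E_indicE measurableT) probability_setT mulr1.
move=> tl l1 t1 hA; have /andP[tu ul] := tl.
have u1 : u <= 1 by apply: l1; rewrite inE eqxx.
have u0 := le_trans t0 tu.
have l1' v : v \in l -> v <= 1 by move=> vl; apply: l1; rewrite inE vl orbT.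
have mA : measurable A by apply: (history_measurable _ hA); rewrite t0.
pose Gen := [set D | exists2 U : set R, measurable U &
  exists2 D', chain u l D' & D = (B u \- B t) @^-1` U `&` D'].
have GenI : setI_closed Gen.
  move=> _ _ [U mU [D hD ->]] [U' mU' [D' hD' ->]].
  exists (U `&` U'); first exact: measurableI.
  exists (D `&` D'); first exact: chainI.
  by rewrite preimage_setI setIACA.
have Genm : Gen `<=` measurable.
  move=> D GD; apply: (chain_measurable t0 tl l1 t1).
  exact: sub_sigma_algebra.
have pc (c : R) : pint (fun w => \1_A w - c).
  by apply: intgB => //; [exact: pint_indic|exact: pint_cst].
move=> hC; have := @orthogonal_pi _ _ _ P Gen (fun w => \1_A w - E \1_A) GenI Genm (pc _) _ _ C hC.
rewrite E_centered//; last by apply: (chain_measurable t0 tl l1 t1).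
move=> h; apply/eqP; rewrite -subr_eq0; apply/eqP; apply: h.
  rewrite IntB//; [|exact: pint_indic|exact: pint_cst].
  by rewrite E_cst subrr.
move=> D GD; rewrite E_centered//; last exact: Genm.
case: GD => U mU [D' hD' ->]; rewrite setIA.
have hA1 : history B u (A `&` (B u \- B t) @^-1` U).
  apply: (@measurableI _ (g_sigma_algebraType _)); first exact: history_le hA.
  by apply: (incr_algebra_history t0 u1 tu); apply: sub_sigma_algebra; exists u, U; rewrite tu lexx.
have hU : history B u ((B u \- B t) @^-1` U).
  by apply: (incr_algebra_history t0 u1 tu); apply: sub_sigma_algebra; exists u, U; rewrite tu lexx.
rewrite (IH u _ _ u0 ul l1' u1 hA1 hD') (IH u _ _ u0 ul l1' u1 hU hD').
by rewrite incr_indep1// mulrA subrr.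
Qed.

Lemma gmeas_chain t l v : 0 <= t -> path <=%R t l -> (forall v, v \in l -> v <= 1) ->
  t <= 1 -> v \in l -> gmeas (chain t l) (B v \- B t).
Proof.
elim: l t => [//|u l IH] t t0 tl l1 t1; rewrite inE => vl.
have /andP[tu ul] := tl.
have u1 : u <= 1 by apply: l1; rewrite inE eqxx.
have u0 := le_trans t0 tu.
have l1' w : w \in l -> w <= 1 by move=> wl; apply: l1; rewrite inE wl orbT.
have sc := sub_sigma_chain t0 tl l1 t1.
have mu : gmeas (chain t (u :: l)) (B u \- B t).
  move=> _ U mU; rewrite setTI gmeas_measE//; apply: sub_sigma_algebra.
  by exists U => //; exists setT; [exact: chainT|rewrite setIT].
have [->//|vu] := eqVneq v u.
have {}vl : v \in l by move: vl; rewrite (negbTE vu).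
have mv : gmeas (chain t (u :: l)) (B v \- B u).
  have := IH u u0 ul l1' u1 vl.
  case: l vl ul l1' {IH tl l1 sc mu} => [//|x l] _ ul l1' h.
  move=> _ U mU; have := h measurableT U mU; rewrite !setTI => hU.
  apply: sub_sigma_algebra; apply: sub_sigma_algebra; exists setT; first exact: measurableT.
  exists ((B v \- B u) @^-1` U); last by rewrite preimage_setT setTI.
  by move: hU; rewrite gmeas_measE//; exact: (sub_sigma_chain u0 ul l1' u1).
rewrite (_ : B v \- B t = (B v \- B u) \+ (B u \- B t)).
  exact: measurable_funD.
by apply/funext => w /=; rewrite addrA subrK.
Qed.

Definition incr_finite t (l : seq R) : set (set T) :=
  <<s [set A | exists v (U : set R),
        [/\ v \in l, measurable U & A = (B v \- B t) @^-1` U]]>>.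

Lemma incr_finite_chain t (l : seq R) : 0 <= t -> t <= 1 -> (forall v, v \in l -> t <= v <= 1) ->
  l != [::] -> incr_finite t l `<=` chain t (sort <=%R l).
Proof.
move=> t0 t1 lb l0; set l' := sort _ _.
have mem v : (v \in l') = (v \in l) by rewrite mem_sort.
have pl : path <=%R t l'.
  rewrite path_min_sorted; first exact: (sort_sorted (@le_total _ R)).
  by apply/allP => v; rewrite mem => /lb /andP[].
have l1 v : v \in l' -> v <= 1 by rewrite mem => /lb /andP[].
have : l' != [::] by rewrite -size_eq0 size_sort size_eq0.
case: l' mem pl l1 => [//|u l'] mem pl l1 _.
have sc := sub_sigma_chain t0 pl l1 t1.
apply: smallest_sub; first exact: sc.1.
move=> _ [v [U [vl mU ->]]].
have := gmeas_chain t0 pl l1 t1 (_ : v \in u :: l') measurableT mU.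
by rewrite mem setTI gmeas_measE//; apply.
Qed.

(** Events depending on finitely many increments form a pi-system that generates the increment
    algebra; sorting their times reduces each of them to a chain. *)
Lemma indep_history t A C : 0 <= t -> t <= 1 -> history B t A -> incr_algebra t 1 C ->
  E \1_(A `&` C) = E \1_A * E \1_C.
Proof.
move=> t0 t1 hA hC.
have mA : measurable A by apply: (history_measurable _ hA); rewrite t0.
pose Gen := [set C | exists2 l, (l != [::] /\ forall v, v \in l -> t <= v <= 1) & incr_finite t l C].
have Genm : Gen `<=` measurable.
  move=> D [l [l0 lb] h]; apply: (sub_sigma_incr t0 (lexx 1)).2.
  apply: smallest_sub h; first exact: (sub_sigma_incr t0 (lexx 1)).1.
  by move=> _ [v [U [vl mU ->]]]; apply: sub_sigma_algebra; exists v, U; rewrite lb.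
have GenI : setI_closed Gen.
  move=> D D' [l [l0 lb] h] [l' [l0' lb'] h']; exists (l ++ l').
    split; first by case: (l) l0.
    by move=> v; rewrite mem_cat => /orP[/lb|/lb'].
  apply: (@measurableI _ (g_sigma_algebraType _)).
  - apply: smallest_sub h; first exact: smallest_sigma_algebra.
    by move=> _ [v [U [vl mU ->]]]; apply: sub_sigma_algebra; exists v, U; rewrite mem_cat vl.
  - apply: smallest_sub h'; first exact: smallest_sigma_algebra.
    by move=> _ [v [U [vl mU ->]]]; apply: sub_sigma_algebra; exists v, U; rewrite mem_cat vl orbT.
have GenC : <<s Gen >> C.
  apply: smallest_sub hC; first exact: smallest_sigma_algebra.
  move=> _ [v [U [vl mU ->]]]; apply: sub_sigma_algebra; exists [:: v].
    by split => // x; rewrite inE => /eqP ->.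
  by apply: sub_sigma_algebra; exists v, U; rewrite inE eqxx.
have pc (c : R) : pint (fun w => \1_A w - c).
  by apply: intgB => //; [exact: pint_indic|exact: pint_cst].
have := @orthogonal_pi _ _ _ P Gen (fun w => \1_A w - E \1_A) GenI Genm (pc _) _ _ C GenC.
rewrite E_centered//; last exact: (sub_sigma_incr t0 (lexx 1)).2.
move=> h; apply/eqP; rewrite -subr_eq0; apply/eqP; apply: h.
  rewrite IntB//; [|exact: pint_indic|exact: pint_cst].
  by rewrite E_cst subrr.
move=> D GD; rewrite E_centered//; last exact: Genm.
case: GD => l [l0 lb] hD.
have hD' := incr_finite_chain t0 t1 lb l0 hD.
rewrite (chain_indep t0 _ _ t1 hA hD') ?subrr//.
- rewrite path_min_sorted; first exact: (sort_sorted (@le_total _ R)).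
  by apply/allP => v; rewrite mem_sort => /lb /andP[].
- by move=> v; rewrite mem_sort => /lb /andP[].
Qed.

End brownian_filtration.

Section conditional_independence.
Context d (T : measurableType d) (R : realType) (P : probability T R).
Variables (B : R -> T -> R).
Hypotheses (P_complete : measure_is_complete P) (BM : standard_brownian_motion P B).
Local Notation E f := (Rintegral P setT f).
Local Notation pint := (intg P setT).
Local Notation F := (filtration P B).
Local Notation inc := (incr_algebra B).
Implicit Types (s t u v : R) (A C : set T).

(** The completion costs little: history events together with negligible sets are already stable
    under intersection, and both sides vanish on a negligible set. *)
Lemma indep_F t A C : 0 <= t <= 1 -> F t A -> inc t 1 C ->
  E \1_(A `&` C) = E \1_A * E \1_C.
Proof.
move=> t01 FA hC; have /andP[t0 t1] := t01.
have sF := sub_sigma_F P_complete BM t01.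
have mC := (sub_sigma_incr BM t0 (lexx 1)).2 _ hC.
pose Gen := history B t `|` P.-negligible.
have GenI : setI_closed Gen.
  move=> D D' [hD|nD]; last by move=> _; right; apply: negligibleS nD; exact: subIsetl.
  case=> [hD'|nD']; last by right; apply: negligibleS nD'; exact: subIsetr.
  by left; exact: (@measurableI _ (g_sigma_algebraType _)).
have Genm : Gen `<=` measurable.
  by move=> D GD; apply: sF.2; exact: sub_sigma_algebra.
have mA := sF.2 _ FA.
have pc (c : R) : pint (fun w => \1_C w - c).
  by apply: intgB => //; [exact: pint_indic|exact: pint_cst].
have := @orthogonal_pi _ _ _ P Gen (fun w => \1_C w - E \1_C) GenI Genm (pc _) _ _ A FA.
rewrite E_centered// setIC => h; apply/eqP; rewrite mulrC -subr_eq0; apply/eqP; apply: h.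
  rewrite IntB//; [|exact: pint_indic|exact: pint_cst].
  by rewrite E_cst subrr.
move=> D GD; have mD := Genm _ GD; rewrite E_centered//.
case: GD => [hD|nD].
  by rewrite setIC (indep_history BM t0 t1 hD hC) mulrC subrr.
have zero D' : measurable D' -> D' `<=` D -> E \1_D' = 0.
  move=> mD' D'D; rewrite E_indicE//; have [N [mN N0 DN]] := nD.
  have -> : P D' = 0%E by apply: (@subset_measure0 _ _ _ P D' N) => //; exact: subset_trans DN.
  by [].
by rewrite (zero _ (measurableI _ _ mC mD) (@subIsetr _ _ _)) (zero _ mD) ?mulr0 ?subr0.
Qed.

Lemma condexp_indep_indic t A : 0 <= t <= 1 -> F t A ->
  is_condexp P (inc t 1) \1_A (fun=> E \1_A).
Proof.
move=> t01 FA; have /andP[t0 t1] := t01.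
have sF := sub_sigma_F P_complete BM t01.
have sI := sub_sigma_incr BM t0 (lexx 1).
have mA := sF.2 _ FA.
apply/is_condexpP => //; first exact: pint_indic.
split; [exact: measurable_cst|exact: pint_cst|move=> C hC].
have mC := sI.2 _ hC.
by rewrite IntZ ?E_indicI ?(indep_F t01)//; exact: pint_indic.
Qed.

(** Obtained by duality: for an event of F(t), conditioning its indicator on the later increments
    gives a constant, and [eta] is then pulled out. *)
Lemma condexp_indep t eta : 0 <= t <= 1 -> gmeas (inc t 1) eta -> pint eta ->
  is_condexp P (F t) eta (fun=> E eta).
Proof.
move=> t01 me ei; have /andP[t0 t1] := t01.
have sF := sub_sigma_F P_complete BM t01.
have sI := sub_sigma_incr BM t0 (lexx 1).
apply/is_condexpP => //.
split; [exact: measurable_cst|exact: pint_cst|move=> A FA].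
have mA := sF.2 _ FA; have iA := pint_indic P mA.
have i1 : pint (fun w => \1_A w * eta w).
  by have := intg_indic ei mA; apply: intg_eq => // w _; rewrite mulrC.
have := condexp_pull_out sI iA (condexp_indep_indic t01 FA) me i1 (intgZ measurableT _ ei).
rewrite !IntZ// mulrC => ->.
by apply: eq_Rintegral => w _; rewrite mulrC.
Qed.

Lemma E_indep t eta xi : 0 <= t <= 1 -> gmeas (inc t 1) eta -> pint eta ->
  gmeas (F t) xi -> pint xi -> pint (fun w => eta w * xi w) ->
  E (fun w => eta w * xi w) = E eta * E xi.
Proof.
move=> t01 me ei mx xi_i exi.
have sF := sub_sigma_F P_complete BM t01.
by rewrite -(condexp_pull_out sF ei (condexp_indep t01 me ei) mx exi) ?IntZ//; exact: intgZ.
Qed.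

(* The information carried by the path with its increments on [s, t] removed. *)
Definition skip_gen s t : set (set T) :=
  [set D | exists2 A, F s A & exists2 C, inc t 1 C & D = A `&` C].

Lemma skip_genI s t : setI_closed (skip_gen s t).
Proof.
move=> _ _ [A hA [C hC ->]] [A' hA' [C' hC' ->]].
exists (A `&` A'); first exact: (@measurableI _ (g_sigma_algebraType _)).
exists (C `&` C'); first exact: (@measurableI _ (g_sigma_algebraType _)).
by rewrite setIACA.
Qed.

Lemma skip_gen_measurable s t : 0 <= s <= 1 -> 0 <= t <= 1 -> skip_gen s t `<=` measurable.
Proof.
move=> s01 t01 _ [A hA [C hC ->]]; have /andP[t0 t1] := t01.
apply: measurableI; first exact: (sub_sigma_F P_complete BM s01).2.
exact: (sub_sigma_incr BM t0 (lexx 1)).2.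
Qed.

Lemma skip_F s t : F s `<=` <<s skip_gen s t >>.
Proof.
move=> A hA; apply: sub_sigma_algebra; exists A => //; exists setT; last by rewrite setIT.
exact: (@measurableT _ (g_sigma_algebraType _)).
Qed.

Lemma skip_inc s t : inc t 1 `<=` <<s skip_gen s t >>.
Proof.
move=> C hC; apply: sub_sigma_algebra; exists setT; last by exists C => //; rewrite setTI.
exact: (@measurableT _ (g_sigma_algebraType _)).
Qed.

(** The increments after t carry no information on an event of F(t), so adjoining them to F(s) does
    not change its conditional probability. On a generator, the increment event factors out of both
    sides. *)
Lemma condexp_skip_indic s t A W : 0 <= s -> s <= t -> t <= 1 -> F t A ->
  is_condexp P (F s) \1_A W -> is_condexp P <<s skip_gen s t >> \1_A W.
Proof.
move=> s0 st t1 FA AW.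
have s01 : 0 <= s <= 1 by rewrite s0 (le_trans st).
have t01 : 0 <= t <= 1 by rewrite t1 (le_trans s0).
have sF := sub_sigma_F P_complete BM s01.
have tF := sub_sigma_F P_complete BM t01.
have sK := sub_sigma_gen (skip_gen_measurable s01 t01).
have mA := tF.2 _ FA; have iA := pint_indic P mA.
have [mW Wi hW] := (is_condexpP W sF iA).1 AW.
apply: condexp_pi => //.
- exact: skip_genI.
- exact: skip_gen_measurable.
- exact: gmeas_sub (@skip_F s t) mW.
- exact: condexp_mean AW.
move=> _ [A' hA' [C hC ->]].
have mA' := sF.2 _ hA'; have mC : measurable C by apply: sK.2; exact: skip_inc hC.
have t0 := le_trans s0 st.
have iC := pint_indic P mC.
have gC : gmeas (inc t 1) (\1_C : T -> R) by apply: gmeas_indic => //; exact: (sub_sigma_incr BM t0 (lexx 1)).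
have split_C (X : T -> R) : gmeas (F t) X -> pint X ->
    E (fun w => X w * \1_(A' `&` C) w) = E \1_C * E (fun w => X w * \1_A' w).
  move=> mX Xi; have XAi := intg_indic Xi mA'.
  rewrite -(E_indep t01 gC iC)//.
  - by apply: eq_Rintegral => w _; rewrite !indicE in_setI; case: (w \in A'); case: (w \in C); rewrite /= ?mulr1 ?mulr0 ?mul1r ?mul0r.
  - apply: measurable_funM => //; apply: gmeas_indic => //; exact: F_le hA'.
  - by have := intg_indic XAi mC; apply: intg_eq => // w _; rewrite mulrC.
rewrite !split_C ?hW//; first exact: gmeas_indic.
by apply: gmeas_sub mW => //; exact: F_le.
Qed.

(** The dual of [condexp_skip_indic]. With W the conditional probability of A given F(s), E[1_A Z] =
    E[W Z] = E[W 1_D] = E[1_A 1_D]: three exchanges by symmetry of conditional expectation, the last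
    one in the algebra that skips [s, t]. *)
Lemma condexp_skip s t D Z : 0 <= s -> s <= t -> t <= 1 -> <<s skip_gen s t >> D ->
  is_condexp P (F s) \1_D Z -> is_condexp P (F t) \1_D Z.
Proof.
move=> s0 st t1 hD DZ.
have s01 : 0 <= s <= 1 by rewrite s0 (le_trans st).
have t01 : 0 <= t <= 1 by rewrite t1 (le_trans s0).
have sF := sub_sigma_F P_complete BM s01.
have tF := sub_sigma_F P_complete BM t01.
have sK := sub_sigma_gen (skip_gen_measurable s01 t01).
have mD := sK.2 _ hD; have iD := pint_indic P mD.
have ind2 C : measurable C -> L2 P (\1_C : T -> R).
  move=> mC; apply: (@L2_bounded _ _ _ _ _ 1); first exact: measurable_indic.
  by move=> w; rewrite indicE; case: (_ \in _); rewrite ?normr1 ?normr0.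
have [mZ Zi hZ] := (is_condexpP Z sF iD).1 DZ.
apply/is_condexpP => //; split => //; first by apply: gmeas_sub mZ => //; exact: F_le.
move=> A FA; have mA := tF.2 _ FA; have iA := pint_indic P mA.
have [W AW] := condexp_exists sF iA.
have [mW Wi hW] := (is_condexpP W sF iA).1 AW.
have W2 := (condexp_L2 sF (ind2 _ mA) AW).1.
have Z2 := (condexp_L2 sF (ind2 _ mD) DZ).1.
have e1 := condexp_pull_out sF iA AW mZ (L2_mul (ind2 _ mA) Z2) (L2_mul W2 Z2).
have e2 := condexp_pull_out sF iD DZ mW (L2_mul (ind2 _ mD) W2) (L2_mul Z2 W2).
have [_ _ hK] := (is_condexpP W sK iA).1 (condexp_skip_indic s0 st t1 FA AW).
have e3 := hK _ hD.
transitivity (E (fun w => \1_A w * Z w)); first by apply: eq_Rintegral => w _; rewrite mulrC.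
rewrite -e1.
transitivity (E (fun w => Z w * W w)); first by apply: eq_Rintegral => w _; rewrite mulrC.
rewrite e2.
transitivity (E (fun w => W w * \1_D w)); first by apply: eq_Rintegral => w _; rewrite mulrC.
by rewrite e3; apply: eq_Rintegral => w _; rewrite mulrC.
Qed.

End conditional_independence.

(** * Continuity of conditional expectations in time *)

Section brownian_moments.
Context d (T : measurableType d) (R : realType) (P : probability T R).
Variables (B : R -> T -> R).
Hypotheses (BM : standard_brownian_motion P B).
Local Notation E f := (Rintegral P setT f).
Local Notation pint := (intg P setT).

Let incr_law s t : 0 <= s -> s < t -> t <= 1 ->
  [/\ measurable_fun setT (B t \- B s), 0 < Num.sqrt (t - s) &
      forall U, measurable U -> P ((B t \- B s) @^-1` U) = normal_prob 0 (Num.sqrt (t - s)) U].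
Proof.
move=> s0 st t1; split.
- apply: measurable_funB; apply: (bm_measurable BM); first by rewrite t1 (le_trans s0) ?ltW.
  by rewrite s0 (le_trans _ t1) ?ltW.
- by rewrite sqrtr_gt0 subr_gt0.
- exact: (bm_increment BM).
Qed.

Lemma incr_Lp p s t : 0 <= p -> 0 <= s -> s <= t -> t <= 1 -> Lp P p (fun w => B t w - B s w).
Proof.
move=> p0 s0; rewrite le_eqVlt => /predU1P[->|st] t1.
  by under eq_fun do rewrite subrr; exact: Lp_cst.
have [m sq l] := incr_law s0 st t1; exact: (normal_Lp m sq l).
Qed.

Lemma incr_sq_le s t : 0 <= s -> s <= t -> t <= 1 ->
  E (fun w => (B t w - B s w) ^+ 2) <= 8 * (t - s).
Proof.
move=> s0; rewrite le_eqVlt => /predU1P[->|st] t1.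
  by under eq_Rintegral do rewrite subrr expr0n/=; rewrite E_cst subrr mulr0.
have [m sq l] := incr_law s0 st t1; have := normal_sq_le m sq l.
by rewrite sqr_sqrtr// subr_ge0 ltW.
Qed.

Lemma bm_ae t : {ae P, forall w, B t w - B 0 w = B t w}.
Proof. by apply: filterS (bm_start BM) => w ->; rewrite subr0. Qed.

Lemma bm_Lp p t : 0 <= p -> 0 <= t -> t <= 1 -> Lp P p (B t).
Proof.
move=> p0 t0 t1; have mB : measurable_fun setT (B t) by apply: (bm_measurable BM); rewrite t0.
split => //; apply: (intg_ae measurableT (meas_absp p mB) _ (incr_Lp p0 (lexx 0) t0 t1).2).
by apply: filterS (bm_ae t) => w -> _.
Qed.

Lemma bm_L2 t : 0 <= t -> t <= 1 -> L2 P (B t).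
Proof. by move=> t0 t1; apply/Lp2; exact: bm_Lp. Qed.

Lemma bm_mean t : 0 <= t -> t <= 1 -> E (B t) = 0.
Proof.
move=> t0 t1.
have mB : measurable_fun setT (B t) by apply: (bm_measurable BM); rewrite t0.
have := incr_Lp ler01 (lexx 0) t0 t1; move=> [mi _].
rewrite -(@Int_ae _ _ _ P setT measurableT (fun w => B t w - B 0 w))//; last first.
  by apply: filterS (bm_ae t) => w -> _.
move: t0; rewrite le_eqVlt => /predU1P[<-|t0].
  by under eq_Rintegral do rewrite subrr; exact: E_cst.
have [m sq l] := incr_law (lexx 0) t0 t1; exact: (normal_mean m sq l).
Qed.

Lemma bm_sq_ge t : 0 <= t -> t <= 1 -> t <= E (fun w => B t w ^+ 2).
Proof.
move=> t0 t1.
have mB : measurable_fun setT (B t) by apply: (bm_measurable BM); rewrite t0.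
have := incr_Lp ler01 (lexx 0) t0 t1; move=> [mi _].
rewrite -(@Int_ae _ _ _ P setT measurableT (fun w => (B t w - B 0 w) ^+ 2)); last first.
- by apply: filterS (bm_ae t) => w -> _.
- exact: meas_sq.
- exact: meas_sq.
move: t0; rewrite le_eqVlt => /predU1P[<-|t0].
  by apply: Rintegral_ge0 => w _; exact: sqr_ge0.
have [m sq l] := incr_law (lexx 0) t0 t1; have := normal_sq_ge m sq l.
by rewrite sqr_sqrtr subr0// ltW.
Qed.

End brownian_moments.

(** * Events that hardly depend on the increments over a short interval *)

Section skip_approximation.
Context d (T : measurableType d) (R : realType) (P : probability T R).
Variables (B : R -> T -> R).
Hypotheses (P_complete : measure_is_complete P) (BM : standard_brownian_motion P B).
Local Notation E f := (Rintegral P setT f).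
Local Notation pint := (intg P setT).
Local Notation F := (filtration P B).
Local Notation inc := (incr_algebra B).
Implicit Types (s t u v : R) (A C D : set T).

Definition edist A C : R := E (fun w => `|\1_A w - \1_C w|).

(** The width [h] does not depend on the position of [s, t], which is what makes the later
    continuity in time uniform. Closure under complements, finite unions and L^1-limits makes this
    class a sigma-algebra. *)
Definition skippable A := measurable A /\ forall e, 0 < e -> exists2 h, 0 < h &
  forall s t, 0 <= s -> s <= t -> t <= 1 -> t - s < h ->
  exists2 D, <<s skip_gen P B s t >> D & edist A D <= e.

Let pi1 A C : measurable A -> measurable C -> pint (fun w => `|\1_A w - \1_C w|).
Proof. by move=> mA mC; apply: intg_abs => //; apply: intgB => //; exact: pint_indic. Qed.

Lemma edistU A A' C C' : measurable A -> measurable A' -> measurable C -> measurable C' ->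
  edist (A `|` A') (C `|` C') <= edist A C + edist A' C'.
Proof.
move=> mA mA' mC mC'; rewrite /edist -IntD//; [|exact: pi1..].
apply: Int_le => //; first by apply: pi1; exact: measurableU.
  by apply: intgD => //; exact: pi1.
move=> w _; rewrite !indicE !in_setU.
by case: (w \in A); case: (w \in A'); case: (w \in C); case: (w \in C') => /=;
  rewrite ?subrr ?subr0 ?sub0r ?normrN ?normr1 ?normr0; lra.
Qed.

Lemma edist_triangle A D C : measurable A -> measurable C -> measurable D ->
  edist A C <= edist A D + edist D C.
Proof.
move=> mA mC mD; rewrite /edist -IntD//; [|exact: pi1..].
apply: Int_le => //; [exact: pi1|by apply: intgD => //; exact: pi1|].
by move=> w _; exact: ler_distD.
Qed.

Lemma sub_sigma_skip s t : 0 <= s -> s <= t -> t <= 1 -> sub_sigma <<s skip_gen P B s t >>.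
Proof.
move=> s0 st t1; apply: sub_sigma_gen; apply: skip_gen_measurable => //.
  by rewrite s0 (le_trans st).
by rewrite t1 (le_trans s0).
Qed.

Lemma skippable0 : skippable set0.
Proof.
split => // e e0; exists 1 => // s t s0 st t1 _; exists set0.
  exact: (@measurable0 _ (g_sigma_algebraType _)).
rewrite /edist; under eq_Rintegral do rewrite subrr normr0.
by rewrite E_cst ltW.
Qed.

Lemma skippableC A : skippable A -> skippable (~` A).
Proof.
move=> [mA hA]; split; first exact: measurableC.
move=> e e0; have [h h0 H] := hA e e0; exists h => // s t s0 st t1 ts.
have [D hD De] := H s t s0 st t1 ts; exists (~` D).
  exact: (@measurableC _ (g_sigma_algebraType _)).
apply: le_trans De; rewrite /edist le_eqVlt; apply/orP; left; apply/eqP.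
apply: eq_Rintegral => w _; rewrite !indicE !in_setC.
by case: (w \in A); case: (w \in D) => /=; rewrite ?subrr ?subr0 ?sub0r ?normrN.
Qed.

Lemma skippableU A C : skippable A -> skippable C -> skippable (A `|` C).
Proof.
move=> [mA hA] [mC hC]; split; first exact: measurableU.
move=> e e0; have e2 : 0 < e / 2 by rewrite divr_gt0.
have [h h0 H] := hA _ e2; have [k k0 K] := hC _ e2.
exists (Order.min h k); first by rewrite lt_min h0.
move=> s t s0 st t1; rewrite lt_min => /andP[th tk].
have sK := sub_sigma_skip s0 st t1.
have [D hD De] := H s t s0 st t1 th; have [D' hD' De'] := K s t s0 st t1 tk.
exists (D `|` D'); first exact: (@measurableU _ (g_sigma_algebraType _)).
apply: le_trans (edistU mA mC (sK.2 _ hD) (sK.2 _ hD')) _; lra.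
Qed.

Lemma skippable_lim (A_ : nat -> set T) A : measurable A ->
  (forall n, skippable (A_ n)) -> (fun n => edist A (A_ n)) @ \oo --> 0 -> skippable A.
Proof.
move=> mA hA cv; split => // e e0; have e2 : 0 < e / 2 by rewrite divr_gt0.
have /cvgrPdist_lt/(_ _ e2)[N _ HN] := cv.
have := HN N (leqnn N); rewrite /= sub0r normrN => hN.
have [mN /(_ _ e2)[h h0 H]] := hA N; exists h => // s t s0 st t1 ts.
have sK := sub_sigma_skip s0 st t1.
have [D hD De] := H s t s0 st t1 ts; exists D => //.
apply: le_trans (edist_triangle mA (sK.2 _ hD) mN) _.
have := ler_norm (edist A (A_ N)); lra.
Qed.

Lemma skippable_sigma : sigma_algebra setT skippable.
Proof.
split; first exact: skippable0.
  by move=> A hA; rewrite setTD; exact: skippableC.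
move=> A hA; have mA n : measurable (A n) by have [] := hA n.
have mU : measurable (\bigcup_k A k) by exact: bigcup_measurable.
pose A_ n := \big[setU/set0]_(k < n) A k.
have hA_ n : skippable (A_ n).
  rewrite /A_; elim: n => [|n IH]; first by rewrite big_ord0; exact: skippable0.
  by rewrite big_ord_recr; apply: skippableU.
have mA_ n : measurable (A_ n) by have [] := hA_ n.
apply: (@skippable_lim A_) => //.
have [] := @Int_dominated _ _ _ P setT measurableT (fun n => \1_(A_ n)) \1_(\bigcup_k A k) (fun=> 1) _ _ _ _ _.
- by move=> n; exact: measurable_indic.
- exact: measurable_indic.
- apply: aeW => w _; apply: cvg_near_cst.
  have [[k _ Ak]|nA] := pselect ((\bigcup_k A k) w).
    have := nbhs_infty_gt k; apply: filterS => n /= kn.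
    rewrite !indicE !mem_set//; first by exists k.
    by rewrite /A_ -bigcup_mkord; exists k.
  apply: nearW => n; rewrite !indicE !memNset//.
  by rewrite /A_ -bigcup_mkord => -[k _ Ak]; apply: nA; exists k.
- exact: pint_cst.
- by move=> n; apply: aeW => w _; rewrite indicE; case: (_ \in _); rewrite ?normr1 ?normr0.
move=> _ + _; apply: cvg_trans; apply: near_eq_cvg; apply: nearW => n.
by apply: eq_Rintegral => w _; rewrite distrC.
Qed.

Lemma skippable_null A : P.-negligible A -> skippable A.
Proof.
move=> nA; have mA : measurable A by exact: P_complete.
split => // e e0; exists 1 => // s t s0 st t1 _; exists set0.
  exact: (@measurable0 _ (g_sigma_algebraType _)).
suff -> : edist A set0 = E (fun=> 0) by rewrite E_cst ltW.
apply: (Int_ae measurableT).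
- by apply: measurableT_comp => //; apply: measurable_funB; exact: measurable_indic.
- exact: measurable_cst.
- have [N [mN N0 AN]] := nA; exists N; split => // w /= h; apply: AN.
  apply: contrapT => nAw; apply: h => _.
  by rewrite !indicE !memNset// subrr normr0.
Qed.

(* [frozen s t r] is the value at time [r] of the path stopped during [s, t]. *)
Let frozen s t r w := if r <= s then B r w else if r <= t then B s w
  else B s w + (B r w - B t w).

Let frozen_meas s t r : 0 <= s -> s <= t -> t <= 1 -> 0 <= r -> r <= 1 ->
  gmeas <<s skip_gen P B s t >> (frozen s t r).
Proof.
move=> s0 st t1 r0 r1; have sK := sub_sigma_skip s0 st t1.
have t0 := le_trans s0 st; have s1 := le_trans st t1.
have s01 : 0 <= s <= 1 by rewrite s0.
have sF := sub_sigma_F P_complete BM s01.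
have mF u : 0 <= u -> u <= s -> gmeas <<s skip_gen P B s t >> (B u).
  move=> u0 us; apply: (gmeas_sub sF sK (@skip_F _ _ _ P B s t)).
  by apply: gmeas_F => //; rewrite u0.
rewrite /frozen; have [rs|rs] := leP r s; first exact: mF.
have [rt|rt] := leP r t; first exact: mF.
apply: measurable_funD; first exact: mF.
apply: (gmeas_sub (sub_sigma_incr BM t0 (lexx 1)) sK (@skip_inc _ _ _ P B s t)).
by apply: (gmeas_incr BM) => //; rewrite ltW.
Qed.

Let frozen_dist s t r : 0 <= s -> s <= t -> t <= 1 -> 0 <= r -> r <= 1 ->
  L2 P (fun w => B r w - frozen s t r w) /\
  E (fun w => (B r w - frozen s t r w) ^+ 2) <= 8 * (t - s).
Proof.
move=> s0 st t1 r0 r1; have t0 := le_trans s0 st.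
rewrite /frozen; have [rs|rs] := leP r s.
  under eq_fun do rewrite subrr; split; first by apply: (@L2_bounded _ _ _ _ _ 0) => // w; rewrite normr0.
  under eq_Rintegral do rewrite subrr expr0n/=; rewrite E_cst.
  by rewrite mulr_ge0// subr_ge0.
have [rt|rt] := leP r t.
  split; first by apply/Lp2; apply: (incr_Lp BM) => //; exact: ltW.
  apply: le_trans (incr_sq_le BM s0 (ltW rs) r1) _.
  by rewrite ler_pM2l// lerB.
have e w : B r w - (B s w + (B r w - B t w)) = B t w - B s w by ring.
under eq_fun do rewrite e; split; first by apply/Lp2; exact: (incr_Lp BM).
by under eq_Rintegral do rewrite e; exact: (incr_sq_le BM s0 st t1).
Qed.

Lemma skippable_ray r a : 0 <= r -> r <= 1 -> skippable (B r @^-1` `]-oo, a[).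
Proof.
move=> r0 r1; have mB : measurable_fun setT (B r) by apply: (bm_measurable BM); rewrite r0.
have mray (f : T -> R) (I : set R) : measurable_fun setT f -> measurable I -> measurable (f @^-1` I).
  by move=> mf mI; rewrite -[X in measurable X]setTI; exact: mf.
split; first exact: mray.
move=> e e0.
pose S n := B r @^-1` `[a - 2 * n.+1%:R^-1, a[.
have mS n : measurable (S n) by exact: mray.
have e2 : 0 < e / 2 by rewrite divr_gt0.
have cS : (fun n => E \1_(S n)) @ \oo --> 0.
  have [] := @Int_dominated _ _ _ P setT measurableT (fun n => \1_(S n)) (fun=> 0) (fun=> 1) _ _ _ _ _.
  - by move=> n; exact: measurable_indic.
  - exact: measurable_cst.
  - apply: aeW => w _; apply: cvg_near_cst.
    have [wa|wa] := ltP (B r w) a; last first.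
      apply: nearW => n; rewrite indicE memNset//.
      by rewrite /S /= in_itv/= => /andP[_]; rewrite ltNge wa.
    have ga : 0 < (a - B r w) / 2 by rewrite divr_gt0// subr_gt0.
    have /cvgrPdist_lt/(_ _ ga) := @cvg_harmonic R.
    apply: filterS => n; rewrite /= sub0r normrN ger0_norm// => hn.
    rewrite indicE memNset// /S /= in_itv/= => /andP[h _].
    move: hn h; rewrite /harmonic /= ltr_pdivlMr//; move: (n.+1%:R^-1) => k; lra.
  - exact: pint_cst.
  - by move=> n; apply: aeW => w _; rewrite indicE; case: (_ \in _); rewrite ?normr1 ?normr0.
  by move=> _ _; rewrite E_cst.
have /cvgrPdist_lt/(_ _ e2)[N _ HN] := cS.
have := HN N (leqnn N); rewrite /= sub0r normrN => /(le_lt_trans (ler_norm _)) SN.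
pose k : R := N.+1%:R^-1; have k0 : 0 < k by rewrite invr_gt0.
(* Chosen so that Chebyshev's bound 8(t - s)/k^2 is at most e/2; the other half of the error is the
   probability of the strip. *)
exists (e / 2 * k ^+ 2 / 8); first by rewrite divr_gt0// mulr_gt0// exprn_gt0.
move=> s t s0 st t1 ts; have sK := sub_sigma_skip s0 st t1.
have mf := frozen_meas s0 st t1 r0 r1.
have [f2 fd] := frozen_dist s0 st t1 r0 r1.
exists (frozen s t r @^-1` `]-oo, a - k[).
  by have := mf measurableT `]-oo, a - k[%classic (measurable_itv _); rewrite setTI gmeas_measE.
have k2 : 0 < k ^+ 2 by rewrite exprn_gt0.
have bnd : edist (B r @^-1` `]-oo, a[) (frozen s t r @^-1` `]-oo, a - k[) <=
    E (fun w => \1_(S N) w + (k ^+ 2)^-1 * (B r w - frozen s t r w) ^+ 2).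
  apply: Int_le => //.
  - by apply: pi1; apply: mray => //; exact: gmeas_meas mf.
  - by apply: intgD => //; [exact: pint_indic|apply: intgZ => //; exact: f2.2].
  move=> w _; rewrite !indicE.
  have key : k < `|B r w - frozen s t r w| ->
      1 <= (k ^+ 2)^-1 * (B r w - frozen s t r w) ^+ 2.
    move=> h; rewrite mulrC ler_pdivlMr// mul1r -[leRHS]real_normK ?num_real//.
    by rewrite ler_pXn2r ?nnegrE ?normr_ge0//; exact: ltW.
  have pos : 0 <= (k ^+ 2)^-1 * (B r w - frozen s t r w) ^+ 2.
    by rewrite mulr_ge0 ?sqr_ge0// invr_ge0 ltW.
  have iB : (w \in B r @^-1` `]-oo, a[) = (B r w < a).
    by apply/idP/idP; rewrite inE /= in_itv.
  have iF : (w \in frozen s t r @^-1` `]-oo, a - k[) = (frozen s t r w < a - k).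
    by apply/idP/idP; rewrite inE /= in_itv.
  have iS : (w \in S N) = (a - 2 * k <= B r w) && (B r w < a).
    by apply/idP/idP; rewrite inE /S /= in_itv.
  rewrite iB iF iS; have [h1|h1] := ltP (B r w) a; have [h2|h2] := ltP (frozen s t r w) (a - k);
    rewrite ?andbT ?andbF /= ?subrr ?subr0 ?sub0r ?normrN ?normr0 ?normr1.
  - by rewrite addr_ge0.
  - have [h3|h3] := leP (a - 2 * k) (B r w); rewrite /=; first lra.
    have : k < `|B r w - frozen s t r w| by rewrite ltr0_norm; lra.
    by move=> /key; lra.
  - have : k < `|B r w - frozen s t r w| by rewrite gtr0_norm; lra.
    by move=> /key; lra.
  - by rewrite add0r.
apply: le_trans bnd _; rewrite IntD//; [|exact: pint_indic|by apply: intgZ => //; exact: f2.2].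
rewrite IntZ//; last exact: f2.2.
have : (k ^+ 2)^-1 * E (fun w => (B r w - frozen s t r w) ^+ 2) <= e / 2.
  rewrite mulrC ler_pdivrMr//; apply: le_trans fd _.
  by move: ts; rewrite ltr_pdivlMr//; lra.
lra.
Qed.

Lemma F1_skippable : F 1 `<=` skippable.
Proof.
have sS := skippable_sigma.
apply: smallest_sub => //.
move=> A [hA|]; last exact: skippable_null.
apply: smallest_sub hA => // _ [r [U [/andP[r0 r1] mU ->]]].
pose Q := [set U : set R | skippable (B r @^-1` U)].
suff : @measurable _ (measurableTypeR R) `<=` Q by apply.
rewrite RGenInftyO.measurableE; apply: smallest_sub.
  have [q0 qC qU] := sS; split.
  - by rewrite /Q /= preimage_set0.
  - by move=> V QV; rewrite /Q /= setTD preimage_setC; exact: skippableC.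
  - by move=> V QV; rewrite /Q /= preimage_bigcup; exact: qU.
by move=> _ [a ->]; exact: skippable_ray.
Qed.

(** [Y] is first replaced by its conditional expectation given F(1), to which approximation by
    skippable events applies. A combination of events that skip [s, t] has the same conditional
    expectation at both times, and conditioning contracts L^1, so the two errors add up. *)
Lemma condexp_L1_continuous Y : pint Y -> forall e, 0 < e -> exists2 h, 0 < h &
  forall s t Zs Zt, 0 <= s -> s <= t -> t <= 1 -> t - s < h ->
    is_condexp P (F s) Y Zs -> is_condexp P (F t) Y Zt ->
    E (fun w => `|Zt w - Zs w|) <= e.
Proof.
move=> Yi.
have I01 : (0 : R) <= (1 : R) <= 1 by rewrite ler01 lexx.
have sF1 := sub_sigma_F P_complete BM I01.
have [Y1 YY1] := condexp_exists sF1 Yi; have [mY1 Y1i _] := YY1.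
(* The approximation X' may depend on s and t; what matters is that one and the same [Z] is a
   version of both of its conditional expectations. *)
pose apx X e h := forall s t, 0 <= s -> s <= t -> t <= 1 -> t - s < h ->
  exists X' Z, [/\ pint X', is_condexp P (F s) X' Z, is_condexp P (F t) X' Z &
    E (fun w => `|X w - X' w|) <= e].
pose Q X := [/\ gmeas (F 1) X, pint X & forall e, 0 < e -> exists2 h, 0 < h & apx X e h].
have Fst s t : 0 <= s -> s <= t -> t <= 1 ->
    [/\ sub_sigma (F s), sub_sigma (F t), F s `<=` F 1 & F t `<=` F 1].
  move=> s0 st t1; split; try (apply: sub_sigma_F => //); try apply: F_le => //.
  - by rewrite s0 (le_trans st).
  - by rewrite t1 (le_trans s0).
  - exact: le_trans t1.
have [|||f_ [Qf cf bf]] := @simple_approx _ (g_sigma_algebraType (F 1)) R Q _ _ _ Y1 mY1.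
- move=> A; rewrite gmeas_measE// => FA; have mA := sF1.2 _ FA.
  split; [exact: gmeas_indic|exact: pint_indic|move=> e e0].
  have [_ /(_ _ e0)[h h0 H]] := F1_skippable FA; exists h => // s t s0 st t1 ts.
  have [sF tF _ _] := Fst s t s0 st t1.
  have [D hD De] := H s t s0 st t1 ts.
  have mD := (sub_sigma_skip s0 st t1).2 _ hD; have iD := pint_indic P mD.
  have [Z DZ] := condexp_exists sF iD; exists \1_D, Z; split => //.
  exact: (condexp_skip P_complete BM s0 st t1 hD).
- move=> f g [mf fi hf] [mg gi hg]; split; [exact: measurable_funD|exact: intgD|].
  move=> e e0; have e2 : 0 < e / 2 by rewrite divr_gt0.
  have [h h0 H] := hf _ e2; have [k k0 K] := hg _ e2.
  exists (Order.min h k); first by rewrite lt_min h0.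
  move=> s t s0 st t1; rewrite lt_min => /andP[th tk].
  have [sF tF _ _] := Fst s t s0 st t1.
  have [f' [Zf [f'i a1 a2 a3]]] := H s t s0 st t1 th.
  have [g' [Zg [g'i b1 b2 b3]]] := K s t s0 st t1 tk.
  exists (fun w => f' w + g' w), (fun w => Zf w + Zg w).
  split; [exact: intgD|exact: condexpD|exact: condexpD|].
  apply: (@le_trans _ _ (E (fun w => `|f w - f' w| + `|g w - g' w|))).
    apply: Int_le => //.
    + by apply: intg_abs => //; apply: intgB => //; exact: intgD.
    + by apply: intgD => //; apply: intg_abs => //; exact: intgB.
    + by move=> w _; rewrite opprD addrACA ler_normD.
  rewrite IntD//; [lra|by apply: intg_abs => //; exact: intgB..].
- move=> c f [mf fi hf]; split; [exact: measurable_funM|exact: intgZ|].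
  move=> e e0; have c1 : 0 < `|c| + 1 by rewrite ltr_wpDl.
  have e2 : 0 < e / (`|c| + 1) by rewrite divr_gt0.
  have [h h0 H] := hf _ e2; exists h => // s t s0 st t1 th.
  have [sF tF _ _] := Fst s t s0 st t1.
  have [f' [Zf [f'i a1 a2 a3]]] := H s t s0 st t1 th.
  exists (fun w => c * f' w), (fun w => c * Zf w).
  split; [exact: intgZ|exact: condexpZ|exact: condexpZ|].
  under eq_Rintegral do rewrite -mulrBr normrM.
  have ai : pint (fun w => `|f w - f' w|) by apply: intg_abs => //; exact: intgB.
  rewrite IntZ//; move: a3; rewrite ler_pdivlMr// => a3.
  apply: le_trans a3; rewrite mulrC ler_wpM2l ?lerDl//.
  by apply: Rintegral_ge0 => w _.
have [] := @Int_dominated _ _ _ P setT measurableT f_ Y1 (fun w => `|Y1 w|) _ _ _ _ _.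
- by move=> n; have [m _ _] := Qf n; exact: gmeas_meas m.
- exact: gmeas_meas mY1.
- by apply: aeW => w _; exact: cf.
- exact: intg_abs.
- by move=> n; apply: aeW => w _; exact: bf.
move=> _ c1 _ e e0; have e4 : 0 < e / 4 by rewrite divr_gt0.
have /cvgrPdist_lt/(_ _ e4)[N _ HN] := c1.
have := HN N (leqnn N); rewrite /= sub0r normrN => /(le_lt_trans (ler_norm _)) hN.
have [_ fi /(_ _ e4)[h h0 H]] := Qf N; exists h => // s t Zs Zt s0 st t1 ts Ys Yt.
have [sF tF s1F t1F] := Fst s t s0 st t1.
have [X' [Z [X'i a1 a2 a3]]] := H s t s0 st t1 ts.
have Ys' := (condexp_tower _ sF1 sF s1F YY1).1 Ys.
have Yt' := (condexp_tower _ sF1 tF t1F YY1).1 Yt.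
have b1 := condexp_L1_dist sF Y1i X'i Ys' a1.
have b2 := condexp_L1_dist tF Y1i X'i Yt' a2.
have [_ Zi _] := a1; have [_ Zsi _] := Ys; have [_ Zti _] := Yt.
have d1 : E (fun w => `|Y1 w - X' w|) <= e / 2.
  apply: (@le_trans _ _ (E (fun w => `|f_ N w - Y1 w| + `|f_ N w - X' w|))).
    apply: Int_le => //.
    + by apply: intg_abs => //; exact: intgB.
    + by apply: intgD => //; apply: intg_abs => //; exact: intgB.
    + by move=> w _; rewrite [X in _ <= X + _]distrC; exact: ler_distD.
  rewrite IntD//; [lra|by apply: intg_abs => //; exact: intgB..].
apply: (@le_trans _ _ (E (fun w => `|Zt w - Z w| + `|Zs w - Z w|))).
  apply: Int_le => //.
  + by apply: intg_abs => //; exact: intgB.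
  + by apply: intgD => //; apply: intg_abs => //; exact: intgB.
  + by move=> w _; rewrite [X in _ <= _ + X]distrC; exact: ler_distD.
rewrite IntD//; [lra|by apply: intg_abs => //; exact: intgB..].
Qed.

End skip_approximation.

Section fast_convergence.
Context d (T : measurableType d) (R : realType) (mu : {measure set T -> \bar R}).
Local Notation Int f := (Rintegral mu setT f).
Local Notation int := (intg mu setT).

Lemma ae_summable (u : nat -> T -> R) :
  (forall n x, 0 <= u n x) -> (forall n, int (u n)) -> (forall n, Int (u n) <= 2^-1 ^+ n) ->
  exists2 g, int g & {ae mu, forall x, forall n, \sum_(k < n) u k x <= g x}.
Proof.
move=> u0 ui ub; pose f n x := (\sum_(k < n) u k x)%:E.
have fi n : int (fun x => \sum_(k < n) u k x).
  elim: n => [|n IH].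
    by under eq_fun do rewrite big_ord0; exact: integrable0.
  by under eq_fun do rewrite big_ord_recr/=; exact: intgD.
have mf n : measurable_fun setT (f n) by exact: measurable_int (fi n).
have f0 n x : setT x -> (0 <= f n x)%E by move=> _; rewrite lee_fin sumr_ge0.
have nd x : setT x -> nondecreasing_seq (f ^~ x).
  move=> _; apply/nondecreasing_seqP => n.
  by rewrite lee_fin big_ord_recr/= lerDl.
have fb n : (\int[mu]_x f n x <= 2%:E)%E.
  rewrite (intgE measurableT (fi n)) lee_fin.
  have : Int (fun x => \sum_(k < n) u k x) <= 2 - 2 * 2^-1 ^+ n.
    elim: n => [|n IH].
      under eq_Rintegral do rewrite big_ord0.
      by rewrite /Rintegral integral0 expr0 mulr1 subrr.
    rewrite (_ : Int _ = Int (fun x => \sum_(k < n) u k x) + Int (u n)); last first.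
      by rewrite -IntD//; apply: eq_Rintegral => x _; rewrite big_ord_recr.
    apply: le_trans (lerD IH (ub n)) _; rewrite exprS; lra.
  have : 0 <= 2^-1 ^+ n :> R by rewrite exprn_ge0// invr_ge0.
  lra.
pose G x := limn (f ^~ x).
have cG x : f ^~ x @ \oo --> G x by apply: ereal_nondecreasing_is_cvgn; exact: nd.
have mG : measurable_fun setT G.
  by apply: (emeasurable_fun_cvg f) => // x _; exact: cG.
have G0 x : (0 <= G x)%E by apply: lime_ge; [exact: cG|apply: nearW => n; exact: f0].
have GI : mu.-integrable setT G.
  apply/integrableP; split => //.
  under eq_integral do rewrite gee0_abs//.
  rewrite (@monotone_convergence _ _ _ mu setT measurableT f mf f0 nd).
  apply: (@le_lt_trans _ _ 2%:E); last by rewrite ltry.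
  apply: lime_le; last exact: nearW.
  apply: ereal_nondecreasing_is_cvgn => a b ab.
  by apply: ge0_le_integral => // x Tx; [exact: f0|exact: nd Tx _ _ ab].
have mg : measurable_fun setT (fine \o G) by exact: measurableT_comp.
have fin := integrable_ae measurableT GI.
have ge x n : (f n x <= G x)%E.
  apply: lime_ge; first exact: cG.
  by apply: filterS (nbhs_infty_ge n) => m /= nm; exact: nd nm.
exists (fine \o G).
  have : {ae mu, forall x, setT x -> G x = (EFin \o (fine \o G)) x}.
    by apply: filterS fin => x /[apply] h; rewrite /= fineK.
  move=> ae1; apply/integrableP; split; first exact/measurable_EFinP.
  have /integrableP[_] := GI; apply: le_lt_trans.
  rewrite le_eqVlt; apply/orP; left; apply/eqP; apply: ae_eq_integral => //.
  - by apply: measurableT_comp => //; exact/measurable_EFinP.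
  - exact: measurableT_comp.
  - by apply: filterS ae1 => x h Tx; exact: (esym (congr1 abse (h Tx))).
apply: filterS fin => x /(_ I) h n; rewrite -lee_fin /= fineK//; exact: ge.
Qed.

Lemma sum_bounded_cvg0 (u : nat -> R) (g : R) : (forall n, 0 <= u n) ->
  (forall n, \sum_(k < n) u k <= g) -> u @ \oo --> 0.
Proof.
move=> u0 ub; apply: cvg_series_cvg_0; apply: nondecreasing_is_cvgn.
  by apply/nondecreasing_seqP => n; rewrite /series /= big_nat_recr//= lerDl.
by exists g => _ [n _ <-]; rewrite /series /= big_mkord.
Qed.

(** The geometric rate makes the errors summable, so the whole sequence converges almost everywhere
    and no subsequence is extracted. This matters where one sequence must serve every time t. *)
Lemma fast_cvg_ae (X_ : nat -> T -> R) (X : T -> R) :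
  (forall n, int (X_ n)) -> int X ->
  (forall n, Int (fun x => `|X_ n x - X x|) <= 2^-1 ^+ n) ->
  {ae mu, forall x, X_ ^~ x @ \oo --> X x}.
Proof.
move=> Xi_ Xi h.
have [|n|//|g gi] := @ae_summable (fun n x => `|X_ n x - X x|) => //.
  by apply: intg_abs => //; exact: intgB.
apply: filterS => x hx; apply/subr_cvg0; apply/norm_cvg0P.
by apply: (@sum_bounded_cvg0 _ (g x)) => // n; exact: normr_ge0.
Qed.

End fast_convergence.

(** * Progressive versions and continuity of second moments *)

Section martingales.
Context d (T : measurableType d) (R : realType) (P : probability T R).
Variables (B : R -> T -> R).
Hypotheses (P_complete : measure_is_complete P) (BM : standard_brownian_motion P B).
Local Notation E f := (Rintegral P setT f).
Local Notation pint := (intg P setT).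
Local Notation F := (filtration P B).
Implicit Types (s t u v : R).

Lemma condexpP t Y : 0 <= t <= 1 -> pint Y ->
  is_condexp P (F t) Y (condexp P (F t) Y).
Proof.
move=> t01 Yi; have [Z YZ] := condexp_exists (sub_sigma_F P_complete BM t01) Yi.
exact: (@xgetI _ (fun=> 0) [set Z | is_condexp P (F t) Y Z] Z).
Qed.

(** Each cell uses the value at its left endpoint, which is known at every time of the cell. The sum
    has [m.+1] cells because t = 1 falls into the cell starting at 1. *)
Lemma progressive_step (Z : R -> T -> R) m : (0 < m)%N ->
  (forall t, 0 <= t <= 1 -> gmeas (F t) (Z t)) ->
  progressive P B (fun t w => \sum_(k < m.+1)
    \1_(`[k%:R / m%:R, k.+1%:R / m%:R[%classic : set R) t * Z (k%:R / m%:R) w).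
Proof.
move=> m0 mZ t0 t01; have mp : 0 < m%:R :> R by rewrite ltr0n.
have sF := sub_sigma_F P_complete BM t01.
apply: measurable_sum => k.
have [kt|kt] := leP (k%:R / m%:R) t0; last first.
  apply: (eq_measurable_fun (cst (0 : R))); last exact: measurable_cst.
  move=> [t w]; rewrite inE => -[/=]; rewrite in_itv/= => /andP[_ tt] _.
  rewrite indicE memNset ?mul0r//= in_itv/= => /andP[h _].
  by have := lt_le_trans kt (le_trans h tt); rewrite ltxx.
have k01 : (0 : R) <= (k%:R / m%:R : R) <= 1.
  by rewrite divr_ge0//= (le_trans kt)//; case/andP: t01.
apply: measurable_funM.
  apply: measurable_funTS.
  have mI := @measurable_indic _ (measurableTypeR R) R setT _
    (measurable_itv `[k%:R / m%:R, k.+1%:R / m%:R[).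
  exact: (measurableT_comp mI measurable_fst).
have mZk : gmeas (F t0) (Z (k%:R / m%:R)).
  by apply: gmeas_sub (mZ _ k01) => //; [exact: sub_sigma_F|exact: F_le].
by apply: measurable_funTS; exact: (measurableT_comp mZk measurable_snd).
Qed.

Lemma step_eval m t : (0 < m)%N -> 0 <= t <= 1 ->
  exists s, [/\ 0 <= s, s <= t, t - s < m%:R^-1 & forall f : R -> R, \sum_(k < m.+1)
    \1_(`[k%:R / m%:R, k.+1%:R / m%:R[%classic : set R) t * f (k%:R / m%:R) = f s].
Proof.
move=> m0 /andP[t0 t1]; have mp : 0 < m%:R :> R by rewrite ltr0n.
pose k := Num.truncn (t * m%:R).
have /andP[k1 k2] : (k%:R : R) <= t * m%:R < k.+1%:R by apply: Num.Theory.truncn_itv; rewrite mulr_ge0// ltW.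
have km : (k < m.+1)%N.
  rewrite ltnS -(ler_nat R) (le_trans k1)// ler_piMl// ltW//.
have kt : k%:R / m%:R <= t by rewrite ler_pdivrMr.
have tk : t < k.+1%:R / m%:R by rewrite ltr_pdivlMr.
exists (k%:R / m%:R); split => //.
- by move: tk; rewrite -natr1 mulrDl mul1r; lra.
move=> f; rewrite (bigD1 (Ordinal km))//= big1 ?addr0.
  by rewrite indicE mem_set ?mul1r//= in_itv/= kt.
move=> [j jm] /= jk; rewrite indicE memNset ?mul0r//= in_itv/= => /andP[h1 h2].
move: jk; rewrite -val_eqE /= => /eqP; apply.
move: h1 h2; rewrite ler_pdivrMr// ltr_pdivlMr// => h1 h2.
apply/eqP; rewrite eqn_leq; apply/andP; split.
  by rewrite -ltnS -(ltr_nat R); exact: le_lt_trans h1 k2.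
by rewrite -ltnS -(ltr_nat R); exact: le_lt_trans k1 h2.
Qed.

(** The meshes are taken from the uniform modulus of continuity, so that at every fixed time the
    n-th step process is within 2^-n in L^1. The upper limit is defined for every path and is
    progressive, and at each fixed time it agrees almost surely with the conditional expectation. *)
Lemma martingale_version_exists Y : pint Y -> exists Yt, martingale_version P B Y Yt.
Proof.
move=> Yi; pose Z t := condexp P (F t) Y.
have hZ t : 0 <= t <= 1 -> is_condexp P (F t) Y (Z t) by move=> t01; exact: condexpP.
have mZ t : 0 <= t <= 1 -> gmeas (F t) (Z t) by move=> /hZ[].
have /choice[m hm] n : exists m : nat, (0 < m)%N /\ forall s t, 0 <= s -> s <= t -> t <= 1 ->
    t - s < m%:R^-1 -> E (fun w => `|Z t w - Z s w|) <= 2^-1 ^+ n.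
  have e0 : 0 < 2^-1 ^+ n :> R by rewrite exprn_gt0// invr_gt0.
  have [h h0 H] := condexp_L1_continuous P_complete BM Yi e0.
  have /cvgrPdist_lt/(_ _ h0)[m _ Hm] := @cvg_harmonic R.
  have := Hm m (leqnn m); rewrite /= sub0r normrN ger0_norm// => hm.
  exists m.+1; split => // s t s0 st t1 ts; apply: (H s t) => //.
  - exact: lt_trans hm.
  - by apply: hZ; rewrite s0 (le_trans st).
  - by apply: hZ; rewrite t1 (le_trans s0).
pose W n t w : R := \sum_(k < (m n).+1)
    \1_(`[k%:R / (m n)%:R, k.+1%:R / (m n)%:R[%classic : set R) t * Z (k%:R / (m n)%:R) w.
have pW n : progressive P B (W n) by apply: progressive_step => //; have [] := hm n.
pose Yt t w := fine (limn_esup (fun n => (W n t w)%:E)).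
have pY : progressive P B Yt.
  move=> t0 t01; apply: measurableT_comp => //.
  apply: measurable_fun_limn_esup => n; apply/measurable_EFinP; exact: pW.
exists Yt; split => // t t01; have sF := sub_sigma_F P_complete BM t01.
have /andP[t0 t1] := t01.
have mYt : gmeas (F t) (Yt t).
  have := pY t t01 => h; pose f (w : g_sigma_algebraType (F t)) := (t, w).
  have mf : measurable_fun setT f by exact: measurable_pair1.
  rewrite (_ : Yt t = (fun z : R * g_sigma_algebraType (F t) => Yt z.1 z.2) \o f)//.
  apply: (measurable_comp _ _ h mf) => //.
    by apply: measurableX => //; exact: measurable_itv.
  by move=> _ [w _ <-]; split => //=; rewrite in_itv/= t0 lexx.
apply: (@condexp_congr_ae _ _ _ P (F t) Y (Z t)) => //; last exact: hZ.
have [_ Zti _] := hZ t t01.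
have hs n : exists s, [/\ 0 <= s, s <= t, t - s < (m n)%:R^-1 & W n t = Z s].
  have [m0 _] := hm n; have [s [s0 st ts sE]] := step_eval m0 t01.
  by exists s; split => //; apply/funext => w; rewrite /W (sE (fun s => Z s w)).
have cv : {ae P, forall w, (fun n => W n t w) @ \oo --> Z t w}.
  apply: fast_cvg_ae => // n; have [s [s0 st ts ->]] := hs n.
    by have [] := hZ s _; rewrite ?s0 ?(le_trans st).
  have [_ H] := hm n; apply: le_trans (H s t s0 st t1 ts).
  rewrite le_eqVlt; apply/orP; left; apply/eqP; apply: eq_Rintegral => w _.
  by rewrite distrC.
apply: filterS cv => w cw; rewrite /Yt.
have c : (fun n => (W n t w)%:E) @ \oo --> (Z t w)%:E by apply: cvg_EFin => //; exact: nearW.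
by rewrite (cvg_limn_einf_sup c).2.
Qed.

(** The last identity turns the variation of a squared norm into a pairing that is linear in the
    increment, so continuity in L^1 can be used after truncating [Zu]. *)
Lemma condexp_sq_diff s t u Y Zs Zt Zu : 0 <= s -> s <= t -> t <= u -> u <= 1 -> pint Y ->
  is_condexp P (F s) Y Zs -> is_condexp P (F t) Y Zt -> is_condexp P (F u) Y Zu ->
  L2 P Zu ->
  [/\ L2 P Zs, L2 P Zt, E (fun w => Zs w ^+ 2) <= E (fun w => Zu w ^+ 2),
      E (fun w => Zt w ^+ 2) <= E (fun w => Zu w ^+ 2) &
      E (fun w => Zt w ^+ 2) - E (fun w => Zs w ^+ 2) = E (fun w => Zu w * (Zt w - Zs w))].
Proof.
move=> s0 st tu u1 Yi Ys Yt Yu Zu2.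
have su := le_trans st tu; have t0 := le_trans s0 st.
have sF : sub_sigma (F s) by apply: sub_sigma_F => //; rewrite s0 (le_trans su).
have tF : sub_sigma (F t) by apply: sub_sigma_F => //; rewrite t0 (le_trans tu).
have uF : sub_sigma (F u) by apply: sub_sigma_F => //; rewrite u1 (le_trans t0).
have [_ Zui _] := Yu.
have Ys' := (condexp_tower _ uF sF (F_le su) Yu).1 Ys.
have Yt' := (condexp_tower _ uF tF (F_le tu) Yu).1 Yt.
have [Zs2 les] := condexp_L2 sF Zu2 Ys'; have [Zt2 let_] := condexp_L2 tF Zu2 Yt'.
split => //.
have [mZs _ _] := Ys; have [mZt _ _] := Yt.
have es := condexp_pull_out sF Zui Ys' mZs (L2_mul Zu2 Zs2) (L2_mul Zs2 Zs2).
have et := condexp_pull_out tF Zui Yt' mZt (L2_mul Zu2 Zt2) (L2_mul Zt2 Zt2).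
under eq_Rintegral do rewrite expr2; rewrite et.
under [X in _ - X]eq_Rintegral do rewrite expr2; rewrite es.
rewrite -IntB//; [|exact: L2_mul..].
by apply: eq_Rintegral => w _; rewrite mulrBr.
Qed.

(** [Zu] is split at a level M: the bounded part pairs with an increment that is small in L^1, the
    tail is handled by Cauchy-Schwarz. Only times up to a fixed u with [Zu] in L^2 are covered,
    since at time 1 the norm may be infinite. *)
Lemma condexp_sq_continuous u Y Zu : 0 <= u <= 1 -> pint Y ->
  is_condexp P (F u) Y Zu -> L2 P Zu -> forall e, 0 < e -> exists2 h, 0 < h &
  forall s t Zs Zt, 0 <= s -> s <= t -> t <= u -> t - s < h ->
    is_condexp P (F s) Y Zs -> is_condexp P (F t) Y Zt ->
    `|E (fun w => Zt w ^+ 2) - E (fun w => Zs w ^+ 2)| <= e.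
Proof.
move=> /andP[u0 u1] Yi Yu Zu2 e e0; have [mZu Zui] := Zu2.
set c := E (fun w => Zu w ^+ 2).
have c0 : 0 <= c by exact: E_sq_ge0.
pose A n := [set w | `|Zu w| <= n%:R].
have mA n : measurable (A n).
  have := mZu measurableT `[- n%:R, n%:R]%classic (measurable_itv _).
  rewrite setTI; congr measurable; apply/seteqP.
  by split => w; rewrite /A /= in_itv/= ler_norml.
have An n w : \1_(A n) w = (`|Zu w| <= n%:R)%R%:R :> R.
  by rewrite indicE; congr (nat_of_bool _)%:R; apply/idP/idP; rewrite inE /A.
pose tr n w := Zu w - Zu w * \1_(A n) w.
have trle n w : `|tr n w| <= `|Zu w|.
  rewrite /tr An; have [h|h] := leP `|Zu w| n%:R; rewrite /= ?mulr1n ?mulr0n.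
    by rewrite mulr1 subrr normr0.
  by rewrite mulr0 subr0.
have mtr n : measurable_fun setT (tr n).
  by apply: measurable_funB => //; apply: measurable_funM => //; exact: measurable_indic.
have tr2 n : L2 P (tr n).
  by apply/Lp2; apply: Lp_le (trle n) _ => //; exact/Lp2.
have ctr : (fun n => E (fun w => tr n w ^+ 2)) @ \oo --> 0.
  have [] := @Int_dominated _ _ _ P setT measurableT (fun n w => tr n w ^+ 2) (fun=> 0) (fun w => Zu w ^+ 2) _ _ _ _ _ => //.
  - by move=> n; exact: meas_sq.
  - apply: aeW => w _; apply: cvg_near_cst.
    have := nbhs_infty_ger `|Zu w|; apply: filterS => n /= h.
    by rewrite /tr An h mulr1 subrr expr0n.
  - move=> n; apply: aeW => w _; rewrite ger0_norm ?sqr_ge0//.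
    by rewrite -[leLHS]real_normK ?num_real// -[leRHS]real_normK ?num_real// ler_sqr ?nnegrE.
  by move=> _ _; rewrite E_cst.
(* The increment has second moment at most 4c, and k times 4c is at most (e/2)^2. *)
pose k := e ^+ 2 / (16 * (c + 1)).
have c1 : 0 < c + 1 by rewrite ltr_wpDl.
have k0 : 0 < k by rewrite divr_gt0 ?exprn_gt0 ?mulr_gt0.
have /cvgrPdist_lt/(_ _ k0)[M _ HM] := ctr.
have := HM M (leqnn M); rewrite /= sub0r normrN ger0_norm ?E_sq_ge0// => trM.
have eM : 0 < e / 2 / (M%:R + 1) by rewrite !divr_gt0// ltr_wpDl.
have [h h0 H] := condexp_L1_continuous P_complete BM Yi eM.
exists h => // s t Zs Zt s0 st tu ts Ys Yt.
have L1d := H s t Zs Zt s0 st (le_trans tu u1) ts Ys Yt.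
have [Zs2 Zt2 les let_ ->] := condexp_sq_diff s0 st tu u1 Yi Ys Yt Yu Zu2.
have D2 := L2B Zt2 Zs2.
have Zb2 : L2 P (fun w => Zu w * \1_(A M) w).
  apply: (@L2_bounded _ _ _ _ _ M%:R); first by apply: measurable_funM => //; exact: measurable_indic.
  move=> w; rewrite An; have [hh|hh] := leP `|Zu w| M%:R; rewrite /= ?mulr1n ?mulr0n.
    by rewrite mulr1.
  by rewrite mulr0 normr0.
have -> : E (fun w => Zu w * (Zt w - Zs w)) = E (fun w => (Zu w * \1_(A M) w) * (Zt w - Zs w)) + E (fun w => tr M w * (Zt w - Zs w)).
  rewrite -IntD//; [|exact: L2_mul..].
  by apply: eq_Rintegral => w _; rewrite -mulrDl /tr; congr (_ * _); rewrite addrC subrK.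
apply: le_trans (ler_normD _ _) _.
have p1 : `|E (fun w => Zu w * \1_(A M) w * (Zt w - Zs w))| <= e / 2.
  apply: le_trans (Int_norm measurableT (L2_mul Zb2 D2)) _.
  apply: (@le_trans _ _ (E (fun w => M%:R * `|Zt w - Zs w|))).
    apply: Int_le => //.
    - by apply: intg_abs => //; exact: L2_mul.
    - by apply: intgZ => //; apply: intg_abs => //; exact: L2_pint D2.
    - move=> w _; rewrite normrM ler_wpM2r// An.
      have [hh|hh] := leP `|Zu w| M%:R; rewrite /= ?mulr1n ?mulr0n ?mulr1//.
      by rewrite mulr0 normr0.
  rewrite IntZ//; last by apply: intg_abs => //; exact: L2_pint D2.
  move: L1d; rewrite ler_pdivlMr ?ltr_wpDl// => L1d.
  apply: le_trans L1d; rewrite mulrC ler_wpM2l ?lerDl//.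
  by apply: Rintegral_ge0 => w _.
have p2 : `|E (fun w => tr M w * (Zt w - Zs w))| <= e / 2.
  have d4 : E (fun w => (Zt w - Zs w) ^+ 2) <= 4 * c.
    apply: (@le_trans _ _ (E (fun w => 2 * Zt w ^+ 2 + 2 * Zs w ^+ 2))).
      apply: Int_le => //; first exact: D2.2.
        by apply: intgD => //; apply: intgZ => //; [exact: Zt2.2|exact: Zs2.2].
      by move=> w _; have := sqr_ge0 (Zt w + Zs w); rewrite sqrrD sqrrB; lra.
    rewrite IntD// ?IntZ//; [|exact: Zs2.2|exact: Zt2.2|by apply: intgZ => //; exact: Zt2.2|by apply: intgZ => //; exact: Zs2.2].
    by move: les let_; rewrite -/c; lra.
  have sq : (E (fun w => tr M w * (Zt w - Zs w))) ^+ 2 <= (e / 2) ^+ 2.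
    apply: le_trans (cauchy_schwarz_sq (tr2 M) D2) _.
    apply: (@le_trans _ _ (k * (4 * c))).
      apply: ler_pM => //; [exact: E_sq_ge0|exact: E_sq_ge0|exact: ltW].
    rewrite /k mulrAC ler_pdivrMr ?mulr_gt0//.
    have -> : (e / 2) ^+ 2 = e ^+ 2 / 4 by field.
    have := sqr_ge0 e; nra.
  by move: sq; rewrite -[leLHS]real_normK ?num_real// ler_sqr ?nnegrE ?normr_ge0 // divr_ge0 // ltW.
lra.
Qed.

End martingales.

(** * Fubini on [0, t] x T *)

Lemma ae_imply d (T : measurableType d) (R : realType) (m : {measure set T -> \bar R})
    (A C : T -> Prop) :
  (forall x, A x -> C x) -> {ae m, forall x, A x} -> {ae m, forall x, C x}.
Proof.
move=> AC [N [mN N0 AN]]; exists N; split => // x /= nC.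
by apply: AN => /= a; apply: nC; exact: AC.
Qed.

Lemma ae_and d (T : measurableType d) (R : realType) (m : {measure set T -> \bar R})
    (A C : T -> Prop) :
  {ae m, forall x, A x} -> {ae m, forall x, C x} -> {ae m, forall x, A x /\ C x}.
Proof.
move=> hA hC; have := negligibleU hA hC; apply: negligibleS => x /= nAC.
by have [a|a] := pselect (A x); [right => c; exact: nAC|left].
Qed.

Section fubini_interval.
Context d (T : measurableType d) (R : realType) (P : probability T R).
Local Notation mu := (@lebesgue_measure R).
Local Notation E f := (Rintegral P setT f).
Local Notation pint := (intg P setT).
Implicit Types (t : R) (f : R -> T -> R).

Definition strip t : set (R * T) := `[0, t] `*` setT.

Lemma measurable_strip t : measurable (strip t).
Proof. by apply: measurableX => //; exact: measurable_itv. Qed.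

Definition jmeas t f := measurable_fun (strip t) (fun z => f z.1 z.2).

Lemma intg_fine d' (T' : measurableType d') (m : {measure set T' -> \bar R}) (D : set T')
    (G : T' -> \bar R) : measurable D -> m.-integrable D G ->
  intg m D (fine \o G) /\ (\int[m]_(x in D) G x)%E = (Rintegral m D (fine \o G))%:E.
Proof.
move=> mD Gi; have fin := integrable_ae mD Gi.
have mG := measurable_int _ Gi.
have ae1 : {ae m, forall x, D x -> G x = (EFin \o (fine \o G)) x}.
  by apply: filterS fin => x /[apply] h; rewrite /= fineK.
have mg : measurable_fun D (EFin \o (fine \o G)).
  by apply/measurable_EFinP; exact: measurableT_comp.
have gi : intg m D (fine \o G).
  apply/integrableP; split => //.
  have /integrableP[_] := Gi; apply: le_lt_trans.
  rewrite le_eqVlt; apply/orP; left; apply/eqP; apply: ae_eq_integral => //.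
  - exact: measurableT_comp.
  - exact: measurableT_comp.
  - by apply: filterS ae1 => x h Tx; exact: (esym (congr1 abse (h Tx))).
split => //; rewrite -(intgE mD gi); apply: ae_eq_integral => //.
Qed.

Lemma jmeas_section t f s : jmeas t f -> 0 <= s -> s <= t -> measurable_fun setT (f s).
Proof.
move=> mf s0 st; have mp : measurable_fun setT (fun w : T => (s, w)) by exact: measurable_pair1.
apply: (measurable_comp (measurable_strip t) _ mf mp).
by move=> _ [w _ <-]; split => //=; rewrite in_itv/= s0 st.
Qed.

Lemma jmeas_section2 t f w : jmeas t f -> measurable_fun `[0, t] (fun s => f s w).
Proof.
move=> mf; have mp : measurable_fun `[0, t] (fun s : R => (s, w)) by apply: measurable_funTS; exact: measurable_pair2.
apply: (measurable_comp (measurable_strip t) _ mf mp).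
by move=> _ [s st <-]; split.
Qed.

(* Extension by zero outside of the strip, to use the theorems on the product space. *)
Let ext t f := fun z : R * T => \1_(`[0, t]%classic : set R) z.1 * f z.1 z.2.

Let ext_meas t f : jmeas t f -> measurable_fun setT (EFin \o ext t f).
Proof.
move=> mf; apply/measurable_EFinP.
have := (measurable_restrictT (fun z => f z.1 z.2) (measurable_strip t)).1 mf.
congr (measurable_fun _ _); apply/funext => -[s w].
rewrite /ext patchE indicE; case: ifPn => [|/negP h].
  by rewrite inE => -[h _]; rewrite mem_set ?mul1r.
by rewrite memNset ?mul0r// => h'; apply: h; rewrite inE; split.
Qed.

Lemma jmeas_integral_ge0 t f : jmeas t f ->
  measurable_fun `[0, t] (fun s => \int[P]_w (`|f s w|)%:E)%E.
Proof.
move=> mf.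
have me : measurable_fun setT (fun z => (`|ext t f z|)%:E).
  by apply/measurable_EFinP; apply: measurableT_comp => //; apply/measurable_EFinP; exact: ext_meas.
have e0 (z : R * T) : (0 <= (`|ext t f z|)%:E)%E by rewrite lee_fin.
have h := measurable_fun_fubini_tonelli_F (m2 := P) _ me e0.
apply: (eq_measurable_fun (fubini_F P (fun z => (`|ext t f z|)%:E))).
  move=> s; rewrite inE => st; rewrite /fubini_F; apply: eq_integral => w _.
  by rewrite /ext /= indicE mem_set// mul1r.
exact: measurable_funTS.
Qed.

(** The hypothesis has time outermost because controls are estimated in L^2 at a fixed time. The
    conclusions collect the integrability facts that accompany each exchange of integrals. *)
Lemma fubini_Rint t f : jmeas t f ->
  (\int[mu]_(s in `[0%R, t]) \int[P]_w (`|f s w|)%:E < +oo)%E ->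
  [/\ {ae P, forall w, intg mu `[0, t] (fun s => f s w)},
      {ae mu, forall s, 0 <= s <= t -> pint (f s)},
      pint (fun w => Rintegral mu `[0, t] (fun s => f s w)),
      intg mu `[0, t] (fun s => E (f s)) &
      E (fun w => Rintegral mu `[0, t] (fun s => f s w)) =
      Rintegral mu `[0, t] (fun s => E (f s))].
Proof.
move=> mf fin; have me := ext_meas mf.
have mI : @measurable _ (measurableTypeR R) `[0, t]%classic by exact: measurable_itv.
have restr w : (fun s => (ext t f (s, w))%:E) = (fun s => (f s w)%:E) \_ `[0, t].
  apply/funext => s; rewrite patchE /ext /= indicE; case: ifPn => h; first by rewrite mul1r.
  by rewrite mul0r.
have int : (mu \x P)%E.-integrable setT (EFin \o ext t f).
  apply/(integrable12ltyP mu P me); apply: le_lt_trans fin.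
  rewrite [leRHS]integral_mkcond le_eqVlt; apply/orP; left; apply/eqP.
  apply: eq_integral => s _; rewrite patchE; case: ifPn => h.
    by apply: eq_integral => w _; rewrite /ext /= indicE h mul1r.
  by apply: integral0_eq => w _; rewrite /ext /= indicE (negbTE h) mul0r normr0.
have a2 := ae_integrable2 int.
have a1 := ae_integrable1 int.
have secw w : mu.-integrable setT (fun s => (EFin \o ext t f) (s, w)) ->
    intg mu `[0, t] (fun s => f s w).
  move=> h; rewrite /intg; apply/(@integrable_mkcond _ (measurableTypeR R) R mu _ _ mI).
  by have := restr w => e; rewrite -e.
have GE w : fubini_G mu (EFin \o ext t f) w = (\int[mu]_(s in `[0%R, t]) (f s w)%:E)%E.
  by rewrite /fubini_G [RHS]integral_mkcond -restr.
have FE s : fubini_F P (EFin \o ext t f) s = ((fun s => \int[P]_w (f s w)%:E)%E \_ `[0, t]) s.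
  rewrite /fubini_F patchE; case: ifPn => h.
    by apply: eq_integral => w _; rewrite /ext /= indicE h mul1r.
  by apply: integral0_eq => w _; rewrite /ext /= indicE (negbTE h) mul0r.
have Gi : P.-integrable setT (fubini_G mu (EFin \o ext t f)).
  apply/integrableP; split; first exact: measurable_fubini_G int.
  apply: le_lt_trans ((integrable21ltyP mu P me).1 int).
  have mn : measurable_fun setT (abse \o (EFin \o ext t f)) by exact: measurableT_comp.
  apply: ge0_le_integral => //.
  - by apply: measurableT_comp => //; exact: measurable_fubini_G int.
  - exact: (measurable_fun_fubini_tonelli_G (m1 := mu) _ mn (fun=> abse_ge0 _)).
  - move=> w _; apply: le_abse_integral => //.
    by apply: (measurableT_comp me); exact: measurable_pair2.
have Fi := integrable_fubini_F int.
have [Gi' GI] := intg_fine measurableT Gi.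
have Fi2 : mu.-integrable `[0, t] (fun s => \int[P]_w (f s w)%:E)%E.
  apply/(integrable_mkcond _ mI); apply: eq_integrable Fi => // s _; exact: FE.
have [Fi' FI] := intg_fine mI Fi2.
split.
- by apply: filterS a2 => w; exact: secw.
- apply: filterS a1 => s h st; apply: eq_integrable h => // w _.
  by rewrite /ext /= indicE mem_set ?mul1r//= in_itv.
- apply: intg_eq Gi' => // w _; rewrite /= GE//.
- exact: Fi'.
- apply: EFin_inj.
  transitivity (\int[P]_w fubini_G mu (EFin \o ext t f) w)%E.
    by rewrite GI; congr EFin; apply: eq_Rintegral => w _; rewrite /= GE.
  rewrite integral21_prod_meas1// -integral12_prod_meas1//.
  rewrite -FI [RHS]integral_mkcond; apply: eq_integral => s _; exact: FE.
Qed.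

Lemma tonelli_strip t f : jmeas t f -> (forall s w, 0 <= f s w) ->
  (\int[P]_w \int[mu]_(s in `[0%R, t]) (f s w)%:E =
   \int[mu]_(s in `[0%R, t]) \int[P]_w (f s w)%:E)%E.
Proof.
move=> mf f0; have me := ext_meas mf.
have e0 z : (0 <= (EFin \o ext t f) z)%E.
  by rewrite /= lee_fin /ext mulr_ge0// indicE.
have h := fubini_tonelli (m1 := mu) (m2 := P) _ me e0.
rewrite [RHS]integral_mkcond; apply/esym.
transitivity (\int[mu]_x \int[P]_y (EFin \o ext t f) (x, y))%E.
  apply: eq_integral => s _; rewrite patchE; case: ifPn => st.
    by apply: eq_integral => w _; rewrite /ext /= indicE st mul1r.
  by apply/esym/integral0_eq => w _; rewrite /ext /= indicE (negbTE st) mul0r.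
rewrite h; apply: eq_integral => w _; rewrite [RHS]integral_mkcond.
apply: eq_integral => s _; rewrite patchE /ext /= indicE.
by case: ifPn => st; rewrite ?mul1r ?mul0r.
Qed.

Lemma jmeas_Rintegral t f : jmeas t f ->
  measurable_fun setT (fun w => Rintegral mu `[0, t] (fun s => f s w)).
Proof.
move=> mf; have me := ext_meas mf.
apply: measurableT_comp => //.
rewrite (_ : (fun w => _) = (fun w => \int[mu]_s (EFin \o ext t f)^\+ (s, w) -
    \int[mu]_s (EFin \o ext t f)^\- (s, w))%E).
  apply: emeasurable_funB.
  - exact: (measurable_fun_fubini_tonelli_G (m1 := mu) _ (measurable_funepos me) (funepos_ge0 _)).
  - exact: (measurable_fun_fubini_tonelli_G (m1 := mu) _ (measurable_funeneg me) (funeneg_ge0 _)).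
apply/funext => w; rewrite integral_mkcond.
transitivity (\int[mu]_s (EFin \o ext t f) (s, w))%E.
  apply: eq_integral => s _; rewrite patchE /ext /= indicE.
  by case: ifPn => st; rewrite ?mul1r ?mul0r.
rewrite [LHS]integralE; congr (_ - _)%E; apply: eq_integral => s _.
  by rewrite !funeposE.
by rewrite !funenegE.
Qed.

Lemma ae_prod_sections (D : set (R * T)) : (mu \x P)%E.-negligible D ->
  {ae mu, forall s, P.-negligible [set w | D (s, w)]} /\
  {ae P, forall w, mu.-negligible [set s | D (s, w)]}.
Proof.
move=> [N [mN N0 DN]].
have mx := measurable_fun_xsection P mN.
have my := measurable_fun_ysection mu mN.
have hx : (\int[mu]_s `|P (xsection N s)| = 0)%E.
  by under eq_integral do rewrite gee0_abs//; exact: N0.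
have hy : (\int[P]_w `|mu (ysection N w)| = 0)%E.
  under eq_integral do rewrite gee0_abs//.
  have := indic_fubini_tonelli mu P mN.
  by rewrite indic_fubini_tonelli_FE// indic_fubini_tonelli_GE// => <-.
split.
- have /(ae_eq_integral_abs mu measurableT mx) := hx.
  apply: filterS => s /(_ I) /= h; exists (xsection N s); split => //.
    exact: measurable_xsection.
  by move=> w /= /DN Nw; rewrite /xsection /= inE.
- have /(ae_eq_integral_abs P measurableT my) := hy.
  apply: filterS => w /(_ I) /= h; exists (ysection N w); split => //.
    exact: measurable_ysection.
  by move=> s /= /DN Nw; rewrite /ysection /= inE.
Qed.

(** Measurability of [D] is what allows its product measure to be computed by integrating the
    measures of its sections. *)
Lemma ae_prod_ae1 (D : set (R * T)) : measurable D ->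
  {ae mu, forall s, P.-negligible [set w | D (s, w)]} -> (mu \x P)%E.-negligible D.
Proof.
move=> mD h; exists D; split => //.
transitivity (\int[mu]_s (P \o xsection D) s)%E => //.
transitivity (\int[mu]_s (cst 0%E s))%E; last exact: integral0.
apply: ae_eq_integral => //; first exact: measurable_fun_xsection.
case: h => [M [mM M0 DM]]; exists M; split => // s /= nh; apply: DM => /= -[N [mN N0 DN]].
apply: nh => _ /=.
apply: (@subset_measure0 _ _ _ P _ N) => //; first exact: measurable_xsection.
by move=> w; rewrite /xsection /= inE => /DN.
Qed.

End fubini_interval.

(** * Controls *)

Section controls.
Context d (T : measurableType d) (R : realType) (P : probability T R).
Variables (B : R -> T -> R).
Hypotheses (P_complete : measure_is_complete P) (BM : standard_brownian_motion P B).
Local Notation mu := (@lebesgue_measure R).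
Local Notation E f := (Rintegral P setT f).
Local Notation pint := (intg P setT).
Local Notation F := (filtration P B).
Local Notation c0 := (@c0 R).
Implicit Types (s t u v : R) (alpha : R -> T -> R).

Lemma c0_gt0 : 0 < c0.
Proof. by rewrite sqrtr_gt0 divr_gt0// pi_gt0. Qed.

(** The claim is 2 < pi; equality would give cos 1 = cos(pi/2) = 0, whereas cos 1 > 0. *)
Lemma c0_lt1 : c0 < 1.
Proof.
rewrite -[ltRHS]sqrtr1 ltr_sqrt// ltr_pdivrMr ?pi_gt0// mul1r lt_neqAle pi_ge2 andbT.
apply/eqP => pi2; have := cos1_gt0 R.
have -> : 1 = pi / 2 :> R by rewrite -pi2 divff.
by rewrite cos_pihalf ltxx.
Qed.

Lemma jmeas_le t u alpha : t <= u -> jmeas u alpha -> jmeas t alpha.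
Proof.
move=> tu; apply: measurable_funS; first exact: measurable_strip.
by move=> [s w] [/=]; rewrite !in_itv/= => /andP[s0 st] _; split=> //=; rewrite in_itv/= s0 (le_trans st).
Qed.

Lemma jmeas_prog alpha : progressive P B alpha -> jmeas 1 alpha.
Proof.
move=> /(_ 1); rewrite ler01 lexx => /(_ isT) h.
have sF1 : sub_sigma (F 1) by apply: (sub_sigma_F P_complete BM); rewrite ler01 lexx.
pose j (z : R * T) : R * g_sigma_algebraType (F 1) := z.
have mj : measurable_fun setT j.
  apply/measurable_fun_pairP; split; first exact: measurable_fst.
  move=> _ U mU; rewrite setTI; have mU' : measurable (U : set T) by apply: sF1.2; rewrite -(gmeas_measE _ sF1).
  by have := @measurable_snd _ _ R T measurableT _ mU'; rewrite setTI.
have mD : measurable (`[0, 1]%classic `*` setT : set (R * g_sigma_algebraType (F 1))).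
  by apply: measurableX => //; exact: measurable_itv.
apply: (measurable_comp mD _ h (measurable_funTS mj)).
by move=> _ [z zs <-].
Qed.

Lemma gmeas_prog alpha t : progressive P B alpha -> 0 <= t <= 1 -> gmeas (F t) (alpha t).
Proof.
move=> pa t01; have /andP[t0 t1] := t01.
exact: (@jmeas_section _ (g_sigma_algebraType (F t)) R t alpha t (pa t t01)).
Qed.

Lemma gmeas_integral alpha t : progressive P B alpha -> 0 <= t <= 1 ->
  gmeas (F t) (fun w => Rintegral mu `[0, t] (fun s => alpha s w)).
Proof.
by move=> pa t01; exact: (@jmeas_Rintegral _ (g_sigma_algebraType (F t)) R t alpha (pa t t01)).
Qed.

Lemma control_L2 alpha : control P B alpha ->
  {ae mu, forall s, 0 <= s <= 1 -> L2 P (alpha s) /\ E (fun w => alpha s w ^+ 2) <= c0 ^+ 2}.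
Proof.
move=> [pa]; apply: ae_imply => s h s01; have hs := h s01.
have ma : measurable_fun setT (alpha s).
  by apply: gmeas_meas (gmeas_prog pa s01); exact: sub_sigma_F.
have a2 : L2 P (alpha s) by apply: norm2_lty => //; apply: le_lt_trans hs _; rewrite ltry.
split => //; move: hs; rewrite norm2E// lee_fin => hs.
rewrite -[leLHS]sqr_sqrtr ?E_sq_ge0//.
by rewrite ler_sqr ?nnegrE ?sqrtr_ge0 // ltW // c0_gt0.
Qed.

Lemma jmeasM t alpha beta : jmeas t alpha -> jmeas t beta ->
  jmeas t (fun s w => alpha s w * beta s w).
Proof. exact: measurable_funM. Qed.

Lemma jmeas_rv t (xi : T -> R) : measurable_fun setT xi -> jmeas t (fun _ w => xi w).
Proof.
by move=> mxi; apply: measurable_funTS; exact: (measurableT_comp mxi measurable_snd).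
Qed.

Lemma integral_itv_cst (t K : R) : 0 <= t ->
  (\int[mu]_(_ in `[0%R, t]) K%:E = (K * t)%:E)%E.
Proof.
move=> t0; have mI : @measurable _ (measurableTypeR R) `[0, t]%classic by exact: measurable_itv.
transitivity (K%:E * mu (`[0%R, t]%classic : set R))%E; first exact: (integral_cst mu mI).
rewrite lebesgue_measure_itv/= lte_fin.
move: t0; rewrite le_eqVlt => /predU1P[<-|->]; first by rewrite ltxx mulr0 mule0.
by rewrite oppr0 adde0.
Qed.

Lemma strip_bound t (f : R -> T -> R) (K : R) : 0 <= t -> jmeas t f ->
  {ae mu, forall s, 0 <= s <= t -> pint (f s) /\ E (fun w => `|f s w|) <= K} ->
  (\int[mu]_(s in `[0%R, t]) \int[P]_w (`|f s w|)%:E < +oo)%E.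
Proof.
move=> t0 mf h.
have mI : @measurable _ (measurableTypeR R) `[0, t]%classic by exact: measurable_itv.
apply: (@le_lt_trans _ _ (\int[mu]_(s in `[0%R, t]) (`|K|)%:E)%E).
  apply: ae_ge0_le_integral => //.
  - by move=> s _; apply: integral_ge0 => w _.
  - exact: jmeas_integral_ge0.
  apply: ae_imply h => s hs; rewrite /= in_itv/= => /hs[fi fK].
  rewrite (intgE measurableT (intg_abs measurableT fi)) lee_fin.
  exact: le_trans (ler_norm _).
by rewrite integral_itv_cst// ltry.
Qed.

Lemma E_abs_mul_le (X Y : T -> R) a b : L2 P X -> L2 P Y -> 0 <= a -> 0 <= b ->
  E (fun w => X w ^+ 2) <= a ^+ 2 -> E (fun w => Y w ^+ 2) <= b ^+ 2 ->
  E (fun w => `|X w * Y w|) <= a * b.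
Proof.
move=> X2 Y2 a0 b0 Xa Yb.
have abs2 Z : L2 P Z -> L2 P (fun w => `|Z w|).
  move=> [mZ Zi]; split; first exact: measurableT_comp.
  by under eq_fun do rewrite real_normK ?num_real//.
have e2 Z : E (fun w => `|Z w| ^+ 2) = E (fun w => Z w ^+ 2).
  by apply: eq_Rintegral => w _; rewrite real_normK ?num_real.
have := cauchy_schwarz_sq (abs2 _ X2) (abs2 _ Y2); rewrite !e2.
rewrite (_ : E _ = E (fun w => `|X w * Y w|)); last first.
  by apply: eq_Rintegral => w _; rewrite normrM.
move=> h; rewrite -ler_sqr ?nnegrE ?mulr_ge0//; last by apply: Rintegral_ge0 => w _.
apply: le_trans h _; rewrite exprMn; apply: ler_pM => //; exact: E_sq_ge0.
Qed.

Lemma intg_lebesgue_cst (t : R) (K : R) : 0 <= t -> intg mu `[0, t] (fun=> K).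
Proof.
move=> t0; apply/integrableP; split; first exact/measurable_EFinP.
by rewrite /= integral_itv_cst// ltry.
Qed.

Lemma Rintegral_lebesgue_cst (t : R) (K : R) : 0 <= t -> Rintegral mu `[0, t] (fun=> K) = K * t.
Proof. by move=> t0; rewrite /Rintegral integral_itv_cst. Qed.

Lemma control_fubini alpha t xi : control P B alpha -> 0 <= t <= 1 -> L2 P xi ->
  [/\ pint (fun w => Rintegral mu `[0, t] (fun s => alpha s w) * xi w),
      intg mu `[0, t] (fun s => E (fun w => alpha s w * xi w)) &
      E (fun w => Rintegral mu `[0, t] (fun s => alpha s w) * xi w) =
      Rintegral mu `[0, t] (fun s => E (fun w => alpha s w * xi w))].
Proof.
move=> ca t01 xi2; have /andP[t0 t1] := t01; have [pa _] := ca.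
have mI : @measurable _ (measurableTypeR R) `[0, t]%classic by exact: measurable_itv.
have ja : jmeas t alpha by apply: jmeas_le (jmeas_prog pa).
have ae_c := control_L2 ca.
have fin (eta : T -> R) : L2 P eta ->
    (\int[mu]_(s in `[0%R, t]) \int[P]_w (`|alpha s w * eta w|)%:E < +oo)%E.
  move=> eta2; apply: (@strip_bound t _ (c0 * Num.sqrt (E (fun w => eta w ^+ 2)))) => //.
    by apply: jmeasM => //; apply: jmeas_rv; exact: eta2.1.
  apply: ae_imply ae_c => s hs /andP[s0 st]; have [|a2 ac] := hs; first by rewrite s0 (le_trans st).
  split; first exact: L2_mul.
  apply: E_abs_mul_le => //; first by rewrite ltW// c0_gt0.
  by rewrite sqr_sqrtr// E_sq_ge0.
(* The case [xi = 1] shows that almost every path of the control is integrable, which is needed to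
   take [xi w] out of the time integral. *)
have one2 : L2 P (fun=> 1) by apply: (@L2_bounded _ _ _ _ _ 1) => // w; rewrite normr1.
have [a1 _ _ _ _] := fubini_Rint (jmeasM ja (@jmeas_rv t _ one2.1)) (fin _ one2).
have [a2 _ i1 i2 e] := fubini_Rint (jmeasM ja (@jmeas_rv t _ xi2.1)) (fin _ xi2).
have mA : measurable_fun setT (fun w => Rintegral mu `[0, t] (fun s => alpha s w)).
  exact: jmeas_Rintegral.
have ae1 : {ae P, forall w, setT w -> Rintegral mu `[0, t] (fun s => alpha s w * xi w) =
    Rintegral mu `[0, t] (fun s => alpha s w) * xi w}.
  apply: filterS a1 => w h _; rewrite RintegralZr//.
  by apply: intg_eq h => // s _; rewrite mulr1.
have mAx : measurable_fun setT (fun w => Rintegral mu `[0, t] (fun s => alpha s w) * xi w).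
  by apply: measurable_funM => //; exact: xi2.1.
split => //; first exact: intg_ae ae1 i1.
by rewrite -e; apply/esym; apply: Int_ae ae1 => //; exact: intg_meas i1.
Qed.

(** Minkowski's integral inequality in dual form: it says that the integral of a control up to t has
    L^2 norm at most c_0 t. *)
Lemma control_fubini_bound alpha t xi : control P B alpha -> 0 <= t <= 1 -> L2 P xi ->
  `|E (fun w => Rintegral mu `[0, t] (fun s => alpha s w) * xi w)| <=
  c0 * t * Num.sqrt (E (fun w => xi w ^+ 2)).
Proof.
move=> ca t01 xi2; have /andP[t0 t1] := t01.
have mI : @measurable _ (measurableTypeR R) `[0, t]%classic by exact: measurable_itv.
have [_ i2 ->] := control_fubini ca t01 xi2.
apply: le_trans (Int_norm mI i2) _.
rewrite mulrAC -(@Rintegral_lebesgue_cst t)//.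
apply: (Int_le_ae mI); [exact: intg_abs|exact: intg_lebesgue_cst|].
apply: ae_imply (control_L2 ca) => s hs; rewrite /= in_itv/= => /andP[s0 st].
have [|a2 ac] := hs; first by rewrite s0 (le_trans st).
apply: le_trans (Int_norm measurableT (L2_mul a2 xi2)) _.
apply: E_abs_mul_le => //; first by rewrite ltW// c0_gt0.
by rewrite sqr_sqrtr// E_sq_ge0.
Qed.

Definition energy alpha : R := Rintegral mu `[0, 1] (fun s => E (fun w => alpha s w ^+ 2)).

Lemma control_energy alpha : control P B alpha ->
  [/\ intg mu `[0, 1] (fun s => E (fun w => alpha s w ^+ 2)),
      (\int[P]_w \int[mu]_(s in `[0%R, 1%R]) (alpha s w ^+ 2)%:E = (energy alpha)%:E)%E,
      0 <= energy alpha & energy alpha <= c0 ^+ 2].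
Proof.
move=> ca; have [pa _] := ca; have ae_c := control_L2 ca.
have mI : @measurable _ (measurableTypeR R) `[0, 1]%classic by exact: measurable_itv.
have ja := jmeas_prog pa; have j2 : jmeas 1 (fun s w => alpha s w ^+ 2) by exact: measurable_funX.
have fin : (\int[mu]_(s in `[0%R, 1%R]) \int[P]_w (`|alpha s w ^+ 2|)%:E < +oo)%E.
  apply: (@strip_bound 1 _ (c0 ^+ 2)) => //.
  apply: ae_imply ae_c => s hs /hs[a2 ac]; split; first exact: a2.2.
  by under eq_Rintegral do rewrite ger0_norm ?sqr_ge0//.
have [_ _ _ i2 e] := fubini_Rint j2 fin.
split => //.
- rewrite tonelli_strip//; last by move=> s w; exact: sqr_ge0.
  rewrite -(intgE mI i2); apply: ae_eq_integral => //.
  + have := jmeas_integral_ge0 P j2; apply: eq_measurable_fun => s _.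
    by apply: eq_integral => w _; rewrite ger0_norm ?sqr_ge0.
  + exact: measurable_int i2.
  + apply: ae_imply ae_c => s hs; rewrite /= in_itv/= => /hs[a2 _].
    by rewrite (intgE measurableT a2.2).
- by apply: Rintegral_ge0 => s _; exact: E_sq_ge0.
- rewrite -[leRHS]mulr1 -(@Rintegral_lebesgue_cst 1)//.
  apply: (Int_le_ae mI) => //; first exact: intg_lebesgue_cst.
  by apply: ae_imply ae_c => s hs; rewrite /= in_itv/= => /hs[].
Qed.

End controls.

(** * Weak duality *)

Section phi_function.
Context (R : realType).
Implicit Types (delta y a : R).
Local Notation c0 := (@c0 R).

(** The maximizer of a y - (delta/2) a^2 over 0 <= a <= c_0; divided by [y] it is the multiplier
    lambda. For [delta = 0] it is c_0 even at y = 0, where every a is a maximizer. *)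
Definition best delta y := if delta == 0 then c0 else Num.min c0 (y / delta).
Definition phir delta y := best delta y * y - delta / 2 * best delta y ^+ 2.

Lemma best_ge0 delta y : 0 <= delta -> 0 <= y -> 0 <= best delta y.
Proof.
move=> d0 y0; rewrite /best; have c0p := c0_gt0 R; case: ifP => _; first exact: ltW.
by rewrite le_min ltW//= divr_ge0.
Qed.

Lemma best_gt0 delta y : 0 <= delta -> 0 < y -> 0 < best delta y.
Proof.
move=> d0 y0; rewrite /best; have c0p := c0_gt0 R; case: eqP => [//|/eqP dn0].
by rewrite lt_min c0p divr_gt0// lt_neqAle eq_sym dn0.
Qed.

Lemma best_le delta y : best delta y <= c0.
Proof. by rewrite /best; case: ifP => // _; rewrite ge_min lexx. Qed.

Lemma phir_max delta y a : 0 <= delta -> 0 <= y -> `|a| <= c0 ->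
  a * y - delta / 2 * a ^+ 2 <= phir delta y.
Proof.
move=> d0 y0; rewrite ler_norml => /andP[_ ac]; rewrite /phir /best.
case: eqP => [->|/eqP dn0].
  by rewrite !mul0r !subr0 ler_wpM2r.
have {dn0}dp : 0 < delta by rewrite lt_neqAle eq_sym dn0.
set z := y / delta; have -> : y = z * delta by rewrite divfK// gt_eqF.
have [h|h] := leP c0 z; rewrite -subr_ge0.
  rewrite (_ : _ - _ = delta / 2 * ((c0 - a) * ((z - c0) + (z - a)))); last by lra.
  apply: mulr_ge0; first by lra.
  by apply: mulr_ge0; lra.
rewrite (_ : _ - _ = delta / 2 * (z - a) ^+ 2); last by lra.
by apply: mulr_ge0; [lra|exact: sqr_ge0].
Qed.

Lemma phiE delta y : 0 <= delta -> 0 <= y -> phi delta y%:E = (phir delta y)%:E.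
Proof.
move=> d0 y0; apply/eqP; rewrite eq_le; apply/andP; split.
  apply: ge_ereal_sup => _ [a /= ac <-].
  by rewrite -EFinM -EFinB lee_fin; exact: phir_max.
apply: ereal_sup_ubound; exists (best delta y) => /=.
  by rewrite ger0_norm ?best_ge0// best_le.
by rewrite -EFinM -EFinB.
Qed.

Lemma phir_ge0 delta y : 0 <= delta -> 0 <= y -> 0 <= phir delta y.
Proof.
move=> d0 y0; have := @phir_max delta y 0 d0 y0; rewrite normr0 => /(_ (ltW (c0_gt0 R))).
by rewrite mul0r expr0n/= mulr0 subr0.
Qed.

Lemma phir_le delta y : 0 <= delta -> 0 <= y -> phir delta y <= c0 * y.
Proof.
move=> d0 y0; rewrite /phir lerBlDr; apply: (@le_trans _ _ (c0 * y)).
  by rewrite ler_wpM2r// best_le.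
by rewrite lerDl mulr_ge0 ?sqr_ge0// divr_ge0.
Qed.

(** Linear growth from below: it turns finiteness of the integral of [phi] along the martingale into
    integrability of t |-> |Y(t)|_2. *)
Lemma phir_ge delta y : 0 <= delta -> 0 <= y -> c0 * y - delta / 2 * c0 ^+ 2 <= phir delta y.
Proof. by move=> d0 y0; apply: phir_max => //; rewrite gtr0_norm// c0_gt0. Qed.

Lemma measurable_best delta : measurable_fun setT (best delta).
Proof.
have [->|dn0] := eqVneq delta 0.
  by rewrite (_ : best 0 = fun=> c0); [exact: measurable_cst|apply/funext => y; rewrite /best eqxx].
rewrite (_ : best delta = fun y => Num.min c0 (y / delta)).
  by apply: measurable_minr => //; exact: measurable_funM.
by apply/funext => y; rewrite /best (negbTE dn0).
Qed.

Lemma measurable_phir delta : measurable_fun setT (phir delta).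
Proof.
apply: measurable_funB; first by apply: measurable_funM => //; exact: measurable_best.
by apply: measurable_funM => //; apply: measurable_funX; exact: measurable_best.
Qed.

(* The squared distance between a nearly optimal control and its candidate. *)
Lemma best_gap delta y a : 0 <= delta -> 0 < y -> 0 <= a -> a <= c0 ->
  (1 - best delta y / y * delta) * (a ^+ 2 - best delta y ^+ 2) <= 0.
Proof.
move=> d0 y0 a0 ac; rewrite /best; case: eqP => [->|/eqP dn0].
  by rewrite mulr0 subr0 mul1r subr_le0 ler_sqr ?nnegrE// (le_trans a0).
have dp : 0 < delta by rewrite lt_neqAle eq_sym dn0.
have [h|h] := leP c0 (y / delta); last first.
  rewrite (_ : 1 - _ = 0) ?mul0r//.
  by field; rewrite dn0 gt_eqF.
rewrite mulr_ge0_le0//.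
  by rewrite subr_ge0 mulrAC ler_pdivrMr// mul1r -ler_pdivlMr.
by rewrite subr_le0 ler_sqr ?nnegrE// (le_trans a0).
Qed.

End phi_function.

Section expectations.
Context d (T : measurableType d) (R : realType) (P : probability T R).
Local Notation E f := (Rintegral P setT f).
Local Notation pint := (intg P setT).
Local Notation mu := (@lebesgue_measure R).

Lemma norm_ae p (f g : T -> R) : measurable_fun setT f -> measurable_fun setT g ->
  {ae P, forall w, f w = g w} -> norm P p f = norm P p g.
Proof.
move=> mf mg fg; rewrite /norm unlock; congr poweR.
have m (h : T -> R) : measurable_fun setT h -> measurable_fun setT (fun w => (`|(EFin \o h) w| `^ p)%E).
  move=> mh; apply: (measurableT_comp (measurable_poweR p)).
  by apply: measurableT_comp => //; exact/measurable_EFinP.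
apply: ae_eq_integral; [exact: measurableT|exact: m|exact: m|].
by apply: ae_imply fg => w /= ->.
Qed.

(** At t = 1 the martingale need not be in L^2, so statements about its norm are made for t < 1 and
    this single time is discarded. *)
Lemma ae_lt1 : {ae mu, forall t : R, 0 <= t <= 1 -> t < 1}.
Proof.
exists [set 1]; split => //; first exact: lebesgue_measure_set1.
move=> t /= h; apply: contrapT => /eqP t1; apply: h => /andP[_ ].
by rewrite le_eqVlt (negbTE t1).
Qed.

Lemma jmeas_expectation t (f : R -> T -> R) : jmeas t f ->
  measurable_fun `[0, t] (fun s => E (f s)).
Proof.
move=> mf.
have mp : jmeas t (fun s w => Num.max (f s w) 0) by apply: measurable_maxr => //; exact: measurable_cst.
have mn : jmeas t (fun s w => Num.max (- f s w) 0).
  by apply: measurable_maxr; [exact: measurableT_comp|exact: measurable_cst].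
have := emeasurable_funB (jmeas_integral_ge0 P mp) (jmeas_integral_ge0 P mn).
move=> /(measurableT_comp (@fine_measurable R setT measurableT)).
apply: eq_measurable_fun => s _; rewrite /= /Rintegral [in RHS]integralE; congr (fine (_ - _)%E).
  by apply: eq_integral => w _; rewrite ger0_norm ?le_max ?lexx ?orbT// funeposE EFin_max.
by apply: eq_integral => w _; rewrite ger0_norm ?le_max ?lexx ?orbT// funenegE EFin_max EFinN.
Qed.

End expectations.

Section martingale_norm.
Context d (T : measurableType d) (R : realType) (P : probability T R).
Variables (B : R -> T -> R).
Hypotheses (P_complete : measure_is_complete P) (BM : standard_brownian_motion P B).
Local Notation mu := (@lebesgue_measure R).
Local Notation E f := (Rintegral P setT f).
Local Notation pint := (intg P setT).
Local Notation F := (filtration P B).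
Variables (Y : T -> R) (Yt : R -> T -> R).
Hypotheses (Yi : pint Y) (YtY : martingale_version P B Y Yt).

Lemma mart_meas t : 0 <= t <= 1 -> measurable_fun setT (Yt t).
Proof.
move=> t01; have [/gmeas_prog/(_ t01) h _] := YtY.
by apply: gmeas_meas h; exact: sub_sigma_F.
Qed.

Lemma mart_norm_measurable : measurable_fun `[0, 1 : R] (fun t => norm P 2 (Yt t)).
Proof.
have [pY _] := YtY; have j2 : jmeas 1 (fun s w => Yt s w ^+ 2) by apply: measurable_funX; exact: (jmeas_prog P_complete BM).
have := measurableT_comp (measurable_poweR 2^-1) (jmeas_integral_ge0 P j2).
apply: eq_measurable_fun => t _; rewrite /norm unlock /=; congr poweR.
by apply: eq_integral => w _; rewrite powR2 ger0_norm// sqr_ge0.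
Qed.

Lemma mart_norm_le s t : 0 <= s -> s <= t -> t <= 1 -> (norm P 2 (Yt s) <= norm P 2 (Yt t))%E.
Proof.
move=> s0 st t1; have t01 : 0 <= t <= 1 by rewrite (le_trans s0).
have s01 : 0 <= s <= 1 by rewrite s0 (le_trans st).
have [_ Ye] := YtY.
have [h|] := ltP (norm P 2 (Yt t)) +oo%E; last by rewrite leye_eq => /eqP ->; exact: leey.
have t2 := norm2_lty (mart_meas t01) h.
have [s2 _ le _ _] := condexp_sq_diff P_complete BM s0 (lexx s) st t1 Yi (Ye _ s01) (Ye _ s01) (Ye _ t01) t2.
by rewrite !norm2E// lee_fin ler_wsqrtr.
Qed.

Lemma mart_norm_condexp t : 0 <= t <= 1 -> norm P 2 (condexp P (F t) Y) = norm P 2 (Yt t).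
Proof.
move=> t01; have sF := sub_sigma_F P_complete BM t01.
have h := condexpP P_complete BM t01 Yi.
apply: norm_ae; [by apply: gmeas_meas sF _; case: h|exact: mart_meas|].
exact: condexp_unique sF Yi h (YtY.2 _ t01).
Qed.

Hypothesis fin : (\int[mu]_(t in `[0%R, 1%R]) norm P 2 (Yt t) < +oo)%E.

(** The norm is nondecreasing in time, so an infinite value at some t < 1 would make the integral
    over [t, 1] infinite. *)
Lemma mart_L2 t : 0 <= t -> t < 1 -> L2 P (Yt t).
Proof.
move=> t0 t1; have t01 : 0 <= t <= 1 by rewrite t0 ltW.
apply: norm2_lty; first exact: mart_meas.
rewrite ltNge leye_eq; apply/negP => /eqP h; move: fin; apply/negP; rewrite -leNgt.
have mI : @measurable _ (measurableTypeR R) `[t, 1]%classic by exact: measurable_itv.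
apply: (@le_trans _ _ (\int[mu]_(t in `[t, 1%R]) norm P 2 (Yt t))%E); last first.
  apply: ge0_subset_integral => //; first exact: mart_norm_measurable.
    by move=> s _; exact: Lnorm_ge0.
  by move=> s /=; rewrite !in_itv/= => /andP[ts s1]; rewrite (le_trans t0 ts) s1.
rewrite (eq_integral (fun=> +oo%E)); last first.
  move=> s; rewrite inE/= in_itv/= => /andP[ts s1].
  by apply/eqP; rewrite -leye_eq -h; exact: mart_norm_le.
have -> : (\int[mu]_(x in `[t, 1%R]) +oo = +oo * mu (`[t, 1%R]%classic : set R))%E by exact: (integral_cst mu mI).
by rewrite lebesgue_measure_itv/= lte_fin t1 -EFinB gt0_mulye// lte_fin subr_gt0.
Qed.

(** With an integrable norm, [fine] can lose information only at t = 1, where an infinite norm is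
    read as 0. *)
Definition mnorm t : R := fine (norm P 2 (Yt t)).

Lemma mnormE t : 0 <= t -> t < 1 -> norm P 2 (Yt t) = (mnorm t)%:E.
Proof. by move=> t0 t1; rewrite /mnorm norm2E//; exact: mart_L2. Qed.

Lemma mnorm_sq t : 0 <= t -> t < 1 -> mnorm t ^+ 2 = E (fun w => Yt t w ^+ 2).
Proof. by move=> t0 t1; rewrite /mnorm norm2E; [rewrite /= sqr_sqrtr// E_sq_ge0|exact: mart_L2]. Qed.

Lemma mnorm_ge0 t : 0 <= mnorm t.
Proof. by rewrite fine_ge0// Lnorm_ge0. Qed.

Lemma mnorm_measurable : measurable_fun `[0, 1 : R] mnorm.
Proof. exact: (measurableT_comp (@fine_measurable R setT measurableT) mart_norm_measurable). Qed.

Lemma mnorm_le s t : 0 <= s -> s <= t -> t < 1 -> mnorm s <= mnorm t.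
Proof.
move=> s0 st t1; have t0 := le_trans s0 st; have s1 := le_lt_trans st t1.
by rewrite -lee_fin -!mnormE//; exact/mart_norm_le/ltW.
Qed.

Lemma mnorm_intg : intg mu `[0, 1] mnorm.
Proof.
have mI : @measurable _ (measurableTypeR R) `[0, 1 : R]%classic by exact: measurable_itv.
apply: intg_ge0; [exact: mnorm_measurable|by move=> *; exact: mnorm_ge0|].
apply: (le_lt_trans _ fin); apply: ge0_le_integral => //.
- by move=> t _; rewrite lee_fin mnorm_ge0.
- by apply/measurable_EFinP; exact: mnorm_measurable.
- exact: mart_norm_measurable.
- move=> t _; rewrite /mnorm; have : (0 <= norm P 2 (Yt t))%E by exact: Lnorm_ge0.
  by case: (norm _ _ _) => //= _; exact: leey.
Qed.

End martingale_norm.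

Section truncation.
Context d (T : measurableType d) (R : realType) (P : probability T R).
Local Notation E f := (Rintegral P setT f).
Local Notation pint := (intg P setT).
Implicit Types (X Y : T -> R) (k : R).

(** Large values are replaced by 0 and not clipped, so that the product of [X] and its truncation is
    the square of the truncation. *)
Definition trunc k X : T -> R := fun w => if `|X w| <= k then X w else 0.

Lemma trunc_le k X w : 0 <= k -> `|trunc k X w| <= k.
Proof. by rewrite /trunc; case: ifP => // _; rewrite normr0. Qed.

Lemma trunc_le_norm k X w : `|trunc k X w| <= `|X w|.
Proof. by rewrite /trunc; case: ifP => // _; rewrite normr0. Qed.

Lemma trunc_sub_le k X w : `|X w - trunc k X w| <= `|X w|.
Proof. by rewrite /trunc; case: ifP => _; rewrite ?subrr ?subr0 ?normr0. Qed.

Lemma measurable_trunc d' (T' : measurableType d') (D : set T') (f : T' -> R) k :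
  measurable D -> measurable_fun D f ->
  measurable_fun D (fun z => if `|f z| <= k then f z else 0).
Proof.
move=> mD mf; have mb : measurable_fun D (fun z => `|f z| <= k).
  by apply: measurable_fun_ler => //; exact: measurableT_comp.
apply: measurable_fun_if => //; apply: measurable_funS mf => // x [] //.
Qed.

Lemma trunc_cvg (x : R) : (fun n => if `|x| <= n%:R then x else 0) @ \oo --> x.
Proof.
apply: cvg_near_cst; near=> n; rewrite ifT//.
near: n; exact: nbhs_infty_ger.
Unshelve. all: by end_near. Qed.

Lemma hoelder_abs p q X Y : 1 < p -> 0 < q -> p^-1 + q^-1 = 1 -> Lp P p X -> Lp P q Y ->
  E (fun w => `|Y w| `^ q) <= 1 ->
  `|E (fun w => X w * Y w)| <= (E (fun w => `|X w| `^ p)) `^ p^-1.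
Proof.
move=> p1 q0 pq Xp Yq Y1; rewrite ler_norml (hoelder_unit p1 q0 pq)// andbT lerNl.
have p0 : 0 < p by exact: lt_trans p1.
have XY := Lp_mul p0 q0 pq Xp Yq; rewrite -(IntN measurableT XY).
under eq_Rintegral do rewrite -mulrN.
apply: (hoelder_unit p1 q0 pq Xp (LpN (ltW q0) Yq)).
by under eq_Rintegral do rewrite normrN.
Qed.

Lemma powR_cvg_zero r (u : nat -> R) : 0 < r -> (forall n, 0 <= u n) ->
  u @ \oo --> 0 -> (fun n => u n `^ r) @ \oo --> 0.
Proof.
move=> r0 u0 /cvgrPdist_lt u_cvg; apply/cvgrPdist_lt => e e0.
have e0' : 0 < e `^ r^-1 by exact: powR_gt0.
near=> n; rewrite sub0r normrN ger0_norm ?powR_ge0//.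
have un : u n < e `^ r^-1.
  by rewrite -[ltLHS]ger0_norm// -normrN -sub0r; near: n; exact: u_cvg.
rewrite -[ltRHS]powRr1 ?(ltW e0)// -(mulVf (lt0r_neq0 r0)) powRrM.
by apply: gt0_ltr_powR; rewrite ?nnegrE ?powR_ge0.
Unshelve. all: by end_near. Qed.

Lemma trunc_Lp_cvg p X : 0 < p -> Lp P p X ->
  (fun n => (E (fun w => `|X w - trunc n%:R X w| `^ p)) `^ p^-1) @ \oo --> 0.
Proof.
move=> p0 [mX Xp].
have mt n : measurable_fun setT (trunc n%:R X) by exact: measurable_trunc.
have := @Int_dominated _ _ _ P setT measurableT (fun n w => `|X w - trunc n%:R X w| `^ p) (fun=> 0) _ _ _ _ Xp _.
case.
- by move=> n; apply: meas_absp; exact: measurable_funB.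
- exact: measurable_cst.
- apply/aeW => w _; apply: cvg_near_cst; near=> n.
  rewrite /trunc ifT ?subrr ?normr0 ?powR0 ?gt_eqF//.
  near: n; exact: nbhs_infty_ger.
- move=> n; apply/aeW => w _; rewrite ger0_norm ?powR_ge0//.
  by apply: ge0_ler_powR; rewrite ?nnegrE ?(ltW p0)//; exact: trunc_sub_le.
move=> _ _; rewrite (E_cst P 0) => h.
apply: powR_cvg_zero => //; first by rewrite invr_gt0.
by move=> n; apply: Rintegral_ge0 => w _; exact: powR_ge0.
Unshelve. all: by end_near. Qed.

End truncation.

(** * Pairing the integral of a control with the dual variable *)

Section pairing.
Context d (T : measurableType d) (R : realType) (P : probability T R).
Variables (B : R -> T -> R).
Hypotheses (P_complete : measure_is_complete P) (BM : standard_brownian_motion P B).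
Local Notation mu := (@lebesgue_measure R).
Local Notation E f := (Rintegral P setT f).
Local Notation pint := (intg P setT).
Local Notation F := (filtration P B).
Local Notation c0 := (@c0 R).
Variables (p q : R) (Y : T -> R) (Yt : R -> T -> R).
Hypotheses (p1 : 1 < p) (q1 : 1 < q) (pq : p^-1 + q^-1 = 1).
Hypotheses (Yq : Lp P q Y) (YtY : martingale_version P B Y Yt).
Hypothesis (Y1 : E (fun w => `|Y w| `^ q) <= 1).

Let q0 : 0 < q. Proof. exact: lt_trans q1. Qed.
Let p0 : 0 < p. Proof. exact: lt_trans p1. Qed.

Let Yi : pint Y. Proof. exact: Lp_pint (ltW q1) Yq. Qed.

Lemma mart_Lp t : 0 <= t <= 1 -> Lp P q (Yt t) /\ E (fun w => `|Yt t w| `^ q) <= 1.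
Proof.
move=> t01; have [Yp h] := condexp_Lp (sub_sigma_F P_complete BM t01) q1 Yq (YtY.2 _ t01).
by split => //; exact: le_trans Y1.
Qed.

Let s_ n : R := 1 - n.+1%:R^-1.
Let s01 n : 0 <= s_ n <= 1.
Proof.
rewrite /s_ subr_ge0 lerBlDr lerDl invr_ge0 ler0n andbT.
by rewrite invf_le1// ler1n.
Qed.
Let s_lt1 n : s_ n < 1. Proof. by rewrite ltrBlDr ltrDl invr_gt0. Qed.

(** Y(s_n) tends to Y(1) in L^1, which handles a truncation of [A]; the remainder is small in L^p
    and is controlled by Hölder, because all the Y(t) have L^q norm at most 1. *)
Lemma pairing_left_limit (A : T -> R) : gmeas (F 1) A -> Lp P p A ->
  (fun n => E (fun w => A w * Yt (s_ n) w)) @ \oo --> E (fun w => A w * Y w).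
Proof.
move=> A1 Ap; have t11 : 0 <= (1:R) <= (1:R) by rewrite ler01 lexx.
have sF1 := sub_sigma_F P_complete BM t11.
have [Y1q Y11] := mart_Lp t11; have Y1e := YtY.2 _ t11.
have int t : 0 <= t <= 1 -> pint (fun w => A w * Yt t w).
  by move=> t01; apply: Lp_mul pq Ap _ => //; exact: (mart_Lp t01).1.
(* [A] is F(1)-measurable, so [Y] may be replaced by Y(1). *)
have <- : E (fun w => A w * Yt 1 w) = E (fun w => A w * Y w).
  under eq_Rintegral do rewrite mulrC; under [RHS]eq_Rintegral do rewrite mulrC.
  apply: condexp_pull_out sF1 Yi Y1e A1 _ _.
    by under eq_fun do rewrite mulrC; exact: Lp_mul pq Ap Yq.
  by under eq_fun do rewrite mulrC; exact: int.
apply/cvgrPdist_le => e e0; have e4 : 0 < e / 4 by lra.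
have /cvgrPdist_lt/(_ _ e4)[k _ /(_ k (leqnn k))] := trunc_Lp_cvg p0 Ap.
rewrite /= sub0r normrN; set D := fun w => A w - trunc k%:R A w => De.
have mA := Ap.1; have mtA : measurable_fun setT (trunc k%:R A) by exact: measurable_trunc.
have Dp : Lp P p D.
  apply: LpB => //; first exact: ltW.
  apply: (@Lp_bounded _ _ _ _ _ _ k%:R) => //; first exact: ltW.
  by move=> w; exact: trunc_le.
have De' : `|E (fun w => `|D w| `^ p)| `^ p^-1 < e / 4.
  rewrite ger0_norm; last by apply: Rintegral_ge0 => w _; exact: powR_ge0.
  by apply: le_lt_trans De; exact: ler_norm.
have Dt t : 0 <= t <= 1 -> pint (fun w => D w * Yt t w) /\ `|E (fun w => D w * Yt t w)| <= e / 4.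
  move=> t01; have [tp t1] := mart_Lp t01; split; first exact: Lp_mul pq Dp tp.
  apply: le_trans (hoelder_abs p1 q0 pq Dp tp t1) _; rewrite ltW//.
  by move: De'; rewrite ger0_norm//; apply: Rintegral_ge0 => w _; exact: powR_ge0.
have e2 : 0 < e / 2 / (k%:R + 1) by apply: divr_gt0; [lra|rewrite ltr_wpDl].
have [h h0 hc] := condexp_L1_continuous P_complete BM Yi e2.
near=> n.
have nh : 1 - s_ n < h.
  rewrite /s_ opprB addrC subrK.
  by near: n; exact: near_infty_natSinv_lt (PosNum h0).
have hn := hc _ _ _ _ (andP (s01 n)).1 (andP (s01 n)).2 (lexx 1) nh (YtY.2 _ (s01 n)) Y1e.
rewrite -IntB//; [|exact: int|exact: int].
have i1 := Lp_pint (ltW q1) Y1q; have is_ := Lp_pint (ltW q1) (mart_Lp (s01 n)).1.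
have idif := intgB measurableT i1 is_.
have it : pint (fun w => trunc k%:R A w * (Yt 1 w - Yt (s_ n) w)).
  under eq_fun do rewrite mulrC.
  by apply: (intg_bounded measurableT idif mtA) => w _; exact: trunc_le.
have [iD1 D1] := Dt _ t11; have [iDs Ds] := Dt _ (s01 n).
rewrite (_ : E _ = (E (fun w => D w * Yt 1 w) - E (fun w => D w * Yt (s_ n) w)) +
    E (fun w => trunc k%:R A w * (Yt 1 w - Yt (s_ n) w))); last first.
  rewrite -IntB// -IntD//; last exact: intgB.
  by apply: eq_Rintegral => w _; rewrite /D; ring.
have tb : `|E (fun w => trunc k%:R A w * (Yt 1 w - Yt (s_ n) w))| <= e / 2.
  apply: le_trans (Int_norm measurableT it) _.
  apply: (@le_trans _ _ (k%:R * E (fun w => `|Yt 1 w - Yt (s_ n) w|))).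
    rewrite -IntZ//; last exact: intg_abs.
    apply: Int_le => //; [exact: intg_abs|by apply: intgZ => //; exact: intg_abs|].
    by move=> w _; rewrite normrM ler_wpM2r// trunc_le.
  apply: (@le_trans _ _ (k%:R * (e / 2 / (k%:R + 1)))); first by rewrite ler_wpM2l.
  have k0 : (0 : R) <= k%:R by [].
  by rewrite mulrA ler_pdivrMr; nra.
apply: le_trans (ler_normD _ _) _.
have := ler_normB (E (fun w => D w * Yt 1 w)) (E (fun w => D w * Yt (s_ n) w)).
lra.
Unshelve. all: by end_near. Qed.

Hypothesis fin : (\int[mu]_(t in `[0%R, 1%R]) norm P 2 (Yt t) < +oo)%E.
Local Notation y := (mnorm P Yt).

Lemma mart_pair_le t (xi : T -> R) : 0 <= t -> t < 1 -> L2 P xi ->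
  E (fun w => xi w ^+ 2) <= c0 ^+ 2 -> `|E (fun w => xi w * Yt t w)| <= c0 * y t.
Proof.
move=> t0 t1 xi2 xic; have Y2 := mart_L2 P_complete BM Yi YtY fin t0 t1.
apply: le_trans (cauchy_schwarz xi2 Y2) _.
have -> : y t = Num.sqrt (E (fun w => Yt t w ^+ 2)) by rewrite /mnorm norm2E.
apply: ler_wpM2r; first exact: sqrtr_ge0.
by have := ler_wsqrtr xic; rewrite sqrtr_sqr gtr0_norm// c0_gt0.
Qed.

(** Fubini is applied to Y(s_n), which is in L^2. At times t <= s_n the pairing with Y(s_n) is the
    pairing with Y(t); at later times it is at most c_0 |Y(s_n)|_2 <= c_0 |Y(t)|_2. Thus c_0
    |Y(t)|_2 dominates throughout, and n can tend to infinity. *)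
Lemma pairing_integral alpha : control P B alpha ->
  Lp P p (fun w => Rintegral mu `[0, 1] (fun s => alpha s w)) ->
  intg mu `[0, 1] (fun t => E (fun w => alpha t w * Yt t w)) /\
  E (fun w => Rintegral mu `[0, 1] (fun s => alpha s w) * Y w) =
  Rintegral mu `[0, 1] (fun t => E (fun w => alpha t w * Yt t w)).
Proof.
move=> ca Ap; have [pa _] := ca; have t11 : 0 <= (1:R) <= (1:R) by rewrite ler01 lexx.
have mI : @measurable _ (measurableTypeR R) `[0, 1 : R]%classic by exact: measurable_itv.
have L2t := mart_L2 P_complete BM Yi YtY fin.
pose h n t := E (fun w => alpha t w * Yt (s_ n) w).
have fub n := control_fubini P_complete BM ca t11 (L2t _ (andP (s01 n)).1 (s_lt1 n)).
have ae_c : {ae mu, forall t, 0 <= t <= 1 ->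
    [/\ t < 1, L2 P (alpha t) & E (fun w => alpha t w ^+ 2) <= c0 ^+ 2]}.
  apply: ae_imply (ae_and (ae_lt1 R) (control_L2 P_complete BM ca)) => t [h1 h2] t01.
  by have [a2 ac] := h2 t01; split => //; exact: h1.
have hE n t : 0 <= t -> t <= s_ n -> L2 P (alpha t) ->
    h n t = E (fun w => alpha t w * Yt t w).
  move=> t0 tn a2; have t1 := le_lt_trans tn (s_lt1 n).
  have t01 : 0 <= t <= 1 by rewrite t0 ltW.
  have sF := sub_sigma_F P_complete BM.
  have Yn2 := L2t _ (andP (s01 n)).1 (s_lt1 n).
  rewrite /h; under eq_Rintegral do rewrite mulrC; under [RHS]eq_Rintegral do rewrite mulrC.
  apply/esym; apply: (condexp_pull_out (sF _ t01) (L2_pint Yn2)).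
  - apply: (condexp_tower _ (sF _ (s01 n)) (sF _ t01) _ (YtY.2 _ (s01 n))).1; first exact: F_le.
    exact: YtY.2.
  - exact: gmeas_prog.
  - exact: L2_mul.
  - by apply: L2_mul => //; exact: L2t.
have := @Int_dominated _ _ _ mu _ mI h (fun t => E (fun w => alpha t w * Yt t w))
  (fun t => c0 * y t) _ _ _ _ _; case.
- by move=> n; have [_ /intg_meas] := fub n.
- apply: jmeas_expectation; apply: jmeasM; apply: (jmeas_prog P_complete BM) => //.
  exact: YtY.1.
- apply: ae_imply ae_c => t ht; rewrite /= in_itv/= => t01.
  have [t1 a2 _] := ht t01; have /andP[t0 _] := t01.
  have t10 : 0 < 1 - t by rewrite subr_gt0.
  apply: cvg_near_cst; near=> n; apply: hE => //.
  have nt : n.+1%:R^-1 < 1 - t by near: n; exact: (near_infty_natSinv_lt (PosNum t10)).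
  rewrite /s_ lerBrDl -lerBrDr. exact: (ltW nt).
- by apply: (intgZ mI); exact: (mnorm_intg P_complete BM YtY fin).
- move=> n; apply: ae_imply ae_c => t ht; rewrite /= in_itv/= => t01.
  have [t1 a2 ac] := ht t01; have /andP[t0 _] := t01.
  have [tn|nt] := leP t (s_ n); first by rewrite hE//; exact: mart_pair_le.
  have sn0 := (andP (s01 n)).1.
  apply: le_trans (mart_pair_le sn0 (s_lt1 n) a2 ac) _.
  rewrite ler_pM2l ?c0_gt0//.
  exact: (mnorm_le P_complete BM Yi YtY fin sn0 (ltW nt) t1).
move=> ih _ cv; split => //.
have A1 : gmeas (F 1) (fun w => Rintegral mu `[0, 1] (fun s => alpha s w)) by exact: gmeas_integral.
have := pairing_left_limit A1 Ap.
rewrite (_ : (fun n => _) = (fun n => Rintegral mu `[0, 1] (h n))); last first.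
  by apply/funext => n; have [_ _] := fub n.
by move=> cv'; exact: (cvg_unique _ cv' cv).
Unshelve. all: by end_near. Qed.

End pairing.

(** * The duality gap and its equality cases *)

Section weak_duality.
Context d (T : measurableType d) (R : realType) (P : probability T R).
Variables (B : R -> T -> R).
Hypotheses (P_complete : measure_is_complete P) (BM : standard_brownian_motion P B).
Local Notation mu := (@lebesgue_measure R).
Local Notation E f := (Rintegral P setT f).
Local Notation pint := (intg P setT).
Local Notation F := (filtration P B).
Local Notation c0 := (@c0 R).
Implicit Types (alpha : R -> T -> R) (Y : T -> R).

(** If the state at t were a constant, testing the integral of the control against B(t) would give b
    = E[B(t)^2] <= c_0 t sqrt(b), hence t <= b <= (c_0 t)^2 < t. *)
Lemma control_state_nondegenerate alpha t c : control P B alpha -> 0 < t -> t <= 1 ->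
  {ae P, forall w, state B alpha t w = c} -> False.
Proof.
move=> ca t0 t1 h; have t01 : 0 <= t <= 1 by rewrite ltW.
have b2 := bm_L2 BM (ltW t0) t1; have tb := bm_sq_ge BM (ltW t0) t1.
have [i1 _ _] := control_fubini P_complete BM ca t01 b2.
have := control_fubini_bound P_complete BM ca t01 b2.
have ib := L2_pint b2.
rewrite (@Int_ae _ _ _ P setT measurableT _ (fun w => c * B t w - B t w ^+ 2)); last first.
- by apply: ae_imply h => w /= e _; rewrite -e /state; ring.
- by apply: intg_meas (intgB measurableT (intgZ measurableT c ib) b2.2).
- exact: intg_meas i1.
rewrite IntB//; [|by apply: intgZ|exact: b2.2].
rewrite IntZ// (bm_mean BM (ltW t0) t1) mulr0 sub0r normrN.
set b := E _ in tb *; rewrite ger0_norm; last by apply: le_trans tb; exact: ltW.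
have b0 : 0 < b by exact: lt_le_trans tb.
have s0 : 0 < Num.sqrt b by rewrite sqrtr_gt0.
rewrite -[X in X <= _](sqr_sqrtr (ltW b0)) expr2 ler_pM2r// => sb.
have c1 := c0_lt1 R; have cp := c0_gt0 R.
have : b <= (c0 * t) ^+ 2.
  rewrite -(sqr_sqrtr (ltW b0)) ler_sqr ?nnegrE ?sqrtr_ge0 ?mulr_ge0//; exact: ltW.
have ct : c0 * t < 1 by nra.
have ct0 : 0 < c0 * t by exact: mulr_gt0.
nra.
Qed.

Variables (p q delta : R).
Hypotheses (p2 : 2 <= p) (q1 : 1 < q) (pq : p^-1 + q^-1 = 1) (delta0 : 0 <= delta).

Let p1 : 1 < p. Proof. by apply: lt_le_trans p2; rewrite ltr1n. Qed.
Let p0 : 0 < p. Proof. exact: lt_trans p1. Qed.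
Let q0 : 0 < q. Proof. exact: lt_trans q1. Qed.
Let t11 : 0 <= (1:R) <= (1:R). Proof. by rewrite ler01 lexx. Qed.
Let mI : @measurable _ (measurableTypeR R) `[0, 1 : R]%classic.
Proof. exact: measurable_itv. Qed.

Definition pnorm (X : T -> R) : R := (E (fun w => `|X w| `^ p)) `^ p^-1.

Lemma state_meas alpha : control P B alpha -> measurable_fun setT (state B alpha 1).
Proof.
move=> [pa _]; apply: measurable_funD; last exact: (bm_measurable BM).
exact: jmeas_Rintegral (jmeas_prog P_complete BM pa).
Qed.

Lemma cost_lty alpha : control P B alpha -> (primal_cost P B delta p alpha < +oo)%E ->
  Lp P p (state B alpha 1).
Proof.
move=> ca h; apply: norm_lty; [by rewrite gt_eqF|exact: state_meas|].
move: h; rewrite /primal_cost; have [_ -> _ _] := control_energy P_complete BM ca.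
have : (0 <= norm P p (state B alpha 1))%E by exact: Lnorm_ge0.
by case: (norm _ _ _) => [r _ _|_ //|//]; exact: ltry.
Qed.

Lemma costE alpha : control P B alpha -> Lp P p (state B alpha 1) ->
  primal_cost P B delta p alpha =
  (pnorm (state B alpha 1) + delta / 2 * energy P alpha)%:E.
Proof.
move=> ca Xp; rewrite /primal_cost; have [_ -> _ _] := control_energy P_complete BM ca.
by rewrite normE// gt_eqF.
Qed.

Lemma terminal_Lp alpha : Lp P p (state B alpha 1) ->
  Lp P p (fun w => Rintegral mu `[0, 1] (fun s => alpha s w)).
Proof.
move=> Xp; rewrite (_ : (fun w => _) = (fun w => state B alpha 1 w - B 1 w)); last first.
  by apply/funext => w; rewrite /state addrK.
by apply: LpB => //; [exact: ltW|apply: bm_Lp => //; exact: ltW].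
Qed.

Lemma pnorm_gt0 alpha : control P B alpha -> Lp P p (state B alpha 1) ->
  0 < pnorm (state B alpha 1).
Proof.
move=> ca [mX Xi]; apply: powR_gt0.
rewrite lt_neqAle; apply/andP; split; last by apply: Rintegral_ge0 => w _; exact: powR_ge0.
apply/negP => /eqP e0; apply: (control_state_nondegenerate (c := 0) ca ltr01 (lexx 1)).
have := Int_eq0_ae measurableT Xi; rewrite -e0 lexx.
have ge : {ae P, forall x, [set: T] x -> 0 <= `|state B alpha 1 x| `^ p}.
  by apply/aeW => w _; exact: powR_ge0.
move=> /(_ ge isT); apply: ae_imply => w /(_ I) /eqP.
by rewrite powR_eq0 normr_eq0 => /andP[/eqP].
Qed.

(** One formula for finite and infinite arguments: the last summand is 0 or +oo. It exhibits t |->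
    phi(|Y(t)|_2) as a sum of measurable functions. *)
Lemma phi_ext (y : \bar R) : (0 <= y)%E ->
  phi delta y = ((phir delta (fine y))%:E + (y - (fine y)%:E))%E.
Proof.
case: y => [y| |] //.
  by rewrite lee_fin => y0; rewrite phiE//= -EFinB subrr adde0.
by move=> _; rewrite phi_pinfty /= oppr0 adde0.
Qed.

Section dual_variable.
Variables (Y : T -> R) (Yt : R -> T -> R).
Hypotheses (Yq : Lp P q Y) (YtY : martingale_version P B Y Yt).
Hypothesis (Y1 : E (fun w => `|Y w| `^ q) <= 1).
Local Notation y := (mnorm P Yt).

Let Yi : pint Y. Proof. exact: Lp_pint (ltW q1) Yq. Qed.
Let b1p : Lp P p (B 1). Proof. exact: (bm_Lp BM (ltW p0) ler01 (lexx 1)). Qed.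
Let Yb : pint (fun w => Y w * B 1 w).
Proof. by under eq_fun do rewrite mulrC; exact: Lp_mul pq b1p Yq. Qed.

Lemma dual_gainE : dual_gain P B delta Y =
  ((E (fun w => Y w * B 1 w))%:E -
   \int[mu]_(t in `[0%R, 1%R]) phi delta (norm P 2 (Yt t)))%E.
Proof.
rewrite /dual_gain unlock; congr (_ - _)%E.
  exact: (intgE measurableT Yb).
apply: eq_integral => t; rewrite inE/= in_itv/= => t01.
by rewrite (mart_norm_condexp P_complete BM Yi YtY).
Qed.

Lemma phir_mnorm_measurable : measurable_fun `[0, 1 : R] (fun t => phir delta (y t)).
Proof.
by apply: (measurableT_comp (measurable_phir delta)); exact: (mnorm_measurable P_complete BM YtY).
Qed.

Lemma gain_fin : dual_gain P B delta Y != -oo%E ->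
  (\int[mu]_(t in `[0%R, 1%R]) norm P 2 (Yt t) < +oo)%E.
Proof.
rewrite dual_gainE => h; have n0 t : (0 <= norm P 2 (Yt t))%E by exact: Lnorm_ge0.
have mn := mart_norm_measurable P_complete BM YtY.
have phi0 t : (0 <= phi delta (norm P 2 (Yt t)))%E.
  rewrite phi_ext// adde_ge0 ?lee_fin ?phir_ge0 ?fine_ge0//.
  by case: (norm _ _ _) (n0 t) => [r| |] //= _; rewrite ?subee// oppr0 adde0.
have mphi : measurable_fun `[0, 1 : R] (fun t => phi delta (norm P 2 (Yt t))).
  rewrite (_ : (fun t => _) = (fun t => (phir delta (y t))%:E +
      (norm P 2 (Yt t) - (y t)%:E))%E); last by apply/funext => t; rewrite phi_ext.
  apply: emeasurable_funD; first by apply/measurable_EFinP; exact: phir_mnorm_measurable.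
  apply: emeasurable_funB => //; apply/measurable_EFinP.
  exact: (mnorm_measurable P_complete BM YtY).
have cp := c0_gt0 R.
have : (c0%:E * \int[mu]_(t in `[0%R, 1%R]) norm P 2 (Yt t) <=
   \int[mu]_(t in `[0%R, 1%R]) phi delta (norm P 2 (Yt t)) + (delta / 2 * c0 ^+ 2)%:E)%E.
  have -> : ((delta / 2 * c0 ^+ 2)%:E = \int[mu]_(t in `[0%R, 1%R]) (delta / 2 * c0 ^+ 2)%:E)%E.
    by rewrite integral_itv_cst// mulr1.
  have k0 : 0 <= delta / 2 * c0 ^+ 2 by rewrite mulr_ge0 ?sqr_ge0// divr_ge0.
  rewrite -ge0_integralD//.
  rewrite -ge0_integralZl//; last by rewrite lee_fin ltW.
  apply: ge0_le_integral => //.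
  - by move=> t _; rewrite mule_ge0// lee_fin ltW.
  - exact: measurable_funeM.
  - exact: emeasurable_funD.
  move=> t _; rewrite phi_ext//; case: (norm _ _ _) (n0 t) => [r| |] //=.
    rewrite lee_fin => r0; rewrite -EFinB subrr adde0 -EFinM -EFinD lee_fin.
    by have := phir_ge delta0 r0; lra.
  by move=> _; rewrite oppr0 adde0 leey.
move=> le; have phi_lty : (\int[mu]_(t in `[0%R, 1%R]) phi delta (norm P 2 (Yt t)) < +oo)%E.
  by rewrite ltey; apply: contra h => /eqP ->.
rewrite ltey; apply/negP => /eqP e; move: le; rewrite e gt0_muley ?lte_fin// leye_eq => /eqP e'.
by have := lte_add_pinfty phi_lty (ltry (delta / 2 * c0 ^+ 2)); rewrite e' ltxx.
Qed.

Hypothesis fin : (\int[mu]_(t in `[0%R, 1%R]) norm P 2 (Yt t) < +oo)%E.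

Lemma phir_intg : intg mu `[0, 1] (fun t => phir delta (y t)).
Proof.
apply: (@intg_le _ _ _ mu _ mI (fun t => c0 * y t)); first exact: phir_mnorm_measurable.
  move=> t _; have y0 := mnorm_ge0 P Yt t.
  by rewrite ger0_norm ?phir_ge0// phir_le.
by apply: (intgZ mI); exact: (mnorm_intg P_complete BM YtY fin).
Qed.

Lemma gainE : dual_gain P B delta Y =
  (E (fun w => Y w * B 1 w) - Rintegral mu `[0, 1] (fun t => phir delta (y t)))%:E.
Proof.
rewrite dual_gainE EFinB; congr (_ - _)%E; rewrite -(intgE mI phir_intg).
have mn := phir_mnorm_measurable.
apply: ae_eq_integral => //; last first.
- apply: ae_imply (ae_lt1 R) => t h; rewrite /= in_itv/= => t01.
  rewrite (mnormE P_complete BM Yi YtY fin (andP t01).1 (h t01)) phiE//.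
  exact: mnorm_ge0.
- exact/measurable_EFinP.
rewrite (_ : (fun t => _) = (fun t => (phir delta (y t))%:E +
    (norm P 2 (Yt t) - (y t)%:E))%E); last first.
  by apply/funext => t; rewrite phi_ext//; exact: Lnorm_ge0.
apply: emeasurable_funD; first exact/measurable_EFinP.
apply: emeasurable_funB; first exact: (mart_norm_measurable P_complete BM YtY).
by apply/measurable_EFinP; exact: (mnorm_measurable P_complete BM YtY).
Qed.

Variable alpha : R -> T -> R.
Hypotheses (ca : control P B alpha) (Xp : Lp P p (state B alpha 1)).
Local Notation X := (state B alpha 1).

Let g t := E (fun w => alpha t w * Yt t w) + delta / 2 * E (fun w => alpha t w ^+ 2) +
  phir delta (y t).

Let g_intg : intg mu `[0, 1] g.
Proof.
have [i1 _] := pairing_integral P_complete BM p1 q1 pq Yq YtY Y1 fin ca (terminal_Lp Xp).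
have [i2 _ _ _] := control_energy P_complete BM ca.
apply: (intgD mI _ phir_intg); apply: (intgD mI i1); exact: (intgZ mI).
Qed.

Let g_ge0 : {ae mu, forall t, `[0, 1 : R]%classic t -> 0 <= g t}.
Proof.
apply: ae_imply (ae_and (ae_lt1 R) (control_L2 P_complete BM ca)) => t [h1 h2].
rewrite /= in_itv/= => t01; have /andP[t0 _] := t01; have [a2 ac] := h2 t01.
have t1 := h1 t01; have Y2 := mart_L2 P_complete BM Yi YtY fin t0 t1.
have := cauchy_schwarz a2 Y2.
have -> : Num.sqrt (E (fun w => Yt t w ^+ 2)) = y t by rewrite /mnorm norm2E.
have aE := sqr_sqrtr (E_sq_ge0 P (alpha t)).
set a := Num.sqrt _ in aE *.
have a0 : 0 <= a by exact: sqrtr_ge0.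
have ac' : `|a| <= c0.
  by rewrite ger0_norm// -ler_sqr ?nnegrE// ?aE// ltW// c0_gt0.
have := phir_max delta0 (mnorm_ge0 P Yt t) ac'.
by rewrite /g -aE ler_norml => h /andP[h' _]; lra.
Qed.

Lemma duality_gap : pnorm X + delta / 2 * energy P alpha -
  (E (fun w => Y w * B 1 w) - Rintegral mu `[0, 1] (fun t => phir delta (y t))) =
  (pnorm X - E (fun w => X w * Y w)) + Rintegral mu `[0, 1] g.
Proof.
have [i1 e1] := pairing_integral P_complete BM p1 q1 pq Yq YtY Y1 fin ca (terminal_Lp Xp).
have [i2 _ _ _] := control_energy P_complete BM ca.
have i3 := intgZ mI (delta / 2) i2.
have -> : E (fun w => X w * Y w) = E (fun w => Y w * B 1 w) +
    E (fun w => Rintegral mu `[0, 1] (fun s => alpha s w) * Y w).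
  rewrite -IntD//; last exact: Lp_mul pq (terminal_Lp Xp) Yq.
  by apply: eq_Rintegral => w _; rewrite /state; ring.
rewrite /g (IntD mI _ phir_intg); last exact: (intgD mI i1 i3).
by rewrite (IntD mI i1 i3) (IntZ mI _ i2) e1 /energy; ring.
Qed.

Lemma weak_duality : (dual_gain P B delta Y <= primal_cost P B delta p alpha)%E.
Proof.
rewrite gainE costE// lee_fin -subr_ge0 duality_gap addr_ge0//.
  by rewrite subr_ge0; exact: hoelder_unit p1 q0 pq Xp Yq Y1.
have i0 : intg mu `[0, 1] (fun=> 0) by exact: intg_lebesgue_cst.
rewrite -[leLHS](@mul0r R 1) -(@Rintegral_lebesgue_cst R 1 0)//.
exact: (Int_le_ae mI i0 g_intg g_ge0).
Qed.

Hypothesis opt : (primal_cost P B delta p alpha <= dual_gain P B delta Y)%E.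

Let gap0 : pnorm X - E (fun w => X w * Y w) = 0 /\ Rintegral mu `[0, 1] g = 0.
Proof.
move: opt; rewrite gainE costE// lee_fin -subr_le0 duality_gap => h.
have h1 : E (fun w => X w * Y w) <= pnorm X by exact: hoelder_unit p1 q0 pq Xp Yq Y1.
have i0 : intg mu `[0, 1] (fun=> 0) by exact: intg_lebesgue_cst.
have := Int_le_ae mI i0 g_intg g_ge0; rewrite (@Rintegral_lebesgue_cst R 1 0)// mul0r.
by split; lra.
Qed.

Lemma optimal_dual : {ae P, forall w, Y w = dualf p (X w) / pnorm X `^ (p - 1)}.
Proof.
apply: (hoelder_unit_eq p1 q0 pq Xp Yq Y1); first exact: pnorm_gt0.
by have [/eqP] := gap0; rewrite subr_eq0 => /eqP <-.
Qed.

(** The relation is asserted only at times where |Y(t)|_2 > 0. The proof of positivity itself relies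
    on it, at times after the supposed last zero. *)
Lemma optimal_control : {ae mu, forall t, 0 <= t <= 1 -> 0 < y t ->
  {ae P, forall w, alpha t w = - (best delta (y t) / y t) * Yt t w}}.
Proof.
have := Int_eq0_ae mI g_intg g_ge0; rewrite (gap0.2) lexx => /(_ isT) gz.
apply: ae_imply (ae_and gz (ae_and (ae_lt1 R) (control_L2 P_complete BM ca))) => t [h0 [h1 h2]] t01 y0.
have /andP[t0 _] := t01; have [a2 ac] := h2 t01; have t1 := h1 t01.
have Y2 := mart_L2 P_complete BM Yi YtY fin t0 t1.
have {h0} : g t = 0 by apply: h0; rewrite /= in_itv.
have yE := mnorm_sq P_complete BM Yi YtY fin t0 t1.
rewrite /g /phir; set b := best delta (y t); set l := b / y t => gt0.
have bl : b = l * y t by rewrite /l divfK// gt_eqF.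
have L2l : L2 P (fun w => alpha t w + l * Yt t w) by apply: L2D => //; exact: L2Z.
have le0 : E (fun w => (alpha t w + l * Yt t w) ^+ 2) <= 0.
  rewrite E_sqD// -yE.
  have aE := sqr_sqrtr (E_sq_ge0 P (alpha t)); set a := Num.sqrt _ in aE.
  have a0 : 0 <= a by exact: sqrtr_ge0.
  have ac' : a <= c0 by rewrite -ler_sqr ?nnegrE// ?aE// ltW// c0_gt0.
  (* With a = |alpha(t)|_2, inserting g(t) = 0 into the expanded square gives exactly
     E[(alpha + l Y)^2] = (1 - l delta)(a^2 - b^2), which [best_gap] shows to be at most 0. *)
  have := best_gap delta0 y0 a0 ac'; rewrite -/b -/l.
  move: gt0; rewrite -aE => gt0 h.
  have eY : E (fun w => alpha t w * Yt t w) = - (delta / 2 * a ^+ 2) - (b * y t - delta / 2 * b ^+ 2) by lra.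
  apply: le_trans h; rewrite eY bl le_eqVlt; apply/orP; left; by apply/eqP; field.
have sq0 : {ae P, forall w, [set: T] w -> 0 <= (alpha t w + l * Yt t w) ^+ 2}.
  by apply/aeW => w _; exact: sqr_ge0.
have := Int_eq0_ae measurableT L2l.2 sq0 le0; apply: ae_imply => w /(_ I) /eqP; rewrite sqrf_eq0 addr_eq0 => /eqP ->.
by rewrite mulNr.
Qed.

End dual_variable.
End weak_duality.

(** * Existence of a primal optimizer *)

Section norming_functional.
Context d (T : measurableType d) (R : realType) (P : probability T R).
Local Notation E f := (Rintegral P setT f).
Local Notation pint := (intg P setT).
Variables (p q : R).
Hypotheses (p1 : 1 < p) (q1 : 1 < q) (pq : p^-1 + q^-1 = 1).
Local Notation Nrm := (pnorm P p).
Let p0 : 0 < p. Proof. exact: lt_trans p1. Qed.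
Let q0 : 0 < q. Proof. exact: lt_trans q1. Qed.

Lemma conjugate_exponent : (p - 1) * q = p.
Proof.
have : q + p = p * q by rewrite -[RHS]mulr1 -pq; field; rewrite !gt_eqF.
by move=> e; rewrite mulrBl -e mul1r addrAC subrr add0r.
Qed.

Lemma conjugate_powRV (a : R) : ((a `^ (p - 1))^-1) `^ q = (a `^ p)^-1.
Proof. by rewrite -powRN -powRrM mulNr conjugate_exponent powRN. Qed.

Lemma pnorm_ge0 X : 0 <= Nrm X. Proof. exact: powR_ge0. Qed.

Lemma pnorm_powR X : Nrm X `^ p = E (fun w => `|X w| `^ p).
Proof.
rewrite /pnorm -powRrM mulVf ?gt_eqF// powRr1//.
by apply: Rintegral_ge0 => w _; exact: powR_ge0.
Qed.

Definition dualn (X : T -> R) : T -> R := fun w => dualf p (X w) / Nrm X `^ (p - 1).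

Lemma dualn_spec X : Lp P p X -> 0 < Nrm X ->
  [/\ Lp P q (dualn X), E (fun w => `|dualn X w| `^ q) = 1 &
      E (fun w => X w * dualn X w) = Nrm X].
Proof.
move=> [mX Xi] N0; have Np := powR_gt0 (p - 1) N0.
have mD : measurable_fun setT (dualn X).
  by apply: measurable_funM => //; apply: measurable_funM => //; exact: meas_absp.
have NE := pnorm_powR X; have Npp := powR_gt0 p N0.
have eq w : `|dualn X w| `^ q = (Nrm X `^ p)^-1 * `|X w| `^ p.
  rewrite /dualn normrM norm_dualf// normfV (ger0_norm (ltW Np)) powRM ?invr_ge0 ?(ltW Np) ?powR_ge0//.
  rewrite -[in LHS]powRrM conjugate_exponent mulrC; congr (_ * _).
  by rewrite conjugate_powRV.
split.
- by split => //; apply: (intg_eq measurableT _ (intgZ measurableT (Nrm X `^ p)^-1 Xi)) => // w _; rewrite eq.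
- under eq_Rintegral do rewrite eq.
  by rewrite IntZ// -NE mulVf// gt_eqF.
- rewrite (_ : (fun w => _) = fun w => (Nrm X `^ (p - 1))^-1 * `|X w| `^ p); last first.
    by apply/funext => w; rewrite /dualn mulrA mulr_dualf// mulrC.
  have NM : Nrm X `^ p = Nrm X `^ (p - 1) * Nrm X.
    have h := @powRD R (Nrm X) (p - 1) 1; rewrite subrK powRr1 in h; last exact: ltW.
    by apply: h; rewrite (gt_eqF N0) implybT.
  by rewrite IntZ// -NE NM mulrA mulVf ?mul1r// gt_eqF.
Qed.

Lemma pnorm_ae X Z : measurable_fun setT X -> measurable_fun setT Z ->
  {ae P, forall w, X w = Z w} -> Nrm X = Nrm Z.
Proof.
move=> mX mZ XZ; rewrite /pnorm (Int_ae measurableT (meas_absp p mX) (meas_absp p mZ))//.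
by apply: ae_imply XZ => w ->.
Qed.

Lemma Lp_ae X Z : measurable_fun setT X ->
  {ae P, forall w, Z w = X w} -> Lp P p Z -> Lp P p X.
Proof.
move=> mX XZ [mZ Zp]; split => //; apply: (intg_ae measurableT (meas_absp p mX) _ Zp).
by apply: ae_imply XZ => w ->.
Qed.

Lemma Lp_mix X Z c : Lp P p X -> Lp P p Z -> Lp P p (fun w => X w + c * (Z w - X w)).
Proof.
move=> Xp Zp; have p0' := ltW p0; apply: (LpD p0' Xp).
by apply: LpZ => //; exact: LpB.
Qed.

(** Convexity of the norm by duality: the norming functional of the mixture is tested on the two
    endpoints. *)
Lemma pnorm_mix X Z c : Lp P p X -> Lp P p Z -> 0 <= c <= 1 ->
  Nrm (fun w => X w + c * (Z w - X w)) <= (1 - c) * Nrm X + c * Nrm Z.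
Proof.
move=> Xp Zp /andP[c0 c1]; have Wp := Lp_mix c Xp Zp.
have N0 := pnorm_ge0 X; have N0' := pnorm_ge0 Z; have c1' : 0 <= 1 - c by rewrite subr_ge0.
set W := fun w => _; have [W0|] := ltP 0 (Nrm W); last first.
  by move=> h; exact: le_trans h (addr_ge0 (mulr_ge0 c1' N0) (mulr_ge0 c0 N0')).
have [Dq D1 <-] := dualn_spec Wp W0.
have D1' : E (fun w => `|dualn W w| `^ q) <= 1 by rewrite D1.
have hX := hoelder_unit p1 q0 pq Xp Dq D1'; have hZ := hoelder_unit p1 q0 pq Zp Dq D1'.
have iX := Lp_mul p0 q0 pq Xp Dq; have iZ := Lp_mul p0 q0 pq Zp Dq.
rewrite (_ : E _ = E (fun w => (1 - c) * (X w * dualn W w) + c * (Z w * dualn W w))); last first.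
  by apply: eq_Rintegral => w _; rewrite /W; ring.
rewrite IntD ?IntZ//; try exact: intgZ.
exact: lerD (ler_wpM2l c1' hX) (ler_wpM2l c0 hZ).
Qed.

End norming_functional.

Section control_mix.
Context d (T : measurableType d) (R : realType) (P : probability T R).
Variables (B : R -> T -> R).
Hypotheses (P_complete : measure_is_complete P) (BM : standard_brownian_motion P B).
Local Notation mu := (@lebesgue_measure R).
Local Notation E f := (Rintegral P setT f).
Local Notation pint := (intg P setT).
Local Notation c0 := (@c0 R).
Implicit Types (alpha beta : R -> T -> R).
Let t11 : 0 <= (1:R) <= (1:R). Proof. by rewrite ler01 lexx. Qed.
Let mI : @measurable _ (measurableTypeR R) `[0, 1 : R]%classic.
Proof. exact: measurable_itv. Qed.

Lemma control_intro alpha : progressive P B alpha ->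
  {ae mu, forall s : R, 0 <= s <= 1 -> L2 P (alpha s) /\ E (fun w => alpha s w ^+ 2) <= c0 ^+ 2} ->
  control P B alpha.
Proof.
move=> pa h; split => //; apply: ae_imply h => s hs /hs[a2 ac].
by rewrite norm2E// lee_fin; have := ler_wsqrtr ac; rewrite sqrtr_sqr gtr0_norm// c0_gt0.
Qed.

Definition mix c alpha beta : R -> T -> R := fun s w => alpha s w + c * (beta s w - alpha s w).

Lemma prog_mix c alpha beta : progressive P B alpha -> progressive P B beta ->
  progressive P B (mix c alpha beta).
Proof.
move=> pa pb t t01; apply: measurable_funD; first exact: pa.
by apply: measurable_funM => //; apply: measurable_funB; [exact: pb|exact: pa].
Qed.

Lemma E_sq_mix (X Z : T -> R) c : L2 P X -> L2 P Z ->
  E (fun w => (X w + c * (Z w - X w)) ^+ 2) =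
  (1 - c) * E (fun w => X w ^+ 2) + c * E (fun w => Z w ^+ 2) -
  c * (1 - c) * E (fun w => (Z w - X w) ^+ 2).
Proof.
move=> X2 Z2; have D2 := L2B Z2 X2; rewrite (E_sqD c X2 D2).
have := E_sqD 1 X2 D2; rewrite (_ : E _ = E (fun w => Z w ^+ 2)); last first.
  by apply: eq_Rintegral => w _; rewrite mul1r addrC subrK.
by move=> ->; ring.
Qed.

Lemma control_mix c alpha beta : 0 <= c <= 1 -> control P B alpha -> control P B beta ->
  control P B (mix c alpha beta).
Proof.
move=> /andP[c0' c1] ca cb; apply: control_intro; first exact: prog_mix ca.1 cb.1.
apply: ae_imply (ae_and (control_L2 P_complete BM ca) (control_L2 P_complete BM cb)) => s [h1 h2] s01.
have [a2 ac] := h1 s01; have [b2 bc] := h2 s01; split.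
  by apply: L2D => //; apply: L2Z; exact: L2B.
rewrite (E_sq_mix c a2 b2); have := E_sq_ge0 P (fun w => beta s w - alpha s w).
set D := E _ => D0; set a := E _ in ac *; set b := E _ in bc *.
have : 0 <= c * (1 - c) * D by apply: mulr_ge0 => //; apply: mulr_ge0 => //; lra.
have : (1 - c) * a <= (1 - c) * c0 ^+ 2 by apply: ler_wpM2l => //; lra.
have : c * b <= c * c0 ^+ 2 by exact: ler_wpM2l.
lra.
Qed.

(** Half the difference of two controls is again a control, so that all facts about controls apply
    to it. This is the origin of the factor 4 in the energy identity for mixtures. *)
Definition hdiff alpha beta : R -> T -> R := fun s w => (beta s w - alpha s w) / 2.

Lemma control_hdiff alpha beta : control P B alpha -> control P B beta ->
  control P B (hdiff alpha beta).
Proof.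
move=> ca cb; apply: control_intro.
  move=> t t01; apply: measurable_funM => //.
  by apply: measurable_funB; [exact: cb.1|exact: ca.1].
apply: ae_imply (ae_and (control_L2 P_complete BM ca) (control_L2 P_complete BM cb)) => s [h1 h2] s01.
have [a2 ac] := h1 s01; have [b2 bc] := h2 s01; have D2 := L2B b2 a2.
rewrite (_ : hdiff alpha beta s = fun w => 2^-1 * (beta s w - alpha s w)); last first.
  by apply/funext => w; rewrite /hdiff mulrC.
split; first exact: L2Z.
under eq_Rintegral do rewrite exprMn.
rewrite (IntZ measurableT _ D2.2).
have := E_sq_ge0 P (fun w => alpha s w + 2^-1 * (beta s w - alpha s w)).
rewrite (E_sq_mix 2^-1 a2 b2).
move: (E _) (E _) (E _) ac bc => D a b ac bc.
lra.
Qed.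

Lemma energy_mix c alpha beta : control P B alpha -> control P B beta ->
  energy P (mix c alpha beta) = (1 - c) * energy P alpha + c * energy P beta -
  4 * c * (1 - c) * energy P (hdiff alpha beta).
Proof.
move=> ca cb; have ch := control_hdiff ca cb.
have [ia _ _ _] := control_energy P_complete BM ca.
have [ib _ _ _] := control_energy P_complete BM cb.
have [ih _ _ _] := control_energy P_complete BM ch.
rewrite /energy -(IntZ mI (1 - c) ia) -(IntZ mI c ib) -(IntZ mI (4 * c * (1 - c)) ih).
have i1 := intgZ mI (1 - c) ia; have i2 := intgZ mI c ib; have i3 := intgZ mI (4 * c * (1 - c)) ih.
rewrite -(IntD mI i1 i2) -(IntB mI (intgD mI i1 i2) i3).
apply: (Int_ae mI); last first.
- apply: ae_imply (ae_and (control_L2 P_complete BM ca) (control_L2 P_complete BM cb)) => s [h1 h2].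
  rewrite /= in_itv/= => s01; have [a2 _] := h1 s01; have [b2 _] := h2 s01.
  rewrite (E_sq_mix c a2 b2) (_ : E (fun w => hdiff alpha beta s w ^+ 2) =
    4^-1 * E (fun w => (beta s w - alpha s w) ^+ 2)); first by field.
  rewrite -IntZ//; last exact: (L2B b2 a2).2.
  by apply: eq_Rintegral => w _; rewrite /hdiff; field.
- exact: intg_meas (intgB mI (intgD mI i1 i2) i3).
- apply: jmeas_expectation; apply: measurable_funX; apply: (jmeas_prog P_complete BM).
  exact: prog_mix ca.1 cb.1.
Qed.

Lemma control_fin alpha : control P B alpha ->
  (\int[mu]_(s in `[0%R, 1%R]) \int[P]_w (`|alpha s w|)%:E < +oo)%E.
Proof.
move=> ca; apply: (@strip_bound _ _ _ _ 1 _ c0) => //; first exact: (jmeas_prog P_complete BM ca.1).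
apply: ae_imply (control_L2 P_complete BM ca) => s hs /hs[a2 ac].
split; first exact: L2_pint.
have one2 : L2 P (fun=> 1) by apply: (@L2_bounded _ _ _ _ _ 1) => // w; rewrite normr1.
have := E_abs_mul_le a2 one2 (ltW (c0_gt0 R)) ler01 ac.
rewrite (_ : E (fun=> 1 ^+ 2) = 1); last by rewrite expr1n (E_cst P 1).
by rewrite expr1n mulr1 lexx => /(_ isT); under eq_Rintegral do rewrite mulr1.
Qed.

Lemma control_path_intg alpha : control P B alpha ->
  {ae P, forall w, intg mu `[0, 1] (fun s => alpha s w)}.
Proof.
by move=> ca; have [] := fubini_Rint (jmeas_prog P_complete BM ca.1) (control_fin ca).
Qed.

(** Only almost sure, because the time integral is linear only on integrable paths. *)
Lemma state_mix c alpha beta : control P B alpha -> control P B beta ->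
  {ae P, forall w, state B alpha 1 w + c * (state B beta 1 w - state B alpha 1 w) =
    state B (mix c alpha beta) 1 w}.
Proof.
move=> ca cb; apply: ae_imply (ae_and (control_path_intg ca) (control_path_intg cb)) => w [ia ib].
have id := intgB mI ib ia.
by rewrite /state /mix (IntD mI ia (intgZ mI c id)) (IntZ mI _ id) (IntB mI ib ia); ring.
Qed.

End control_mix.

(** * Limits of sequences of controls *)

Section control_limit.
Context d (T : measurableType d) (R : realType) (P : probability T R).
Variables (B : R -> T -> R).
Hypotheses (P_complete : measure_is_complete P) (BM : standard_brownian_motion P B).
Local Notation mu := (@lebesgue_measure R).
Local Notation E f := (Rintegral P setT f).
Local Notation pint := (intg P setT).
Local Notation c0 := (@c0 R).
Local Notation S1 := (@strip _ T R 1).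
Let t11 : 0 <= (1:R) <= (1:R). Proof. by rewrite ler01 lexx. Qed.
Let mI : @measurable _ (measurableTypeR R) `[0, 1 : R]%classic.
Proof. exact: measurable_itv. Qed.
Let mS : @measurable _ (measurableTypeR R * T)%type S1. Proof. exact: measurable_strip. Qed.

Lemma prod_strip (f : R -> T -> R) : jmeas 1 f -> (forall s w, 0 <= f s w) ->
  (\int[mu \x P]_(z in S1) (f z.1 z.2)%:E =
   \int[mu]_(s in `[0%R, 1%R]) \int[P]_w (f s w)%:E)%E.
Proof.
move=> mf f0; rewrite integral_mkcond.
have mr : measurable_fun setT ((fun z => (f z.1 z.2)%:E) \_ S1).
  by apply: (measurable_restrictT _ mS).1; exact/measurable_EFinP.
rewrite fubini_tonelli1//; last by move=> z; rewrite patchE; case: ifP => // _; rewrite lee_fin.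
rewrite [RHS]integral_mkcond; apply: eq_integral => s _; rewrite patchE /fubini_F.
case: ifPn => [|/negP] s01.
  by apply: eq_integral => w _; rewrite patchE mem_set//; split => //; exact: set_mem.
apply: integral0_eq => w _; rewrite patchE memNset// => -[h _].
by apply: s01; exact: mem_set.
Qed.

(** Integrate |x| <= a x^2 + 1/(4a) over a set of total mass 1. For an energy of at most r^2/4 the
    choice a = 1/r gives an L^1 norm of at most r/2. *)
Lemma control_L1 (h : R -> T -> R) : control P B h ->
  intg (mu \x P)%E S1 (fun z => `|h z.1 z.2|) /\ forall a, 0 < a ->
  Rintegral (mu \x P)%E S1 (fun z => `|h z.1 z.2|) <= a * energy P h + a^-1 / 4.
Proof.
move=> ch; have jh := jmeas_prog P_complete BM ch.1.
have ja : jmeas 1 (fun s w => `|h s w|) by exact: measurableT_comp.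
have fin := control_fin P_complete BM ch.
have fin' : (\int[mu]_(s in `[0%R, 1%R]) \int[P]_w (`|(`|h s w|)|)%:E < +oo)%E.
  by apply: le_lt_trans fin; under eq_integral do under eq_integral do rewrite normr_id.
have [_ _ _ i1 _] := fubini_Rint ja fin'.
have e := prod_strip ja (fun s w => normr_ge0 _).
have i0 : intg (mu \x P)%E S1 (fun z => `|h z.1 z.2|).
  by apply: intg_ge0 => //; rewrite e.
split => // a a0; rewrite -lee_fin -(intgE mS i0) e.
have [i2 _ _ _] := control_energy P_complete BM ch.
have ic : intg mu `[0, 1] (fun=> a^-1 / 4) by exact: intg_lebesgue_cst.
have ia := intgD mI (intgZ mI a i2) ic.
have -> : a * energy P h + a^-1 / 4 =
    Rintegral mu `[0, 1] (fun s => a * E (fun w => h s w ^+ 2) + a^-1 / 4).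
  by rewrite (IntD mI (intgZ mI a i2) ic) (IntZ mI _ i2) Rintegral_lebesgue_cst// mulr1.
rewrite -(intgE mI ia); apply: ae_ge0_le_integral => //.
- by move=> s _; apply: integral_ge0 => w _; rewrite lee_fin.
- have := jmeas_integral_ge0 P ja; apply: eq_measurable_fun => s _.
  by apply: eq_integral => w _; rewrite normr_id.
- move=> s _; rewrite lee_fin addr_ge0 ?divr_ge0 ?invr_ge0 ?(ltW a0)//.
  by rewrite mulr_ge0 ?(ltW a0)// E_sq_ge0.
- exact: measurable_int ia.
apply: ae_imply (control_L2 P_complete BM ch) => s hs; rewrite /= in_itv/= => /hs[h2 _].
have hi := intg_abs measurableT (L2_pint h2).
rewrite (intgE measurableT hi) lee_fin.
have i3 := intgZ measurableT a h2.2.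
have <- : E (fun w => a * h s w ^+ 2 + a^-1 / 4) = a * E (fun w => h s w ^+ 2) + a^-1 / 4.
  by rewrite IntD ?(E_cst P)// ?IntZ//; [exact: h2.2|exact: pint_cst].
apply: Int_le => //; first by apply: intgD => //; exact: pint_cst.
move=> w _; rewrite -subr_ge0 -[h s w ^+ 2](@real_normK _ (h s w)) ?num_real//.
set x := `|_|; rewrite (_ : _ - _ = a * (x - a^-1 / 2) ^+ 2); last by field; rewrite gt_eqF.
by rewrite mulr_ge0 ?sqr_ge0// ltW.
Qed.

Variable alpha_ : nat -> R -> T -> R.
Hypothesis ca : forall n, control P B (alpha_ n).
Hypothesis he : forall n,
  energy P (hdiff (alpha_ n) (alpha_ n.+1)) <= (2^-1 ^+ n) ^+ 2 / 4.

Let h n := hdiff (alpha_ n) (alpha_ n.+1).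
Let ch n : control P B (h n). Proof. exact: control_hdiff. Qed.

Lemma bounded_variation_cvg (x : nat -> R) (g : R) :
  (forall n, \sum_(k < n) `|(x k.+1 - x k) / 2| <= g) ->
  cvgn x /\ forall n, `|x n| <= `|x 0%N| + 2 * g.
Proof.
move=> hg; pose dx k := x k.+1 - x k.
have s2 n : \sum_(k < n) `|dx k| <= 2 * g.
  have := hg n; under eq_bigr do rewrite normrM.
  by rewrite -mulr_suml (ger0_norm (_ : 0 <= 2^-1)) ?invr_ge0//; lra.
have xE n : x n = x 0%N + series dx n.
  elim: n => [|n IH]; first by rewrite seriesEord /= big_ord0 addr0.
  rewrite seriesEord /= big_ord_recr /= addrA.
  by move: IH; rewrite seriesEord /= => <-; rewrite /dx addrC subrK.
split; last first.
  move=> n; rewrite xE; apply: le_trans (ler_normD _ _) _; rewrite lerD2l.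
  by rewrite seriesEord /=; apply: le_trans (ler_norm_sum _ _ _) (s2 n).
rewrite (_ : x = fun n => x 0%N + series dx n); last by apply/funext.
apply: is_cvgD; first exact: is_cvg_cst.
apply: normed_cvg; have -> : [normed series dx] = series (fun k => `|dx k|) by [].
apply: nondecreasing_is_cvgn.
  by apply/nondecreasing_seqP => n; rewrite !seriesEord /= big_ord_recr /= lerDl.
by exists (2 * g) => _ [n _ <-]; rewrite seriesEord /=; exact: s2.
Qed.

(** The half-increments are summable in L^1 of the product measure, hence the controls converge
    almost everywhere, with a dominating function along almost every path. The energy bound is asked
    for a tail of the sequence only, because the bounds to be used improve with [m]. *)
Lemma control_limit : exists alpha, [/\ control P B alpha,
  {ae P, forall w, (fun n => state B (alpha_ n) 1 w) @ \oo --> state B alpha 1 w} &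
  forall m c, (forall n, energy P (alpha_ (m + n)) <= c) -> energy P alpha <= c].
Proof.
pose u n := (fun z : R * T => `|h n z.1 z.2|) \_ S1.
have [|n|n|g gi ug] := @ae_summable _ _ _ (mu \x P)%E u.
- by move=> n z; rewrite /u patchE; case: ifP.
- have [i _] := control_L1 (ch n); rewrite /intg /u -restrict_EFin.
  exact/(integrable_mkcond _ mS).
- have [_ /(_ (2^-1 ^+ n)^-1)] := control_L1 (ch n).
  have r0 : 0 < (2^-1 : R) ^+ n by rewrite exprn_gt0.
  rewrite invr_gt0 r0 => /(_ isT); rewrite /u -Rintegral_mkcond => le1.
  apply: le_trans le1 _; have := he n; rewrite -/(h n) invrK.
  set r := _ ^+ n in r0 *; set en := energy _ _ => hen.
  have : r^-1 * en <= r^-1 * (r ^+ 2 / 4) by rewrite ler_pM2l ?invr_gt0.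
  rewrite (_ : r^-1 * (r ^+ 2 / 4) = r / 4); last by field; rewrite gt_eqF.
  lra.
pose alpha s w := fine (limn_esup (fun n => (alpha_ n s w)%:E)).
have pa : progressive P B alpha.
  move=> t0 t01; apply: measurableT_comp => //.
  apply: measurable_fun_limn_esup => n; apply/measurable_EFinP; exact: (ca n).1.
have ja := jmeas_prog P_complete BM pa.
have jn n := jmeas_prog P_complete BM (ca n).1.
have good (z : R * T) : S1 z -> (forall n, \sum_(k < n) u k z <= g z) ->
    (fun n => alpha_ n z.1 z.2) @ \oo --> alpha z.1 z.2 /\
    forall n, `|alpha_ n z.1 z.2| <= `|alpha_ 0%N z.1 z.2| + 2 * g z.
  move=> zs hz; have [|cv bd] := @bounded_variation_cvg (fun n => alpha_ n z.1 z.2) (g z).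
    move=> n; apply: le_trans (hz n); rewrite le_eqVlt; apply/orP; left; apply/eqP.
    by apply: eq_bigr => k _; rewrite /u patchE mem_set.
  split => //; rewrite /alpha.
  have c : (fun n => (alpha_ n z.1 z.2)%:E) @ \oo -->
      (limn (fun n => alpha_ n z.1 z.2))%:E by apply: cvg_EFin => //; exact: nearW.
  by rewrite (cvg_limn_einf_sup c).2.
have ugz : {ae (mu \x P)%E, forall z, S1 z ->
    (fun n => alpha_ n z.1 z.2) @ \oo --> alpha z.1 z.2 /\
    forall n, `|alpha_ n z.1 z.2| <= `|alpha_ 0%N z.1 z.2| + 2 * g z}.
  by apply: ae_imply ug => z hz zs; exact: good.
have [ae_s ae_w] := ae_prod_sections ugz.
have gw := ae_integrable2 gi.
have cv_s : {ae mu, forall s, 0 <= s <= 1 -> {ae P, forall w, setT w ->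
    (fun n => alpha_ n s w) @ \oo --> alpha s w}}.
  apply: ae_imply ae_s => s hs s01; apply: negligibleS hs => w /= nh zs.
  have sw : S1 (s, w) by split => //=; rewrite in_itv.
  by apply: nh => _; exact: (zs sw).1.
have ae_L2 := ae_foralln (fun n => control_L2 P_complete BM (ca n)).
have ctrl : control P B alpha.
  apply: control_intro => //; apply: ae_imply (ae_and cv_s ae_L2) => s [hs h2] s01.
  have ms := jmeas_section ja (andP s01).1 (andP s01).2.
  have msn n := jmeas_section (jn n) (andP s01).1 (andP s01).2.
  have le : (\int[P]_w (alpha s w ^+ 2)%:E <= (c0 ^+ 2)%:E)%E.
    apply: (@Int_fatou _ _ _ P setT measurableT (fun n w => alpha_ n s w ^+ 2)).
    - by move=> n; exact: meas_sq.
    - exact: meas_sq.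
    - by move=> n w _; exact: sqr_ge0.
    - apply: ae_imply (hs s01) => w hw _; rewrite expr2; under eq_fun do rewrite expr2.
      by apply: cvgM; exact: hw.
    - by move=> n; have [a2 ac] := h2 n s01; rewrite (intgE measurableT a2.2) lee_fin.
  have a2 : L2 P (alpha s).
    split => //; apply: intg_ge0; [exact: meas_sq|by move=> w _; exact: sqr_ge0|].
    by apply: le_lt_trans le _; exact: ltry.
  by split => //; move: le; rewrite (intgE measurableT a2.2) lee_fin.
exists alpha; split => //.
- apply: ae_imply (ae_and ae_w (ae_and gw (control_path_intg P_complete BM (ca 0)))) => w [hw [hg ha0]].
  apply: cvgD; last exact: cvg_cst.
  have := @Int_dominated _ _ _ mu _ mI (fun n s => alpha_ n s w) (fun s => alpha s w)
    (fun s => `|alpha_ 0%N s w| + 2 * g (s, w)) _ _ _ _ _; case => //.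
  + by move=> n; exact: jmeas_section2.
  + exact: jmeas_section2.
  + by apply: negligibleS hw => s /= nh zs; apply: nh => si; have [] := zs (conj si I).
  + apply: (intgD mI (intg_abs mI ha0)); apply: (intgZ mI).
    have gs : measurable_fun `[0, 1 : R] (fun s => g (s, w)).
      by apply/measurable_EFinP; apply: measurable_funTS; exact: measurable_int hg.
    have hg' : mu.-integrable setT (fun s => (g (s, w))%:E) by [].
    exact: (integrableS measurableT mI (@subsetT _ _) hg').
  + by move=> n; apply: negligibleS hw => s /= nh zs; apply: nh => si; have [_] := zs (conj si I).
- move=> m c hc.
  have [i2 _ _ _] := control_energy P_complete BM ctrl.
  have eE beta : control P B beta ->
      (\int[mu \x P]_(z in S1) (beta z.1 z.2 ^+ 2)%:E = (energy P beta)%:E)%E.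
    move=> cb; have jb := jmeas_prog P_complete BM cb.1.
    have j2 : jmeas 1 (fun s w => beta s w ^+ 2) by exact: measurable_funX.
    rewrite (prod_strip j2 (fun s w => sqr_ge0 _)) -(tonelli_strip P j2 (fun s w => sqr_ge0 _)).
    by have [_ -> _ _] := control_energy P_complete BM cb.
  rewrite -lee_fin -(eE _ ctrl).
  apply: (@Int_fatou _ _ _ (mu \x P)%E S1 mS (fun n z => alpha_ (m + n)%N z.1 z.2 ^+ 2)).
  + by move=> n; apply: measurable_funX; exact: jn.
  + by apply: measurable_funX; exact: ja.
  + by move=> n z _; exact: sqr_ge0.
  + apply: ae_imply ugz => z hz /hz[cv _]; rewrite expr2; under eq_fun do rewrite expr2.
    have cv' : (fun n => alpha_ (m + n)%N z.1 z.2) @ \oo --> alpha z.1 z.2.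
      by under eq_fun do rewrite addnC; move: cv; rewrite -(cvg_shiftn m).
    by apply: cvgM; exact: cv'.
  + by move=> n; rewrite eE// lee_fin.
Qed.

End control_limit.

Lemma powR_cvg (R : realType) (p l : R) (u : nat -> R) : 0 < p -> (forall n, 0 <= u n) -> 0 <= l ->
  u @ \oo --> l -> (fun n => u n `^ p) @ \oo --> l `^ p.
Proof.
move=> p0 u0; rewrite le_eqVlt => /predU1P[<-|l0] ul.
  by rewrite powR0 ?gt_eqF//; exact: powR_cvg_zero.
have dl : derivable (fun x : R => x `^ p) l 1 by apply: derivable_powR; rewrite in_itv/= l0.
have cl := differentiable_continuous ((derivable1_diffP _ _).1 dl).
exact: (cvg_comp _ _ ul cl).
Qed.

(** * A minimizing sequence of nearly least energy *)

Section primal_existence.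
Context d (T : measurableType d) (R : realType) (P : probability T R).
Variables (B : R -> T -> R).
Hypotheses (P_complete : measure_is_complete P) (BM : standard_brownian_motion P B).
Local Notation mu := (@lebesgue_measure R).
Local Notation E f := (Rintegral P setT f).
Local Notation pint := (intg P setT).
Local Notation c0 := (@c0 R).
Variables (p q delta : R).
Hypotheses (p2 : 2 <= p) (q1 : 1 < q) (pq : p^-1 + q^-1 = 1) (delta0 : 0 <= delta).
Let p1 : 1 < p. Proof. by apply: lt_le_trans p2; rewrite ltr1n. Qed.
Let p0 : 0 < p. Proof. exact: lt_trans p1. Qed.

Definition admissible alpha := control P B alpha /\ Lp P p (state B alpha 1).
Definition cost alpha : R := pnorm P p (state B alpha 1) + delta / 2 * energy P alpha.

Lemma admissible_mix c alpha beta : 0 <= c <= 1 -> admissible alpha -> admissible beta ->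
  admissible (mix c alpha beta) /\ pnorm P p (state B (mix c alpha beta) 1) <=
    (1 - c) * pnorm P p (state B alpha 1) + c * pnorm P p (state B beta 1).
Proof.
move=> c01 [ca ap] [cb bp]; have cm := control_mix P_complete BM c01 ca cb.
have sm := state_mix P_complete BM c ca cb; have ms := state_meas P_complete BM cm.
have Xp := Lp_mix p1 c ap bp; split; first exact: (conj cm (Lp_ae ms sm Xp)).
by rewrite -(pnorm_ae p Xp.1 ms sm); apply: (pnorm_mix p1 q1 pq).
Qed.

Lemma cost_mix c alpha beta : 0 <= c <= 1 -> admissible alpha -> admissible beta ->
  cost (mix c alpha beta) <= (1 - c) * cost alpha + c * cost beta.
Proof.
move=> c01 aa ab; have [_ h] := admissible_mix c01 aa ab.
rewrite /cost (energy_mix P_complete BM c aa.1 ab.1).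
have [_ _ e0 _] := control_energy P_complete BM (control_hdiff P_complete BM aa.1 ab.1).
move: h c01 => h /andP[c0' c1]; have c1' : 0 <= 1 - c by rewrite subr_ge0.
have : 0 <= delta / 2 * (4 * (c * (1 - c)) * energy P (hdiff alpha beta)).
  by rewrite !mulr_ge0.
move: (energy P (hdiff _ _)) (energy P alpha) (energy P beta) h => e1 e2 e3.
move: (pnorm _ _ _) (pnorm _ _ _) (pnorm _ _ _) => n1 n2 n3; lra.
Qed.

Lemma cost_ge0 alpha : control P B alpha -> 0 <= cost alpha.
Proof.
move=> ca; have [_ _ e0 _] := control_energy P_complete BM ca.
by rewrite addr_ge0 ?powR_ge0// mulr_ge0// divr_ge0.
Qed.

Lemma admissible0 : admissible (fun _ _ => 0).
Proof.
have c0' : control P B (fun _ _ => 0).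
  apply: control_intro; first by move=> t t01; exact: measurable_cst.
  apply/aeW => s _; split; first by apply: (@L2_bounded _ _ _ _ _ 0) => // w; rewrite normr0.
  by rewrite expr0n/= (E_cst P 0) sqr_ge0.
split => //; apply: (Lp_ae (state_meas P_complete BM c0') _ (bm_Lp BM (ltW p0) ler01 (lexx 1))).
by apply/aeW => w; rewrite /state Rintegral_lebesgue_cst// mul0r add0r.
Qed.

(** [v] is the optimal cost and [Q e] the least energy among controls within e of it. [Q e] grows as
    e decreases and is at most c_0^2; its limit [Qs] is the energy at which the minimizing sequence
    is aimed. *)
Let v := inf [set cost a | a in admissible].
Let level e := [set a | admissible a /\ cost a <= v + e].
Let Q e := inf [set energy P a | a in level e].
Let Qs := sup [set Q e | e in [set e : R | 0 < e]].

Let v_le a : admissible a -> v <= cost a.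
Proof.
move=> aa; apply: ge_inf; last by exists a.
by exists 0 => _ [b bb <-]; exact: cost_ge0 bb.1.
Qed.

Let level_ne e : 0 < e -> exists a, level e a.
Proof.
move=> e0; have [|_ [a aa <-] lt] := @inf_adherent _ [set cost a | a in admissible] e e0.
- split; first by exists (cost (fun _ _ => 0)); exists (fun _ _ => 0) => //; exact: admissible0.
  by exists 0 => _ [b bb <-]; exact: cost_ge0 bb.1.
by exists a; split => //; exact: ltW.
Qed.

Let Q_lb e : has_lbound [set energy P a | a in level e].
Proof.
by exists 0 => _ [a [[ca _] _] <-]; have [] := control_energy P_complete BM ca.
Qed.

Let Q_le e a : level e a -> Q e <= energy P a.
Proof. by move=> ha; apply: (ge_inf (Q_lb e)); exists a. Qed.

Let Q_mono e e' : 0 < e' -> e' <= e -> Q e <= Q e'.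
Proof.
move=> e'0 ee; apply: lb_le_inf.
  by have [a ha] := level_ne e'0; exists (energy P a); exists a.
move=> _ [a [aa ca] <-]; apply: Q_le; split => //; apply: le_trans ca _.
by rewrite lerD2l.
Qed.

Let Qs_ub : has_ubound [set Q e | e in [set e : R | 0 < e]].
Proof.
exists (c0 ^+ 2) => _ [e /= e0 <-]; have [a ha] := level_ne e0.
apply: le_trans (Q_le ha) _; have [[ca _] _] := ha.
by have [] := control_energy P_complete BM ca.
Qed.

Let Q_Qs e : 0 < e -> Q e <= Qs.
Proof. by move=> e0; apply: (ub_le_sup Qs_ub); exists e. Qed.

Let near_min eta : 0 < eta -> exists a e, [/\ 0 < e, e <= eta, level e a,
  Qs - eta < Q e & energy P a < Qs + eta].
Proof.
move=> eta0; have [|_ [e1 /= e10 <-] lt1] := @sup_adherent _ [set Q e | e in [set e : R | 0 < e]] eta eta0.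
- by split => //; exists (Q 1); exists 1 => //=.
pose e := Num.min e1 eta; have e0 : 0 < e by rewrite lt_min e10.
have Qe : Qs - eta < Q e by apply: lt_le_trans lt1 _; apply: Q_mono => //; rewrite ge_min lexx.
have [|_ [a ha <-] lt2] := @inf_adherent _ [set energy P a | a in level e] eta eta0.
- by split => //; have [a ha] := level_ne e0; exists (energy P a); exists a.
exists a, e; split => //; first by rewrite ge_min lexx orbT.
by apply: lt_le_trans lt2 _; rewrite lerD2r; exact: Q_Qs.
Qed.

(* Minimizers of the energy over the sublevel sets of the cost form a Cauchy
   sequence by the parallelogram identity; this also covers [delta = 0]. *)
Lemma primal_exists : exists2 alpha, admissible alpha &
  forall beta, admissible beta -> cost alpha <= cost beta.
Proof.
(* The midpoint of two consecutive controls has energy above Qs - eta, while their mean energy is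
   below Qs + eta. By the parallelogram identity the half-difference has energy less than 2 eta =
   4^-n / 4, the rate required by [control_limit]. *)
pose eta n : R := (2^-1 ^+ n) ^+ 2 / 8.
have r0 n : 0 < (2^-1 : R) ^+ n by rewrite exprn_gt0.
have eta0 n : 0 < eta n by rewrite divr_gt0// exprn_gt0.
have r1 n : (2^-1 : R) ^+ n <= 1 by rewrite exprn_ile1 ?invr_ge0// invf_le1 ?ler1n.
have eta_le m n : eta (m + n)%N <= eta m.
  rewrite ler_pM2r ?invr_gt0// ler_sqr ?nnegrE ?(ltW (r0 _))// exprD.
  by rewrite -[leRHS]mulr1 ler_pM2l.
have /choice[a_ /choice[e_ ae]] := fun n => near_min (eta0 n).
have aa n : admissible (a_ n) by have [_ _ [] ] := ae n.
have [|alpha [ca Xcv ecv]] := control_limit P_complete BM (fun n => (aa n).1).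
  move=> n; have [e0 _ la Qn en] := ae n; have [e0' _ la' Qn' en'] := ae n.+1.
  have en1 : eta n.+1 <= eta n by rewrite -addn1.
  pose e := Num.max (e_ n) (e_ n.+1).
  have Qe : Qs - eta n < Q e.
    rewrite /e; have [_|_] := leP (e_ n) (e_ n.+1); last exact: Qn.
    by apply: le_lt_trans Qn'; rewrite lerD2l lerN2.
  have half : 0 <= (2^-1 : R) <= 1 by lra.
  have [am _] := admissible_mix half (aa n) (aa n.+1).
  have lm : level e (mix 2^-1 (a_ n) (a_ n.+1)).
    split => //; apply: le_trans (cost_mix half (aa n) (aa n.+1)) _.
    have h1 : cost (a_ n) <= v + e by apply: le_trans la.2 _; rewrite lerD2l le_max lexx.
    have h2 : cost (a_ n.+1) <= v + e by apply: le_trans la'.2 _; rewrite lerD2l le_max lexx orbT.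
    lra.
  have := Q_le lm; rewrite (energy_mix P_complete BM _ (aa n).1 (aa n.+1).1).
  have : eta n = (2^-1 ^+ n) ^+ 2 / 8 by [].
  move: (energy P (hdiff _ _)) ((2^-1 ^+ n) ^+ 2) => x y; lra.
(* From index m on, the cost is at most v + eta m and the energy at least Qs - eta m, so K m bounds
   the norms of the terminal states. *)
pose K m := v + eta m - delta / 2 * (Qs - eta m).
have d2 : 0 <= delta / 2 by rewrite divr_ge0.
have Nle m n : pnorm P p (state B (a_ (m + n)%N) 1) <= K m.
  have [_ ee [_ lc] Qn _] := ae (m + n)%N; have el := eta_le m n.
  have qe : Q (e_ (m + n)%N) <= energy P (a_ (m + n)%N) by apply: Q_le; have [] := ae (m + n)%N.
  have : delta / 2 * (Qs - eta m) <= delta / 2 * energy P (a_ (m + n)%N).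
    by apply: ler_wpM2l => //; lra.
  by move: lc; rewrite /cost /K; lra.
have K0 m : 0 <= K m by apply: le_trans (Nle m 0%N); exact: powR_ge0.
have mX := state_meas P_complete BM ca.
have Fat m : (\int[P]_w (`|state B alpha 1 w| `^ p)%:E <= (K m `^ p)%:E)%E.
  apply: (@Int_fatou _ _ _ P setT measurableT (fun n w => `|state B (a_ (m + n)%N) 1 w| `^ p)).
  - by move=> n; apply: meas_absp; exact: (aa _).2.1.
  - exact: meas_absp.
  - by move=> n w _; exact: powR_ge0.
  - apply: ae_imply Xcv => w cv _; apply: powR_cvg => //; apply: cvg_norm.
    by under eq_fun do rewrite addnC; move: cv; rewrite -(cvg_shiftn m).
  - move=> n; rewrite (intgE measurableT (aa _).2.2) lee_fin -pnorm_powR//.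
    by apply: ge0_ler_powR; rewrite ?nnegrE ?(ltW p0) ?powR_ge0 ?K0//; exact: Nle.
have Xp : Lp P p (state B alpha 1).
  split => //; apply: intg_ge0; [exact: meas_absp|by move=> w _; exact: powR_ge0|].
  by apply: le_lt_trans (Fat 0%N) _; exact: ltry.
have NX m : pnorm P p (state B alpha 1) <= K m.
  have := Fat m; rewrite (intgE measurableT Xp.2) lee_fin -pnorm_powR// => h.
  rewrite leNgt; apply/negP => lt; move: h; rewrite leNgt => /negP; apply.
  by apply: gt0_ltr_powR; rewrite ?nnegrE ?powR_ge0.
exists alpha => // beta bb; apply: le_trans (v_le bb); apply/ler_addgt0Pr => e e0.
have /cvgrPdist_lt cv : (fun n => (2^-1 : R) ^+ n) @ \oo --> (0 : R).
  by apply: cvg_expr; rewrite ger0_norm ?invr_ge0// invf_lt1 ?ltr1n.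
(* Adding the bound K m for the norm and Qs + eta m for the energy, the terms in Qs cancel and the
   cost of the limit is at most v + (1 + delta) eta m. *)
have d1 : 0 < 1 + delta by rewrite ltr_pwDl.
have [m _ /(_ m (leqnn m))] := cv _ (divr_gt0 e0 d1).
rewrite /= sub0r normrN ger0_norm ?(ltW (r0 m))// ltr_pdivlMr// => hm.
have eta_r : eta m <= 2^-1 ^+ m.
  by rewrite /eta expr2; have := r1 m; have := r0 m; move: (_ ^+ m) => r; nra.
have en : energy P alpha <= Qs + eta m.
  apply: (ecv m) => n; have [_ _ _ _ h] := ae (m + n)%N; have := eta_le m n; lra.
have h3 : delta / 2 * energy P alpha <= delta / 2 * (Qs + eta m) by exact: ler_wpM2l.
have h4 : eta m * (1 + delta) <= 2^-1 ^+ m * (1 + delta) by rewrite ler_pM2r.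
have := NX m; rewrite /cost /K; lra.
Qed.

End primal_existence.

(** * Strong duality *)

(** For p > 2 the exponent p - 2 is positive and the power is continuous at 0 as well; for p = 2 it
    is constantly 1. *)
Lemma dualf_cvg (R : realType) (p l : R) (u : nat -> R) : 2 <= p -> u @ \oo --> l ->
  (fun n => dualf p (u n)) @ \oo --> dualf p l.
Proof.
move=> p2 ul; apply: cvgM => //.
have [->|pn2] := eqVneq p 2.
  rewrite subrr powRr0; under eq_fun do rewrite powRr0.
  exact: cvg_cst.
by apply: powR_cvg => //; [rewrite subr_gt0 lt_neqAle eq_sym pn2|exact: cvg_norm].
Qed.

Lemma mulr_divCA (F : fieldType) (a b c : F) : c != 0 -> a * b = c * (a * (b / c)).
Proof. by move=> c0; field. Qed.

Section first_variation.
Context d (T : measurableType d) (R : realType) (P : probability T R).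
Variables (B : R -> T -> R).
Hypotheses (P_complete : measure_is_complete P) (BM : standard_brownian_motion P B).
Local Notation mu := (@lebesgue_measure R).
Local Notation E f := (Rintegral P setT f).
Local Notation pint := (intg P setT).
Variables (p q delta : R).
Hypotheses (p2 : 2 <= p) (q1 : 1 < q) (pq : p^-1 + q^-1 = 1) (delta0 : 0 <= delta).
Let p1 : 1 < p. Proof. by apply: lt_le_trans p2; rewrite ltr1n. Qed.
Let p0 : 0 < p. Proof. exact: lt_trans p1. Qed.
Let q0 : 0 < q. Proof. exact: lt_trans q1. Qed.
Let p10 : 0 < p - 1. Proof. by rewrite subr_gt0. Qed.

Variable alpha : R -> T -> R.
Hypothesis aa : admissible P B p alpha.
Hypothesis opt : forall beta, admissible P B p beta -> cost P B p delta alpha <= cost P B p delta beta.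
Local Notation X := (state B alpha 1).
Local Notation Y := (dualn P p X).

Section direction.
Variable beta : R -> T -> R.
Hypothesis bb : admissible P B p beta.
Let Xp : Lp P p X. Proof. exact: aa.2. Qed.
Let D w := state B beta 1 w - X w.
Let Dp : Lp P p D. Proof. exact: (LpB (ltW p0) bb.2 Xp). Qed.
Let e_ n : R := n.+1%:R^-1.
Let e0 n : 0 < e_ n. Proof. by rewrite invr_gt0. Qed.
Let e1 n : 0 <= e_ n <= 1. Proof. by rewrite ltW//= invf_le1// ler1n. Qed.
Let Z n w := X w + e_ n * D w.
Let Zp n : Lp P p (Z n). Proof. exact: (Lp_mix p1 (e_ n) Xp bb.2). Qed.
Let G := delta / 2 * (energy P beta - energy P alpha).

Let ZE n : pnorm P p (Z n) = pnorm P p (state B (mix (e_ n) alpha beta) 1).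
Proof.
apply: pnorm_ae; [exact: (Zp n).1| |exact: (state_mix P_complete BM (e_ n) aa.1 bb.1)].
by apply: (state_meas P_complete BM); exact: (control_mix P_complete BM (e1 n) aa.1 bb.1).
Qed.

Let Z0 n : 0 < pnorm P p (Z n).
Proof.
rewrite ZE; have [am _] := admissible_mix P_complete BM p2 q1 pq (e1 n) aa bb.
by apply: (pnorm_gt0 P_complete BM); [exact: am.1|exact: am.2].
Qed.

Let F n := E (fun w => D w * dualf p (Z n w)).

(** Differentiating the norm is avoided by using the norming functional of the perturbed state
    [Z n]: it bounds the norm of [Z n] above by |X|_p + e_n E[D dualn(Z n)]. Optimality bounds it
    below, and the quotient by e_n has a sign. The factor |Z|^(p-1) clears the denominator before
    the limit is taken. *)
Let ineq n : 0 <= F n + pnorm P p (Z n) `^ (p - 1) * G.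
Proof.
have [Yq Y1 YN] := dualn_spec p1 q1 pq (Zp n) (Z0 n).
have Y1' : E (fun w => `|dualn P p (Z n) w| `^ q) <= 1 by rewrite Y1.
have hX : E (fun w => X w * dualn P p (Z n) w) <= pnorm P p X by exact: (hoelder_unit p1 q0 pq Xp Yq Y1').
have iX := Lp_mul p0 q0 pq Xp Yq; have iD := Lp_mul p0 q0 pq Dp Yq.
have EZ : pnorm P p (Z n) = E (fun w => X w * dualn P p (Z n) w) +
    e_ n * E (fun w => D w * dualn P p (Z n) w).
  rewrite -IntZ// -IntD//; last exact: intgZ.
  by rewrite -YN; apply: eq_Rintegral => w _; rewrite {1}/Z; ring.
have [am _] := admissible_mix P_complete BM p2 q1 pq (e1 n) aa bb.
have le := opt am; rewrite /cost -ZE EZ (energy_mix P_complete BM _ aa.1 bb.1) in le.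
have [_ _ h0 _] := control_energy P_complete BM (control_hdiff P_complete BM aa.1 bb.1).
have /andP[en0 en1] := e1 n.
have hh : 0 <= delta / 2 * (4 * (e_ n * (1 - e_ n)) * energy P (hdiff alpha beta)).
  by rewrite !mulr_ge0// subr_ge0.
set ED := E (fun w => D w * dualn P p (Z n) w) in EZ le *.
have -> : F n = pnorm P p (Z n) `^ (p - 1) * ED.
  rewrite /ED -IntZ//; apply: eq_Rintegral => w _.
  by apply: mulr_divCA; apply: lt0r_neq0; exact: powR_gt0 (Z0 n).
rewrite -mulrDr; apply: mulr_ge0; first exact: powR_ge0.
rewrite -(pmulr_rge0 _ (e0 n)) /G.
move: (energy P (hdiff _ _)) (energy P alpha) (energy P beta) (e_ n) le hh => eh ea eb e.
clear EZ; move: (E (fun w => X w * _)) (pnorm P p X) ED hX => EX N ED'; lra.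
Qed.

Let e_cvg : e_ @ \oo --> (0 : R). Proof. exact: cvg_harmonic. Qed.

Let F_cvg : F @ \oo --> E (fun w => D w * dualf p (X w)).
Proof.
pose S w := `|X w| + `|D w|.
have Sp : Lp P p S.
  have ab f : Lp P p f -> Lp P p (fun w => `|f w|).
    move=> fp; apply: (Lp_le (ltW p0) _ _ fp); first exact: measurableT_comp fp.1.
    by move=> w; rewrite normr_id.
  by apply: LpD; [exact: ltW|exact: ab|exact: ab].
have mdual f : measurable_fun setT f -> measurable_fun setT (fun w => D w * dualf p (f w)).
  move=> mf; apply: measurable_funM; first exact: Dp.1.
  by apply: measurable_funM => //; exact: meas_absp.
have := @Int_dominated _ _ _ P setT measurableT (fun n w => D w * dualf p (Z n w))
  (fun w => D w * dualf p (X w)) (fun w => `|S w| `^ p) _ _ _ Sp.2 _; case.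
- by move=> n; apply: mdual; exact: (Zp n).1.
- by apply: mdual; exact: Xp.1.
- apply/aeW => w _; apply: cvgM; first exact: cvg_cst.
  apply: dualf_cvg => //; rewrite -[X in _ --> X]addr0; apply: cvgD; first exact: cvg_cst.
  by rewrite -[X in _ --> X](mul0r (D w)); apply: cvgM => //; exact: cvg_cst.
- move=> n; apply/aeW => w _; rewrite normrM norm_dualf//.
  have S0 : 0 <= S w by rewrite addr_ge0.
  rewrite (ger0_norm S0) -(mulr_powRB1 S0 p0); apply: ler_pM; rewrite ?powR_ge0//.
    by rewrite lerDr.
  apply: ge0_ler_powR; rewrite ?nnegrE ?(ltW p10)//.
  apply: le_trans (ler_normD _ _) _; rewrite lerD2l normrM ger0_norm ?(ltW (e0 n))//.
  by rewrite ler_piMl//; have /andP[] := e1 n.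
by move=> _ _.
Qed.

Lemma first_variation : 0 <= E (fun w => (state B beta 1 w - X w) * Y w) +
  delta / 2 * (energy P beta - energy P alpha).
Proof.
have N0 : 0 < pnorm P p X by apply: (pnorm_gt0 P_complete BM); [exact: aa.1|exact: aa.2].
have [Yq Y1 YN] := dualn_spec p1 q1 pq Xp N0.
have Y1' : E (fun w => `|Y w| `^ q) <= 1 by rewrite Y1.
have iX := Lp_mul p0 q0 pq Xp Yq; have iD := Lp_mul p0 q0 pq Dp Yq.
(* The norm of [Z n] is squeezed between two affine functions of e_n: below by the pairing with the
   norming functional of [X], above by convexity. *)
have N_cvg : (fun n => pnorm P p (Z n)) @ \oo --> pnorm P p X.
  have lin (c : R) : (fun n => pnorm P p X + e_ n * c) @ \oo --> pnorm P p X.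
    rewrite -[X in _ --> X]addr0; apply: cvgD; first exact: cvg_cst.
    by rewrite -[X in _ --> X](mul0r c); apply: cvgM => //; exact: cvg_cst.
  apply: (squeeze_cvgr _ (lin (E (fun w => D w * Y w))) (lin (pnorm P p (state B beta 1) - pnorm P p X))).
  apply: nearW => n; apply/andP; split.
    apply: le_trans (hoelder_unit p1 q0 pq (Zp n) Yq Y1' : _ <= pnorm P p (Z n)).
    rewrite -{1}YN -IntZ// -IntD//; last exact: intgZ.
    by rewrite le_eqVlt; apply/orP; left; apply/eqP/eq_Rintegral => w _; rewrite /Z; ring.
  apply: le_trans (pnorm_mix p1 q1 pq Xp bb.2 (e1 n) : pnorm P p (Z n) <= _) _.
  move: (pnorm P p X) (pnorm P p (state B beta 1)) (e_ n) => a b e.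
  by rewrite le_eqVlt; apply/orP; left; apply/eqP; ring.
have lim : (fun n => F n + pnorm P p (Z n) `^ (p - 1) * G) @ \oo -->
    E (fun w => D w * dualf p (X w)) + pnorm P p X `^ (p - 1) * G.
  apply: cvgD => //; apply: cvgM; last exact: cvg_cst.
  exact: (powR_cvg p10 (fun n => ltW (Z0 n)) (ltW N0) N_cvg).
have : 0 <= E (fun w => D w * dualf p (X w)) + pnorm P p X `^ (p - 1) * G.
  by apply: (cvgr_to_ge lim); apply: nearW; exact: ineq.
have -> : E (fun w => D w * dualf p (X w)) = pnorm P p X `^ (p - 1) * E (fun w => D w * Y w).
  by rewrite -IntZ//; apply: eq_Rintegral => w _; apply: mulr_divCA; apply: lt0r_neq0; exact: powR_gt0 N0.
by rewrite -mulrDr (pmulr_rge0 _ (powR_gt0 _ N0)).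
Qed.

End direction.
End first_variation.

Section capped_phi.
Context (R : realType).
Variable delta : R.
Hypothesis delta0 : 0 <= delta.
Local Notation c0 := (@c0 R).

Lemma phir_lipschitz (a b : R) : 0 <= a -> 0 <= b ->
  `|phir delta a - phir delta b| <= c0 * `|a - b|.
Proof.
have half (x y : R) : 0 <= x -> 0 <= y -> phir delta x - phir delta y <= c0 * `|x - y|.
  move=> x0 y0; have b0 := best_ge0 delta0 x0.
  have bc : `|best delta x| <= c0 by rewrite ger0_norm// best_le.
  have := phir_max delta0 y0 bc.
  have : best delta x * (x - y) <= c0 * `|x - y|.
    apply: le_trans (ler_norm _) _; rewrite normrM; exact: ler_wpM2r.
  by rewrite {2}/phir; lra.
by move=> a0 b0; rewrite ler_norml lerNl opprB half// andbT distrC half.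
Qed.

(** What the n-th truncated candidate control achieves in place of [phi]: the candidate is switched
    off where the norm is below 1/(n+1), so as to keep its multiplier bounded. *)
Definition psi n (x : R) : R := if n.+1%:R^-1 <= x then phir delta x else 0.

(** A finite positive limit is eventually above the cut-off and [phir] is Lipschitz; an infinite
    limit is handled by linear growth. If y = 0, the bound by [y] forces all [x_ n] to be 0, where
    both functions vanish. *)
Lemma psi_cvg (x_ : nat -> R) (y : \bar R) : (forall n, 0 <= x_ n) ->
  (forall n, ((x_ n)%:E <= y)%E) -> (fun n => (x_ n)%:E) @ \oo --> y ->
  (fun n => (psi n (x_ n))%:E) @ \oo --> phi delta y.
Proof.
move=> x0; have cp := c0_gt0 R; case: y => [y| |] le cv; last by have := le 0%N.
- have y0 : 0 <= y by apply: le_trans (x0 0%N) _; rewrite -lee_fin.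
  rewrite phiE//; apply: cvg_EFin; first exact: nearW.
  have cv' : x_ @ \oo --> y by exact: fine_cvg cv.
  have [yE|yn0] := eqVneq y 0.
    have xE n : x_ n = 0 by apply/eqP; rewrite eq_le x0 andbT -yE -lee_fin.
    have p0 : phir delta y = 0.
      apply/eqP; rewrite eq_le phir_ge0// andbT yE -[leRHS](mulr0 c0); exact: phir_le.
    rewrite p0; under eq_fun do rewrite xE /psi leNgt invr_gt0 ltr0n /=.
    exact: cvg_cst.
  have {yn0 y0}yp : 0 < y by rewrite lt_neqAle eq_sym yn0.
  apply/cvgrPdist_lt => e e0; have e0' : 0 < e / c0 by exact: divr_gt0.
  have y2 : 0 < y / 2 by rewrite divr_gt0.
  near=> n.
  have h1 : `|y - x_ n| < y / 2 by near: n; move/cvgrPdist_lt : cv'; exact.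
  have h2 : `|y - x_ n| < e / c0 by near: n; move/cvgrPdist_lt : cv'; exact.
  have h3 : n.+1%:R^-1 < y / 2 by near: n; exact: (near_infty_natSinv_lt (PosNum y2)).
  have h4 : y / 2 < x_ n.
    by move: h1; rewrite ltr_norml => /andP[_ h1]; lra.
  rewrite /= /psi ifT; last exact: ltW (lt_trans h3 h4).
  apply: le_lt_trans (phir_lipschitz (ltW yp) (x0 n)) _.
  by rewrite mulrC -ltr_pdivlMr.
- rewrite phi_pinfty; apply/cvgeryP; apply/cvgryPge => A.
  move/cvgeryP/cvgryPge : cv => cv.
  near=> n.
  have h1 : 1 <= x_ n by near: n; exact: cv.
  have h2 : (A + delta / 2 * c0 ^+ 2) / c0 <= x_ n by near: n; exact: cv.
  rewrite /psi ifT; last by apply: le_trans h1; rewrite invf_le1// ler1n.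
  apply: le_trans (phir_ge delta0 (x0 n)).
  by rewrite lerBrDr [c0 * _]mulrC -ler_pdivrMr.
Unshelve. all: by end_near. Qed.

End capped_phi.

Section truncated_norm.
Context d (T : measurableType d) (R : realType) (P : probability T R).
Local Notation E f := (Rintegral P setT f).
Local Notation pint := (intg P setT).
Variable X : T -> R.
Hypothesis mX : measurable_fun setT X.

Definition tnorm n : R := Num.sqrt (E (fun w => trunc n%:R X w ^+ 2)).

Let mt n : measurable_fun setT (trunc n%:R X). Proof. exact: measurable_trunc. Qed.

Lemma trunc_L2 n : L2 P (trunc n%:R X).
Proof. by apply: (@L2_bounded _ _ _ _ _ n%:R) => // w; exact: trunc_le. Qed.

Let cvsq w : (fun n => trunc n%:R X w ^+ 2) @ \oo --> X w ^+ 2.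
Proof. by rewrite expr2; under eq_fun do rewrite expr2; apply: cvgM; exact: trunc_cvg. Qed.

Lemma tnorm_le n : ((tnorm n)%:E <= norm P 2 X)%E.
Proof.
have [h|] := ltP (norm P 2 X) +oo%E; last by rewrite leye_eq => /eqP ->; exact: leey.
have X2 := norm2_lty mX h; rewrite norm2E// lee_fin; apply: ler_wsqrtr.
apply: Int_le => //; [exact: (trunc_L2 n).2|exact: X2.2|move=> w _].
by rewrite -[leLHS]real_normK ?num_real// -[leRHS]real_normK ?num_real// ler_sqr ?nnegrE// trunc_le_norm.
Qed.

Lemma tnorm_mono m n : (m <= n)%N -> tnorm m <= tnorm n.
Proof.
move=> mn; apply: ler_wsqrtr; apply: Int_le => //; [exact: (trunc_L2 m).2|exact: (trunc_L2 n).2|].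
move=> w _; rewrite /trunc; have [h|_] := leP `|X w| m%:R; last by rewrite expr0n/= sqr_ge0.
by rewrite ifT// (le_trans h)// ler_nat.
Qed.

(** Convergence is in the extended reals, since at this stage nothing excludes that Y(t) has
    infinite L^2 norm; in that case Fatou shows that the truncated norms are unbounded. *)
Lemma tnorm_cvg : (fun n => (tnorm n)%:E) @ \oo --> norm P 2 X.
Proof.
have [h|] := ltP (norm P 2 X) +oo%E.
  have X2 := norm2_lty mX h; rewrite norm2E//; apply: cvg_EFin; first exact: nearW.
  have := @Int_dominated _ _ _ P setT measurableT (fun n w => trunc n%:R X w ^+ 2)
    (fun w => X w ^+ 2) (fun w => X w ^+ 2) _ _ _ X2.2 _; case.
  - by move=> n; exact: meas_sq.
  - exact: meas_sq.
  - by apply/aeW => w _; exact: cvsq.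
  - move=> n; apply/aeW => w _; rewrite ger0_norm ?sqr_ge0//.
    by rewrite -[leLHS]real_normK ?num_real// -[leRHS]real_normK ?num_real// ler_sqr ?nnegrE// trunc_le_norm.
  move=> _ _ cv; exact: (cvg_comp _ _ cv (@sqrt_continuous R _)).
rewrite leye_eq => /eqP Xoo; rewrite Xoo; apply/cvgeryP/cvgryPge => A.
have [bd|/existsNP[n0 /negP]] := pselect (forall n, tnorm n <= A); last first.
  rewrite -ltNge => An0; near=> n; apply: le_trans (ltW An0) _; apply: tnorm_mono.
  near: n; exact: nbhs_infty_ge.
exfalso; have A0 : 0 <= A by apply: le_trans (bd 0%N); exact: sqrtr_ge0.
have le : (\int[P]_w (X w ^+ 2)%:E <= (A ^+ 2)%:E)%E.
  apply: (@Int_fatou _ _ _ P setT measurableT (fun n w => trunc n%:R X w ^+ 2)).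
  - by move=> n; exact: meas_sq.
  - exact: meas_sq.
  - by move=> n w _; exact: sqr_ge0.
  - by apply/aeW => w _; exact: cvsq.
  - move=> n; rewrite (intgE measurableT (trunc_L2 n).2) lee_fin.
    by rewrite -[leLHS]sqr_sqrtr ?E_sq_ge0// ler_sqr ?nnegrE ?sqrtr_ge0//; exact: bd.
have X2 : L2 P X.
  split => //; apply: intg_ge0; [exact: meas_sq|by move=> w _; exact: sqr_ge0|].
  by apply: le_lt_trans le _; exact: ltry.
by move: Xoo; rewrite norm2E.
Unshelve. all: by end_near. Qed.

End truncated_norm.

(** * The first variation along truncated optimal directions *)

Section strong_duality.
Context d (T : measurableType d) (R : realType) (P : probability T R).
Variables (B : R -> T -> R).
Hypotheses (P_complete : measure_is_complete P) (BM : standard_brownian_motion P B).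
Local Notation mu := (@lebesgue_measure R).
Local Notation E f := (Rintegral P setT f).
Local Notation pint := (intg P setT).
Local Notation F := (filtration P B).
Local Notation c0 := (@c0 R).
Variables (p q delta : R).
Hypotheses (p2 : 2 <= p) (q1 : 1 < q) (pq : p^-1 + q^-1 = 1) (delta0 : 0 <= delta).
Let p1 : 1 < p. Proof. by apply: lt_le_trans p2; rewrite ltr1n. Qed.
Let p0 : 0 < p. Proof. exact: lt_trans p1. Qed.
Let q0 : 0 < q. Proof. exact: lt_trans q1. Qed.
Let t11 : 0 <= (1:R) <= (1:R). Proof. by rewrite ler01 lexx. Qed.
Let mI : @measurable _ (measurableTypeR R) `[0, 1 : R]%classic.
Proof. exact: measurable_itv. Qed.

(** The counterpart of [pairing_integral] for use before the norm of Y(t) is known to be integrable: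
    for a bounded control, [Y] in L^1 is enough for Fubini. *)
Lemma bounded_control (Y : T -> R) (Yt : R -> T -> R) beta K : pint Y ->
  martingale_version P B Y Yt -> control P B beta -> 0 <= K ->
  (forall s w, `|beta s w| <= K) ->
  admissible P B p beta /\
  intg mu `[0, 1] (fun t => E (fun w => beta t w * Yt t w)) /\
  E (fun w => Rintegral mu `[0, 1] (fun s => beta s w) * Y w) =
  Rintegral mu `[0, 1] (fun t => E (fun w => beta t w * Yt t w)).
Proof.
move=> Yi YtY cb K0 bK; have jb := jmeas_prog P_complete BM cb.1.
have ms s : 0 <= s <= 1 -> measurable_fun setT (beta s).
  by move=> /andP[s0 s1]; exact: (jmeas_section jb s0 s1).
have pw w : intg mu `[0, 1] (fun s => beta s w).
  apply: (@intg_le _ _ _ mu _ mI (fun=> K)); [exact: jmeas_section2 jb|by move=> s _|].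
  exact: intg_lebesgue_cst.
have Ap : Lp P p (fun w => Rintegral mu `[0, 1] (fun s => beta s w)).
  apply: (@Lp_bounded _ _ _ _ _ _ K); [exact: ltW|exact: jmeas_Rintegral jb|move=> w].
  apply: le_trans (Int_norm mI (pw w)) _.
  rewrite -[leRHS]mulr1 -(@Rintegral_lebesgue_cst R 1 K)//.
  by apply: (Int_le mI (intg_abs mI (pw w))) => //; exact: intg_lebesgue_cst.
split; first by split => //; exact: (LpD (ltW p0) Ap (bm_Lp BM (ltW p0) ler01 (lexx 1))).
have jY : jmeas 1 (fun _ : R => Y) by apply: jmeas_rv; exact: intg_meas Yi.
have ij s : 0 <= s <= 1 -> pint (fun w => beta s w * Y w).
  move=> s01; under eq_fun do rewrite mulrC.
  by apply: (intg_bounded measurableT Yi (ms s s01)) => w _; exact: bK.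
have fin : (\int[mu]_(s in `[0%R, 1%R]) \int[P]_w (`|beta s w * Y w|)%:E < +oo)%E.
  apply: (@strip_bound _ _ _ _ 1 _ (K * E (fun w => `|Y w|))) => //; first exact: jmeasM.
  apply/aeW => s s01; split; first exact: ij.
  rewrite -IntZ//; last exact: intg_abs.
  apply: Int_le => //; [by apply: intg_abs => //; exact: ij|by apply: intgZ => //; exact: intg_abs|].
  by move=> w _; rewrite normrM; apply: ler_wpM2r.
have [_ _ _ i2 e] := fubini_Rint (jmeasM jb jY) fin.
have eq s : `[0, 1 : R]%classic s -> E (fun w => beta s w * Y w) = E (fun w => beta s w * Yt s w).
  rewrite /= in_itv/= => s01; under eq_Rintegral do rewrite mulrC; under [RHS]eq_Rintegral do rewrite mulrC.
  apply/esym; apply: (condexp_pull_out_bounded (sub_sigma_F P_complete BM s01) Yi (YtY.2 _ s01) _ (bK s)).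
  exact: gmeas_prog cb.1 s01.
split.
  by apply: (intg_eq mI _ i2) => s; rewrite inE => /eq.
transitivity (E (fun w => Rintegral mu `[0, 1] (fun s => beta s w * Y w))).
  by apply: eq_Rintegral => w _; rewrite RintegralZr//; exact: pw.
by rewrite e; apply: eq_Rintegral => s; rewrite inE => /eq.
Qed.

Variable alpha : R -> T -> R.
Hypothesis aa : admissible P B p alpha.
Hypothesis opt : forall beta, admissible P B p beta -> cost P B p delta alpha <= cost P B p delta beta.
Local Notation X := (state B alpha 1).
Local Notation Y := (dualn P p X).
Variable Yt : R -> T -> R.
Hypothesis YtY : martingale_version P B Y Yt.

Let y_ n t := tnorm P (Yt t) n.
(** This is best(x)/x away from 0. Together with the truncation of Y(t) the cut-off makes the
    control [beta_] bounded, and its L^2 norm is best(x) <= c_0 or 0. The inverse is written as a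
    real power, whose measurability is at hand. *)
Let lam n (x : R) : R := if n.+1%:R^-1 <= x then best delta x * x `^ (-1) else 0.
Let beta_ n : R -> T -> R := fun t w => - lam n (y_ n t) * trunc n%:R (Yt t) w.

Let mlam n : measurable_fun setT (lam n).
Proof.
apply: measurable_fun_ifT; [exact: measurable_fun_ler| |exact: measurable_cst].
by apply: measurable_funM; [exact: measurable_best|exact: measurable_powR].
Qed.

Let my n : measurable_fun `[0, 1 : R] (y_ n).
Proof.
have ms : measurable_fun setT (@Num.sqrt R) by apply: continuous_measurable_fun; exact: sqrt_continuous.
apply: (measurableT_comp ms); apply: jmeas_expectation; apply: measurable_funX.
apply: measurable_trunc; first exact: measurable_strip.
exact: (jmeas_prog P_complete BM YtY.1).
Qed.

Let lam_bound n x : 0 <= x -> 0 <= lam n x /\ lam n x <= c0 * n.+1%:R.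
Proof.
move=> x0; rewrite /lam; have cp := c0_gt0 R; case: ifPn => h; last by rewrite lexx mulr_ge0// ltW.
rewrite powR_inv1//; have x1 : 0 < x by apply: lt_le_trans h; rewrite invr_gt0.
split; first by rewrite mulr_ge0 ?best_ge0 ?invr_ge0.
apply: ler_pM; rewrite ?best_ge0 ?invr_ge0 ?best_le//.
by rewrite -[leRHS]invrK lef_pV2 ?posrE ?invr_gt0.
Qed.

Let beta_bound n s w : `|beta_ n s w| <= c0 * n.+1%:R * n%:R.
Proof.
have [l0 l1] := lam_bound n (sqrtr_ge0 _ : 0 <= y_ n s).
rewrite /beta_ normrM normrN (ger0_norm l0); apply: ler_pM => //; exact: trunc_le.
Qed.

Let mYt s : 0 <= s <= 1 -> measurable_fun setT (Yt s).
Proof. by move=> s01; exact: (mart_meas P_complete BM YtY s01). Qed.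

Let sq_y n s : 0 <= s <= 1 -> E (fun w => trunc n%:R (Yt s) w ^+ 2) = y_ n s ^+ 2.
Proof. by move=> s01; rewrite sqr_sqrtr// E_sq_ge0. Qed.

Let lam_y n s : lam n (y_ n s) * y_ n s = if n.+1%:R^-1 <= y_ n s then best delta (y_ n s) else 0.
Proof.
rewrite /lam; case: ifPn => [h|_]; last by rewrite mul0r.
have x1 : 0 < y_ n s by apply: lt_le_trans h; rewrite invr_gt0.
by rewrite powR_inv1 ?(ltW x1)// divfK// gt_eqF.
Qed.

Let beta_sq n s : 0 <= s <= 1 -> L2 P (beta_ n s) /\
  E (fun w => beta_ n s w ^+ 2) = (lam n (y_ n s) * y_ n s) ^+ 2.
Proof.
move=> s01; have t2 := trunc_L2 P (mYt s01) n; split; first exact: L2Z.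
rewrite /beta_; under eq_Rintegral do rewrite exprMn sqrrN.
by rewrite (IntZ measurableT _ t2.2) sq_y// exprMn.
Qed.

Let beta_pair n s : 0 <= s <= 1 ->
  E (fun w => beta_ n s w * Yt s w) = - (lam n (y_ n s) * y_ n s) * y_ n s.
Proof.
move=> s01; have t2 := trunc_L2 P (mYt s01) n.
rewrite -mulNr -mulrA -expr2 -sq_y// -(IntZ measurableT _ t2.2).
apply: eq_Rintegral => w _; rewrite /beta_ -mulrA /trunc; case: ifP => _; first by rewrite expr2.
by rewrite mul0r expr0n.
Qed.

Let beta_control n : control P B (beta_ n).
Proof.
apply: control_intro.
  move=> t t01; apply: measurable_funM.
    apply: measurableT_comp => //; apply: (measurableT_comp (mlam n)).
    have mt : measurable_fun `[0, t] (y_ n).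
      apply: measurable_funS (my n) => //.
      move=> s /=; rewrite !in_itv/= => /andP[s0 st]; apply/andP; split=> //.
      exact: le_trans st (andP t01).2.
    have mD : measurable (`[0, t]%classic `*` setT : set (R * g_sigma_algebraType (F t))).
      by apply: measurableX => //; exact: measurable_itv.
    apply: (measurable_comp _ _ mt) => //; first by move=> _ [z [zs _] <-].
    by apply: measurable_funTS; exact: measurable_fst.
  apply: measurable_trunc; last exact: YtY.1.
  by apply: measurableX => //; exact: measurable_itv.
apply/aeW => s s01; have [b2 ->] := beta_sq n s01; split => //.
have cp := c0_gt0 R; rewrite lam_y; case: ifP => _; last by rewrite expr0n/= sqr_ge0.
by rewrite ler_sqr ?nnegrE ?best_le ?best_ge0 ?sqrtr_ge0// ltW.
Qed.

(** For the control [beta_ n] the sum of its pairing with Y(t) and its energy term is -psi, so the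
    first variation says that the integral of psi is at most E[Y B(1)] - cost. Fatou passes this
    bound to [phi], and thereby shows that its integral is finite. *)
Lemma strong_duality : ((cost P B p delta alpha)%:E <= dual_gain P B delta Y)%E.
Proof.
have N0 : 0 < pnorm P p X by apply: (pnorm_gt0 P_complete BM); [exact: aa.1|exact: aa.2].
have [Yq Y1 YN] := dualn_spec p1 q1 pq aa.2 N0.
have Yi : pint Y := Lp_pint (ltW q1) Yq.
have b1p := bm_Lp BM (ltW p0) ler01 (lexx 1).
have iB : pint (fun w => Y w * B 1 w).
  by under eq_fun do rewrite mulrC; exact: Lp_mul pq b1p Yq.
have iX := Lp_mul p0 q0 pq aa.2 Yq.
pose C := E (fun w => Y w * B 1 w) - cost P B p delta alpha.
have K0 n : 0 <= c0 * n.+1%:R * n%:R by rewrite !mulr_ge0// ltW// c0_gt0.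
have psiE n s : 0 <= s <= 1 -> psi delta n (y_ n s) =
    - (E (fun w => beta_ n s w * Yt s w) + delta / 2 * E (fun w => beta_ n s w ^+ 2)).
  move=> s01; rewrite beta_pair// (beta_sq n s01).2 lam_y /psi; case: ifP => _; first by rewrite /phir; ring.
  by rewrite oppr0 mul0r expr0n/= mulr0 addr0 oppr0.
have psi_int n : intg mu `[0, 1] (fun s => psi delta n (y_ n s)) /\
    Rintegral mu `[0, 1] (fun s => psi delta n (y_ n s)) <= C.
  have [ba [i1 e1]] := bounded_control Yi YtY (beta_control n) (K0 n) (beta_bound n).
  have [i2 _ _ _] := control_energy P_complete BM (beta_control n).
  have i3 := intgD mI i1 (intgZ mI (delta / 2) i2).
  split.
    apply: (intg_eq mI _ (intgN mI i3)) => s; rewrite inE/= in_itv/= => s01.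
    by rewrite psiE.
  rewrite (_ : Rintegral _ _ _ = - (Rintegral mu `[0, 1] (fun s => E (fun w => beta_ n s w * Yt s w)) +
      delta / 2 * energy P (beta_ n))); last first.
    rewrite -(IntZ mI _ i2) -(IntD mI i1 (intgZ mI _ i2)) -(IntN mI i3).
    by apply: eq_Rintegral => s; rewrite inE/= in_itv/= => s01; rewrite psiE.
  have := first_variation P_complete BM p2 q1 pq delta0 aa opt ba.
  have Ap := terminal_Lp BM p2 ba.2.
  have iA := Lp_mul p0 q0 pq Ap Yq.
  have -> : E (fun w => (state B (beta_ n) 1 w - X w) * Y w) =
      E (fun w => Rintegral mu `[0, 1] (fun s => beta_ n s w) * Y w) +
      E (fun w => Y w * B 1 w) - E (fun w => X w * Y w).
    rewrite -IntD// -IntB//; last exact: intgD.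
    by apply: eq_Rintegral => w _; rewrite {1}/state; ring.
  rewrite YN e1 /C /cost; lra.
rewrite (dual_gainE P_complete BM delta p2 q1 pq Yq YtY).
have le : (\int[mu]_(t in `[0%R, 1%R]) phi delta (norm P 2 (Yt t)) <= C%:E)%E.
  have mpsi n : measurable_fun `[0, 1 : R] (fun s => (psi delta n (y_ n s))%:E).
    exact: measurable_int (psi_int n).1.
  have lim s : 0 <= s <= 1 -> limn_einf (fun n => (psi delta n (y_ n s))%:E) = phi delta (norm P 2 (Yt s)).
    move=> s01; apply: (cvg_limn_einf_sup _).1; apply: psi_cvg => //.
    - by move=> n; exact: sqrtr_ge0.
    - by move=> n; apply: tnorm_le; exact: mYt.
    - by apply: tnorm_cvg; exact: mYt.
  have -> : (\int[mu]_(t in `[0%R, 1%R]) phi delta (norm P 2 (Yt t)) =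
      \int[mu]_(t in `[0%R, 1%R]) limn_einf (fun n => (psi delta n (y_ n t))%:E))%E.
    by apply: eq_integral => s; rewrite inE/= in_itv/= => s01; rewrite lim.
  apply: le_trans (fatou mu mI mpsi _) _.
    move=> n s _; rewrite lee_fin /psi; case: ifP => // _; apply: phir_ge0 => //; exact: sqrtr_ge0.
  rewrite limn_einf_lim; apply: lime_le; first exact: is_cvg_einfs.
  apply: nearW => n; apply: (@le_trans _ _ (\int[mu]_(s in `[0%R, 1%R]) (psi delta n (y_ n s))%:E)%E).
    by apply: ereal_inf_lbound; exists n => //=.
  by rewrite (intgE mI (psi_int n).1) lee_fin; exact: (psi_int n).2.
have -> : cost P B p delta alpha = E (fun w => Y w * B 1 w) - C by rewrite /C opprB addrC subrK.
by rewrite EFinB; apply: leeB.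
Qed.

End strong_duality.

(** * Positivity of the dual martingale *)

Section increments_conditioning.
Context d (T : measurableType d) (R : realType) (P : probability T R).
Variables (B : R -> T -> R).
Hypotheses (P_complete : measure_is_complete P) (BM : standard_brownian_motion P B).
Local Notation E f := (Rintegral P setT f).
Local Notation pint := (intg P setT).
Local Notation F := (filtration P B).
Local Notation inc := (incr_algebra B).

Definition join_gen (H : set (set T)) t : set (set T) :=
  [set D | exists2 A, H A & exists2 C, inc t 1 C & D = A `&` C].

Lemma join_left H t : H `<=` <<s join_gen H t >>.
Proof.
move=> A hA; apply: sub_sigma_algebra; exists A => //; exists setT; last by rewrite setIT.
exact: (@measurableT _ (g_sigma_algebraType _)).
Qed.

Lemma join_right H t : sub_sigma H -> inc t 1 `<=` <<s join_gen H t >>.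
Proof.
move=> sH C hC; apply: sub_sigma_algebra; exists setT; last by exists C => //; rewrite setTI.
exact: sub_sigmaT.
Qed.

Lemma join_sub_sigma H t : 0 <= t -> sub_sigma H -> sub_sigma <<s join_gen H t >>.
Proof.
move=> t0 sH; apply: sub_sigma_gen => _ [A hA [C hC ->]].
apply: measurableI; first exact: sH.2.
exact: (sub_sigma_incr BM t0 (lexx 1)).2.
Qed.

(** The argument of [condexp_skip_indic] for an arbitrary sub-sigma-algebra [H] of F(t) in place of
    F(s); it is needed for the increments between s and t. *)
Lemma condexp_join_indic H t A W : 0 <= t <= 1 -> sub_sigma H -> H `<=` F t -> F t A ->
  is_condexp P H \1_A W -> is_condexp P <<s join_gen H t >> \1_A W.
Proof.
move=> t01 sH HF FA AW; have /andP[t0 t1] := t01.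
have tF := sub_sigma_F P_complete BM t01.
have sK := join_sub_sigma t0 sH.
have mA := tF.2 _ FA; have iA := pint_indic P mA.
have [mW Wi hW] := (is_condexpP W sH iA).1 AW.
apply: condexp_pi => //.
- move=> _ _ [A1 hA [C hC ->]] [A' hA' [C' hC' ->]].
  exists (A1 `&` A'); first exact: sub_sigmaI.
  by exists (C `&` C'); [exact: (@measurableI _ (g_sigma_algebraType _))|rewrite setIACA].
- by move=> D hD; apply: sK.2; exact: sub_sigma_algebra.
- exact: gmeas_sub (@join_left H t) mW.
- exact: condexp_mean AW.
move=> _ [A' hA' [C hC ->]].
have mA' := sH.2 _ hA'; have mC : measurable C by apply: sK.2; exact: join_right hC.
have iC := pint_indic P mC.
have gC : gmeas (inc t 1) (\1_C : T -> R) by apply: gmeas_indic => //; exact: (sub_sigma_incr BM t0 (lexx 1)).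
have split_C (X : T -> R) : gmeas (F t) X -> pint X ->
    E (fun w => X w * \1_(A' `&` C) w) = E \1_C * E (fun w => X w * \1_A' w).
  move=> mX Xi; have XAi := intg_indic Xi mA'.
  rewrite -(E_indep P_complete BM t01 gC iC)//.
  - by apply: eq_Rintegral => w _; rewrite !indicE in_setI; case: (w \in A'); case: (w \in C); rewrite /= ?mulr1 ?mulr0 ?mul1r ?mul0r.
  - by apply: measurable_funM => //; apply: gmeas_indic => //; exact: HF.
  - by have := intg_indic XAi mC; apply: intg_eq => // w _; rewrite mulrC.
rewrite !split_C ?hW//; first exact: gmeas_indic.
exact: gmeas_sub HF mW.
Qed.

Lemma inc_join s t : 0 <= s -> s <= t -> t <= 1 -> inc s 1 `<=` <<s join_gen (inc s t) t >>.
Proof.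
move=> s0 st t1; have t0 := le_trans s0 st; have sH := sub_sigma_incr BM s0 t1.
have sK := join_sub_sigma t0 sH.
have m1 : gmeas <<s join_gen (inc s t) t >> (B t \- B s).
  by apply: gmeas_sub (@join_left (inc s t) t) _ => //; apply: (gmeas_incr BM) => //; rewrite st lexx.
apply: smallest_sub; first exact: smallest_sigma_algebra.
move=> _ [r [U [/andP[sr r1] mU ->]]].
have [rt|tr] := leP r t.
  by apply: join_left; apply: sub_sigma_algebra; exists r, U; split => //; rewrite sr.
have m2 : gmeas <<s join_gen (inc s t) t >> (B r \- B t).
  have gr : gmeas (inc t 1) (B r \- B t) by apply: (gmeas_incr BM) => //; rewrite r1 ltW.
  have sT := sub_sigma_incr BM t0 (lexx 1).
  exact: gmeas_sub (join_right sH) gr.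
have m3 : gmeas <<s join_gen (inc s t) t >> (B r \- B s).
  rewrite (_ : B r \- B s = (B t \- B s) \+ (B r \- B t)); first exact: measurable_funD.
  by apply/funext => w /=; ring.
by have := m3 measurableT U mU; rewrite setTI (gmeas_measE _ sK).
Qed.

Lemma condexp_inc_indic s t A W : 0 <= s -> s <= t -> t <= 1 -> F t A ->
  is_condexp P (inc s t) \1_A W -> is_condexp P (inc s 1) \1_A W.
Proof.
move=> s0 st t1 FA AW; have t0 := le_trans s0 st; have t01 : 0 <= t <= 1 by rewrite t0.
have sH := sub_sigma_incr BM s0 t1; have sG := sub_sigma_incr BM s0 (lexx 1).
have mA := (sub_sigma_F P_complete BM t01).2 _ FA; have iA := pint_indic P mA.
have HF : inc s t `<=` F t by move=> D /(incr_algebra_history BM s0 t1 st) hD; exact: history_F.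
have K := condexp_join_indic t01 sH HF FA AW.
have [_ Wi hW] := (is_condexpP W (join_sub_sigma t0 sH) iA).1 K.
have [mW _ _] := (is_condexpP W sH iA).1 AW.
apply/(is_condexpP W sG iA); split => //; first exact: gmeas_sub (incr_algebra_le t1) mW.
by move=> D hD; apply: hW; exact: inc_join hD.
Qed.

(** Conditioning on the increments after s commutes with conditioning on F(t). For A in F(t), the
    variable W = E[1_A | increments on (s,t)] also equals E[1_A | increments on (s,1)], so that
    E[V 1_A] = E[V W] = E[Yt W] = E[Y W] = E[Y0 W] = E[Y0 1_A]. *)
Lemma condexp_commute p q s t (Y Y0 Yt V : T -> R) : 1 < p -> 1 < q -> p^-1 + q^-1 = 1 ->
  0 <= s -> s <= t -> t <= 1 -> Lp P q Y ->
  is_condexp P (inc s 1) Y Y0 -> is_condexp P (F t) Y Yt -> is_condexp P (inc s t) Yt V ->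
  is_condexp P (F t) Y0 V.
Proof.
move=> p1 q1 pq s0 st t1 Yq YY0 YYt YtV; have t0 := le_trans s0 st.
have t01 : 0 <= t <= 1 by rewrite t0.
have p0 : 0 < p by exact: lt_trans p1.
have q0 : 0 < q by exact: lt_trans q1.
have sH := sub_sigma_incr BM s0 t1; have sG := sub_sigma_incr BM s0 (lexx 1).
have sF := sub_sigma_F P_complete BM t01.
have [Y0q _] := condexp_Lp sG q1 Yq YY0; have [Ytq _] := condexp_Lp sF q1 Yq YYt.
have [Vq _] := condexp_Lp sH q1 Ytq YtV.
have li Z : Lp P q Z -> pint Z := fun h => Lp_pint (ltW q1) h.
have HF : inc s t `<=` F t by move=> D /(incr_algebra_history BM s0 t1 st) hD; exact: history_F.
have [mV _ _] := YtV; have [mY0 _ _] := YY0.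
apply/(is_condexpP V sF (li _ Y0q)); split; [exact: gmeas_sub HF mV|exact: li|move=> A FA].
have mA := sF.2 _ FA; have iA := pint_indic P mA.
have Ap : Lp P p (\1_A : T -> R).
  apply: (@Lp_bounded _ _ _ _ _ _ 1); [exact: ltW|exact: measurable_indic|].
  by move=> w; rewrite indicE; case: (_ \in _); rewrite ?normr1 ?normr0.
have [W AW] := condexp_exists sH iA.
have [Wp _] := condexp_Lp sH p1 Ap AW.
have AW1 := condexp_inc_indic s0 st t1 FA AW.
have [mW _ _] := AW; have [mW1 _ _] := AW1.
have pr Z : Lp P q Z -> pint (fun w => Z w * \1_A w) /\ pint (fun w => Z w * W w).
  move=> Zq; split; under eq_fun do rewrite mulrC; first exact: Lp_mul pq Ap Zq.
  exact: Lp_mul pq Wp Zq.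
have comm (Z X : T -> R) : E (fun w => Z w * X w) = E (fun w => X w * Z w).
  by apply: eq_Rintegral => w _; rewrite mulrC.
have pr' Z : Lp P q Z -> pint (fun w => \1_A w * Z w) /\ pint (fun w => W w * Z w).
  by move=> Zq; split; [exact: Lp_mul pq Ap Zq|exact: Lp_mul pq Wp Zq].
transitivity (E (fun w => V w * W w)).
  rewrite comm [RHS]comm; apply/esym.
  exact: (condexp_pull_out sH iA AW mV (pr' _ Vq).1 (pr' _ Vq).2).
transitivity (E (fun w => Yt w * W w)).
  exact: (condexp_pull_out sH (li _ Ytq) YtV mW (pr _ Ytq).2 (pr _ Vq).2).
transitivity (E (fun w => Y w * W w)).
  have mWF : gmeas (F t) W by exact: gmeas_sub HF mW.
  exact: (condexp_pull_out sF (li _ Yq) YYt mWF (pr _ Yq).2 (pr _ Ytq).2).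
transitivity (E (fun w => Y0 w * W w)).
  by apply/esym; exact: (condexp_pull_out sG (li _ Yq) YY0 mW1 (pr _ Yq).2 (pr _ Y0q).2).
rewrite comm [RHS]comm.
exact: (condexp_pull_out sG iA AW1 mY0 (pr' _ Y0q).1 (pr' _ Y0q).2).
Qed.

End increments_conditioning.

(** Moduli are compared through the strictly increasing power p - 1; this is what carries an
    identity between dual variables back to the terminal states. *)
Lemma dualf_inj (R : realType) (p x z : R) : 2 <= p -> dualf p x = dualf p z -> x = z.
Proof.
move=> p2 e; have p1 : 1 < p by apply: lt_le_trans p2; rewrite ltr1n.
have p10 : 0 < p - 1 by rewrite subr_gt0.
have n : `|x| = `|z|.
  have := congr1 Num.norm e; rewrite !norm_dualf// => h.
  apply/eqP; rewrite eq_le !leNgt; apply/andP; split; apply/negP => lt.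
    by have := gt0_ltr_powR p10 (normr_ge0 _ : `|z| \in Num.nneg) (normr_ge0 _ : `|x| \in Num.nneg) lt; rewrite h ltxx.
  by have := gt0_ltr_powR p10 (normr_ge0 _ : `|x| \in Num.nneg) (normr_ge0 _ : `|z| \in Num.nneg) lt; rewrite h ltxx.
have [x0|x0] := eqVneq x 0.
  by move: n; rewrite x0 normr0 => /esym/eqP; rewrite normr_eq0 => /eqP ->.
have c0 : `|x| `^ (p - 2) != 0 by rewrite gt_eqF// powR_gt0// normr_gt0.
by move: e; rewrite /dualf -n => /(mulIf c0).
Qed.

Section positivity.
Context d (T : measurableType d) (R : realType) (P : probability T R).
Variables (B : R -> T -> R).
Hypotheses (P_complete : measure_is_complete P) (BM : standard_brownian_motion P B).
Local Notation mu := (@lebesgue_measure R).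
Local Notation E f := (Rintegral P setT f).
Local Notation pint := (intg P setT).
Local Notation F := (filtration P B).
Local Notation inc := (incr_algebra B).
Variables (p q delta : R).
Hypotheses (p2 : 2 <= p) (q1 : 1 < q) (pq : p^-1 + q^-1 = 1) (delta0 : 0 <= delta).
Let p1 : 1 < p. Proof. by apply: lt_le_trans p2; rewrite ltr1n. Qed.
Let p0 : 0 < p. Proof. exact: lt_trans p1. Qed.
Let q0 : 0 < q. Proof. exact: lt_trans q1. Qed.
Let t11 : 0 <= (1:R) <= (1:R). Proof. by rewrite ler01 lexx. Qed.
Let mI : @measurable _ (measurableTypeR R) `[0, 1 : R]%classic.
Proof. exact: measurable_itv. Qed.

Variable alpha : R -> T -> R.
Hypothesis aa : admissible P B p alpha.
Local Notation X := (state B alpha 1).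
Local Notation Y := (dualn P p X).
Variable Yt : R -> T -> R.
Hypothesis YtY : martingale_version P B Y Yt.
Hypothesis opt : (primal_cost P B delta p alpha <= dual_gain P B delta Y)%E.

Let ca : control P B alpha. Proof. exact: aa.1. Qed.
Let Xp : Lp P p X. Proof. exact: aa.2. Qed.
Let N0 : 0 < pnorm P p X. Proof. by apply: (pnorm_gt0 P_complete BM); [exact: ca|exact: Xp]. Qed.
Let Yq : Lp P q Y. Proof. by have [] := dualn_spec p1 q1 pq Xp N0. Qed.
Let Y1 : E (fun w => `|Y w| `^ q) <= 1. Proof. by have [_ ->] := dualn_spec p1 q1 pq Xp N0. Qed.
Let YN : E (fun w => X w * Y w) = pnorm P p X. Proof. by have [_ _] := dualn_spec p1 q1 pq Xp N0. Qed.
Let Yi : pint Y. Proof. exact: Lp_pint (ltW q1) Yq. Qed.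
Let fin : (\int[mu]_(t in `[0%R, 1%R]) norm P 2 (Yt t) < +oo)%E.
Proof.
apply: (gain_fin P_complete BM p2 q1 pq delta0 Yq YtY).
by apply/negP => /eqP e; move: opt; rewrite e (costE P_complete BM delta p2 ca Xp).
Qed.
Let mY t : 0 <= t <= 1 -> measurable_fun setT (Yt t).
Proof. by move=> t01; exact: (mart_meas P_complete BM YtY t01). Qed.

Lemma norm2_eq0 (Z : T -> R) : measurable_fun setT Z -> norm P 2 Z = 0%E <-> {ae P, forall w, Z w = 0}.
Proof.
move=> mZ; split=> [h|h].
  have Z2 : L2 P Z by apply: norm2_lty => //; rewrite h ltry.
  move: h; rewrite norm2E// => -[/eqP]; rewrite sqrtr_eq0 => le0.
  have := Int_eq0_ae measurableT Z2.2 _ le0 => h.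
  have sq : {ae P, forall w, [set: T] w -> 0 <= Z w ^+ 2} by apply/aeW => w _; exact: sqr_ge0.
  by apply: ae_imply (h sq) => w /(_ I)/eqP; rewrite sqrf_eq0 => /eqP.
have z2 : L2 P (fun _ : T => 0 : R).
  apply: (@L2_bounded _ _ _ _ _ 0); first exact: measurable_cst.
  by move=> w; rewrite normr0.
have -> : norm P 2 Z = norm P 2 (fun _ : T => 0 : R) by apply: norm_ae => //; exact: z2.1.
by rewrite norm2E// expr0n/= (E_cst P 0) sqrtr0.
Qed.

(** * Excluding a last zero of the dual martingale *)

Section degenerate_time.
Variable tau : R.
Hypotheses (tau0 : 0 < tau) (tau1 : tau <= 1) (Ytau : norm P 2 (Yt tau) = 0%E).
Hypothesis after : forall s, tau < s -> s < 1 -> 0 < mnorm P Yt s.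

Let tau01 : 0 <= tau <= 1. Proof. by rewrite ltW. Qed.
Let sF := sub_sigma_F P_complete BM tau01.
Let sG := sub_sigma_incr BM (ltW tau0) (lexx 1).
Let Ytau_ae : {ae P, forall w, Yt tau w = 0}. Proof. by apply/norm2_eq0 => //; exact: mY. Qed.
Let Ytau_p xi : measurable_fun setT xi -> E (fun w => Yt tau w * xi w) = 0.
Proof.
move=> mxi; rewrite -(E_cst P 0); apply: (Int_ae measurableT) => //.
  by apply: measurable_funM => //; exact: mY.
by apply: ae_imply Ytau_ae => w /= -> _; rewrite mul0r.
Qed.
Let EY : E Y = 0.
Proof.
rewrite -(condexp_mean sF Yi (YtY.2 _ tau01)) -(Ytau_p (@measurable_cst _ _ T R setT 1)).
by apply: eq_Rintegral => w _; rewrite mulr1.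
Qed.

Variables (Y0 : T -> R) (Y0t : R -> T -> R).
Hypotheses (YY0 : is_condexp P (inc tau 1) Y Y0) (Y0tY : martingale_version P B Y0 Y0t).

Let Y0q : Lp P q Y0. Proof. by have [] := condexp_Lp sG q1 Yq YY0. Qed.
Let Y01 : E (fun w => `|Y0 w| `^ q) <= 1.
Proof. by have [_ h] := condexp_Lp sG q1 Yq YY0; exact: le_trans h Y1. Qed.
Let Y0i : pint Y0. Proof. exact: Lp_pint (ltW q1) Y0q. Qed.
Let mY0 t : 0 <= t <= 1 -> measurable_fun setT (Y0t t).
Proof. by move=> t01; exact: (mart_meas P_complete BM Y0tY t01). Qed.
Let EY0 : E Y0 = 0. Proof. by rewrite (condexp_mean sG Yi YY0). Qed.
Let gY0 : gmeas (inc tau 1) Y0. Proof. by have [] := YY0. Qed.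

(** Up to tau, Y0 is independent of F(t) and centred, so its martingale vanishes. After tau,
    [condexp_commute] presents Y0(t) as a conditional expectation of Y(t), and the L^2 norm
    contracts. *)
Let norm_le t : 0 <= t <= 1 -> (norm P 2 (Y0t t) <= norm P 2 (Yt t))%E.
Proof.
move=> t01; have /andP[t0 t1] := t01; have sFt := sub_sigma_F P_complete BM t01.
have [tt|/ltW tt] := leP t tau.
  have h1 := condexp_indep P_complete BM tau01 gY0 Y0i.
  have h2 := (condexp_tower (Y0t t) sF sFt (F_le tt) h1).1 (Y0tY.2 _ t01).
  have h3 : is_condexp P (F t) (fun=> E Y0) (fun=> E Y0) by apply: condexp_id; [exact: measurable_cst|exact: pint_cst].
  have h4 := condexp_unique sFt (pint_cst P (E Y0)) h2 h3.
  rewrite ((norm2_eq0 (mY0 t01)).2 _); first exact: Lnorm_ge0.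
  by apply: ae_imply h4 => w ->; exact: EY0.
have sH := sub_sigma_incr BM (ltW tau0) t1.
have Yti : pint (Yt t) by have [] := YtY.2 _ t01.
have [V hV] := condexp_exists sH Yti.
have cV := condexp_commute P_complete BM p1 q1 pq (ltW tau0) tt t1 Yq YY0 (YtY.2 _ t01) hV.
have mV : measurable_fun setT V by apply: gmeas_meas sH _; have [] := hV.
rewrite (norm_ae 2 (mY0 t01) mV (condexp_unique sFt Y0i (Y0tY.2 _ t01) cV)).
have [h|] := ltP (norm P 2 (Yt t)) +oo%E; last by rewrite leye_eq => /eqP ->; exact: leey.
have Y2 := norm2_lty (mY t01) h; have [V2 le] := condexp_L2 sH Y2 hV.
by rewrite !norm2E// lee_fin ler_wsqrtr.
Qed.

Let fin0 : (\int[mu]_(t in `[0%R, 1%R]) norm P 2 (Y0t t) < +oo)%E.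
Proof.
apply: le_lt_trans fin; apply: ge0_le_integral => //.
- by move=> t _; exact: Lnorm_ge0.
- exact: (mart_norm_measurable P_complete BM Y0tY).
- exact: (mart_norm_measurable P_complete BM YtY).
Qed.

Let eta w := B 1 w - B tau w.
Let geta : gmeas (inc tau 1) eta.
Proof. by apply: (gmeas_incr BM (ltW tau0) (lexx 1)); rewrite tau1 lexx. Qed.
Let Bp t : 0 <= t <= 1 -> Lp P p (B t).
Proof. by move=> /andP[t0 t1]; exact: (bm_Lp BM (ltW p0) t0 t1). Qed.
Let etap : Lp P p eta. Proof. exact: LpB (ltW p0) (Bp t11) (Bp tau01). Qed.
Let gB : gmeas (F tau) (B tau). Proof. by apply: (gmeas_F P_complete BM tau01); rewrite (ltW tau0) lexx. Qed.
Let pr (Z W : T -> R) : Lp P q Z -> Lp P p W -> pint (fun w => Z w * W w).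
Proof. by move=> Zq Wp; under eq_fun do rewrite mulrC; exact: Lp_mul pq Wp Zq. Qed.

(** B(1) is split at tau. The later increment is measurable for the conditioning, so it pairs
    equally with both variables. B(tau) pairs to 0 with [Y] because Y(tau) = 0, and with [Y0] by
    independence and because B(tau) has mean 0. *)
Let pair_B1 : E (fun w => Y0 w * B 1 w) = E (fun w => Y w * B 1 w).
Proof.
have split (Z : T -> R) : Lp P q Z -> E (fun w => Z w * B 1 w) =
    E (fun w => Z w * eta w) + E (fun w => Z w * B tau w).
  move=> Zq; rewrite -IntD//; [|exact: pr|exact: pr (Bp tau01)].
  by apply: eq_Rintegral => w _; rewrite /eta; ring.
rewrite !split//; congr (_ + _); first exact: (condexp_pull_out sG Yi YY0 geta (pr Yq etap) (pr Y0q etap)).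
have Ytq : Lp P q (Yt tau) by have [] := mart_Lp P_complete BM q1 Yq YtY Y1 tau01.
rewrite -(condexp_pull_out sF Yi (YtY.2 _ tau01) gB (pr Yq (Bp tau01)) (pr Ytq (Bp tau01))).
rewrite Ytau_p; last exact: (Bp tau01).1.
rewrite (E_indep P_complete BM tau01 gY0 Y0i gB (Lp_pint (ltW p1) (Bp tau01)) (pr Y0q (Bp tau01))).
by rewrite (bm_mean BM (ltW tau0) tau1) mulr0.
Qed.

(** By [pair_B1] the linear terms agree; the time integral can only drop, because phi is
    nondecreasing and all norms have decreased. *)
Let gain_le : (dual_gain P B delta Y <= dual_gain P B delta Y0)%E.
Proof.
rewrite (gainE P_complete BM p2 q1 pq delta0 Yq YtY fin) (gainE P_complete BM p2 q1 pq delta0 Y0q Y0tY fin0).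
rewrite lee_fin pair_B1 lerD2l lerN2.
have i1 := phir_intg P_complete BM delta0 YtY fin; have i2 := phir_intg P_complete BM delta0 Y0tY fin0.
apply: (Int_le_ae mI i2 i1); apply: ae_imply (ae_lt1 R) => t h; rewrite /= in_itv/= => t01.
have t1 := h t01; have /andP[t0 _] := t01.
have a0 := mnorm_ge0 P Y0t t; have b0 := mnorm_ge0 P Yt t.
have le : mnorm P Y0t t <= mnorm P Yt t.
  rewrite -lee_fin -(mnormE P_complete BM Yi YtY fin t0 t1) -(mnormE P_complete BM Y0i Y0tY fin0 t0 t1).
  exact: norm_le.
have be := best_ge0 delta0 a0.
have := phir_max delta0 b0 (_ : `|best delta (mnorm P Y0t t)| <= c0 R); rewrite ger0_norm// best_le.
move=> /(_ isT); apply: le_trans; rewrite /phir lerD2r; exact: ler_wpM2l.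
Qed.

Let Y0E : {ae P, forall w, Y0 w = Y w}.
Proof.
exact: (optimal_dual P_complete BM p2 q1 pq delta0 Y0q Y0tY Y01 fin0 ca Xp (le_trans opt gain_le)).
Qed.

Variable Z : T -> R.
Hypothesis XZ : is_condexp P (inc tau 1) X Z.
Let Zp : Lp P p Z. Proof. by have [] := condexp_Lp sG p1 Xp XZ. Qed.
Let Xi : pint X. Proof. exact: Lp_pint (ltW p1) Xp. Qed.
Let Zi : pint Z. Proof. exact: Lp_pint (ltW p1) Zp. Qed.

(** Pairing [Z] with [Y0], which equals [Y] almost surely, gives |X|_p >= |Z|_p. Hence [Z] also
    attains equality in Hölder against [Y0], so [Z] and [X] have the same image under [dualf] and
    coincide. *)
Let ZX : {ae P, forall w, Z w = X w}.
Proof.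
have [_ le] := condexp_Lp sG p1 Xp XZ.
have e1 : E (fun w => Z w * Y0 w) = pnorm P p X.
  rewrite (condexp_pull_out sG Xi XZ gY0 (Lp_mul p0 q0 pq Xp Y0q) (Lp_mul p0 q0 pq Zp Y0q)) -YN.
  have i1 := Lp_mul p0 q0 pq Xp Y0q; have i2 := Lp_mul p0 q0 pq Xp Yq.
  by apply: (Int_ae measurableT (intg_meas i1) (intg_meas i2)); apply: ae_imply Y0E => w ->.
have nn (W : T -> R) : E (fun w => `|W w| `^ p) \in Num.nneg.
  by rewrite nnegrE; apply: Rintegral_ge0 => w _; exact: powR_ge0.
have ip0 : 0 <= p^-1 by rewrite invr_ge0; exact: ltW p0.
have NZ : pnorm P p Z <= pnorm P p X := ge0_ler_powR ip0 (nn Z) (nn X) le.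
have NZ' : E (fun w => Z w * Y0 w) <= pnorm P p Z by exact: (hoelder_unit p1 q0 pq Zp Y0q Y01).
rewrite e1 in NZ'.
have NE : pnorm P p Z = pnorm P p X by apply: le_anti; apply/andP; split; [exact: NZ|exact: NZ'].
have hZ := hoelder_unit_eq p1 q0 pq Zp Y0q Y01.
have {hZ} hZ : {ae P, forall w, Y0 w = dualf p (Z w) / pnorm P p Z `^ (p - 1)}.
  apply: hZ; first exact: lt_le_trans N0 NZ'.
  by rewrite e1; exact: NZ.
have c0 : (pnorm P p X `^ (p - 1))^-1 != 0 by apply: invr_neq0; apply: lt0r_neq0; exact: powR_gt0 N0.
rewrite NE in hZ; apply: ae_imply (ae_and hZ Y0E) => w [h1 h2].
by rewrite h1 in h2; exact: (dualf_inj p2 (mulIf c0 h2)).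
Qed.

Let xi := state B alpha tau.
Let A t w := Rintegral mu `[0, t] (fun s => alpha s w).
Let one2 (D : set T) : measurable D -> L2 P (\1_D : T -> R).
Proof.
move=> mD; apply: (@L2_bounded _ _ _ _ _ 1); first exact: measurable_indic.
by move=> w; rewrite indicE; case: (_ \in _); rewrite ?normr1 ?normr0.
Qed.
Let Ai t : 0 <= t <= 1 -> pint (A t).
Proof.
move=> t01; have [i _ _] := control_fubini P_complete BM ca t01 (one2 measurableT).
by apply: (intg_eq measurableT _ i) => w _; rewrite indicE in_setT mulr1.
Qed.
Let Bi t : 0 <= t <= 1 -> pint (B t). Proof. by move=> t01; exact: Lp_pint (ltW p1) (Bp t01). Qed.

Let A_indic D : F tau D -> E (fun w => A 1 w * \1_D w) = E (fun w => A tau w * \1_D w).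
Proof.
move=> FD; have mD := sF.2 _ FD; have D2 := one2 mD.
have [_ i1 ->] := control_fubini P_complete BM ca t11 D2.
have [_ _ ->] := control_fubini P_complete BM ca tau01 D2.
pose f s := E (fun w => alpha s w * \1_D w).
have mtau : @measurable _ (measurableTypeR R) `[0, tau]%classic by exact: measurable_itv.
have -> : Rintegral mu `[0, tau] f = Rintegral mu `[0, 1] (f \_ `[0, tau]).
  rewrite -Rintegral_mkcondr; congr (Rintegral mu _ f); apply/seteqP; split => s /=; rewrite !in_itv/=.
    by move=> /andP[s0 st]; rewrite s0 st; split => //; exact: le_trans tau1.
  by case.
have mf := intg_meas i1; apply: (Int_ae mI mf).
  apply: (eq_measurable_fun (fun s => \1_(`[0, tau]%classic : set R) s * f s)).
    by move=> s _; rewrite patchE indicE; case: ifP => _; rewrite ?mul1r ?mul0r.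
  by apply: measurable_funM => //; exact: measurable_indic.
have oc := optimal_control P_complete BM p2 q1 pq delta0 Yq YtY Y1 fin ca Xp opt.
apply: ae_imply (ae_and oc (ae_lt1 R)) => s [hs s1']; rewrite /= in_itv/= => s01.
rewrite patchE; case: ifPn => // /negP st; have /andP[s0 _] := s01; have s1 := s1' s01.
have ts : tau < s by rewrite ltNge; apply/negP => h; apply: st; rewrite inE/= in_itv/= s0.
have sFs := sub_sigma_F P_complete BM s01.
have Ysi : pint (Yt s) by have [] := YtY.2 _ s01.
have {hs} hs := hs s01 (after ts s1); set l := - _ in hs.
have ma : measurable_fun setT (alpha s) by apply: gmeas_meas sFs _; exact: gmeas_prog ca.1 s01.
rewrite /f (@Int_ae _ _ _ P setT measurableT _ (fun w => l * (Yt s w * \1_D w))); last first.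
- by apply: ae_imply hs => w -> _; rewrite mulrA.
- by apply: intg_meas (intgZ measurableT l (intg_indic Ysi mD)).
- by apply: measurable_funM => //; exact: measurable_indic.
have iYs := intg_indic Ysi mD; rewrite (IntZ measurableT _ iYs).
have [_ _ e1] := (is_condexpP (Yt s) sFs Yi).1 (YtY.2 _ s01).
have [_ _ e2] := (is_condexpP (Yt tau) sF Yi).1 (YtY.2 _ tau01).
rewrite e1; last exact: F_le (ltW ts) _ FD.
by rewrite -e2// Ytau_p ?mulr0//; exact: measurable_indic.
Qed.

Let xi_condexp : is_condexp P (F tau) X xi.
Proof.
apply/(is_condexpP xi sF Xi); split.
- by apply: measurable_funD => //; exact: gmeas_integral ca.1 tau01.
- exact: (intgD measurableT (Ai tau01) (Bi tau01)).
move=> D FD; have mD := sF.2 _ FD.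
have etai : pint eta by exact: (intgB measurableT (Bi t11) (Bi tau01)).
have e0 : E (fun w => eta w * \1_D w) = 0.
  rewrite (E_indep P_complete BM tau01 geta etai _ (pint_indic P mD) (intg_indic etai mD)).
    by rewrite IntB ?(bm_mean BM) ?subrr ?mul0r//; [exact: ltW|exact: Bi|exact: Bi].
  exact: gmeas_indic.
have iA := intg_indic (Ai tau01) mD; have iA1 := intg_indic (Ai t11) mD.
have iB := intg_indic (Bi tau01) mD; have ie := intg_indic etai mD.
have -> : E (fun w => X w * \1_D w) = E (fun w => A 1 w * \1_D w) + E (fun w => B tau w * \1_D w) +
    E (fun w => eta w * \1_D w).
  rewrite -(IntD measurableT iA1 iB) -(IntD measurableT (intgD measurableT iA1 iB) ie).
  by apply: eq_Rintegral => w _; rewrite /state /A /eta; ring.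
rewrite e0 addr0 A_indic// -(IntD measurableT iA iB).
by apply: eq_Rintegral => w _; rewrite /xi /state /A mulrDl.
Qed.

Lemma degenerate_time_false : False.
Proof.
have gZ : gmeas (inc tau 1) Z by have [] := XZ.
have h1 := condexp_indep P_complete BM tau01 gZ Zi.
have h2 : is_condexp P (F tau) X (fun=> E Z).
  apply/(is_condexpP _ sF Xi); have [m1 m2 m3] := (is_condexpP _ sF Zi).1 h1; split => // D FD.
  rewrite m3//; have mD := sF.2 _ FD; have i1 := intg_indic Zi mD; have i2 := intg_indic Xi mD.
  by apply: (Int_ae measurableT (intg_meas i1) (intg_meas i2)); apply: ae_imply ZX => w ->.
apply: (control_state_nondegenerate P_complete BM ca tau0 tau1 (c := E Z)).
exact: condexp_unique sF Xi xi_condexp h2.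
Qed.

End degenerate_time.

Lemma dual_norm_gt0 t : 0 < t <= 1 -> (0 < norm P 2 (Yt t))%E.
Proof.
move=> /andP[t0 t1]; rewrite lt_neqAle Lnorm_ge0 andbT; apply/negP => /eqP Y0.
pose S := [set s : R | 0 <= s <= 1 /\ norm P 2 (Yt s) = 0%E].
have St : S t by split => //; rewrite ltW.
have Sub : has_ubound S by exists 1 => s [/andP[]].
pose tau := sup S.
have t_tau : t <= tau by exact: (ub_le_sup Sub).
have tau0 : 0 < tau by exact: lt_le_trans t_tau.
have tau1 : tau <= 1 by apply: ge_sup; [exists t|move=> s [/andP[]]].
have tau01 : 0 <= tau <= 1 by rewrite ltW.
(* The supremum is attained: zeros accumulate at tau from the left, and t |-> Y(t) is continuous in
   L^1. *)
have Ytau : norm P 2 (Yt tau) = 0%E.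
  apply/(norm2_eq0 (mY tau01)); have Yti : pint (Yt tau) by have [] := YtY.2 _ tau01.
  have ia := intg_abs measurableT Yti.
  have ge : {ae P, forall w, [set: T] w -> 0 <= `|Yt tau w|} by apply/aeW.
  suff le0 : E (fun w => `|Yt tau w|) <= 0.
    by apply: ae_imply (Int_eq0_ae measurableT ia ge le0) => w /(_ I)/eqP; rewrite normr_eq0 => /eqP.
  apply/ler_addgt0Pr => e e0; rewrite add0r.
  have [h h0 hc] := condexp_L1_continuous P_complete BM Yi e0.
  have [|s Ss lts] := @sup_adherent _ S h h0; first by split => //; exists t.
  have [s01 Ys0] := Ss; have st : s <= tau by exact: (ub_le_sup Sub).
  have lt : tau - s < h by rewrite ltrBlDr addrC -ltrBlDr.
  apply: le_trans (hc _ _ _ _ (andP s01).1 st tau1 lt (YtY.2 _ s01) (YtY.2 _ tau01)).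
  have Ysi : pint (Yt s) by have [] := YtY.2 _ s01.
  rewrite le_eqVlt; apply/orP; left; apply/eqP.
  apply: (Int_ae measurableT (intg_meas ia) (intg_meas (intg_abs measurableT (intgB measurableT Yti Ysi)))).
  by apply: ae_imply ((norm2_eq0 (mY s01)).1 Ys0) => w -> _; rewrite subr0.
have after s : tau < s -> s < 1 -> 0 < mnorm P Yt s.
  move=> ts s1; have s0 : 0 <= s by exact: ltW (lt_trans tau0 ts).
  rewrite lt_neqAle mnorm_ge0 andbT; apply/negP => /eqP e.
  have : s <= tau.
    apply: (ub_le_sup Sub); split; first by rewrite s0 ltW.
    by rewrite (mnormE P_complete BM Yi YtY fin s0 s1) -e.
  by rewrite leNgt ts.
have sG := sub_sigma_incr BM (ltW tau0) (lexx 1).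
have [Y0' YY0] := condexp_exists sG Yi.
have Y0i : pint Y0' by have [] := YY0.
have [Y0t Y0tY] := martingale_version_exists P_complete BM Y0i.
have [Z XZ] := condexp_exists sG (Lp_pint (ltW p1) Xp).
exact: (degenerate_time_false tau0 tau1 Ytau after YY0 Y0tY XZ).
Qed.

End positivity.

(** * Integrability and continuity *)

Section conclusion.
Context d (T : measurableType d) (R : realType) (P : probability T R).
Variables (B : R -> T -> R).
Hypotheses (P_complete : measure_is_complete P) (BM : standard_brownian_motion P B).
Local Notation mu := (@lebesgue_measure R).
Local Notation E f := (Rintegral P setT f).
Local Notation pint := (intg P setT).
Local Notation F := (filtration P B).
Local Notation c0 := (@c0 R).

Lemma ln_le_powR (r z : R) : 0 < r -> 0 < z -> ln z <= r^-1 * z `^ r.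
Proof.
move=> r0 z0; have zr := powR_gt0 r z0.
have : ln (z `^ r) <= z `^ r.
  by have := expR_ge1Dx (ln (z `^ r)); rewrite lnK ?posrE//; lra.
by rewrite ln_powR -ler_pdivlMl.
Qed.

Lemma log_integrable q (Y : T -> R) : 1 < q -> Lp P q Y ->
  (\int[P]_w (`|Y w| * Num.sqrt (ln (1 + `|Y w|)))%:E < +oo)%E.
Proof.
move=> q1 Yq; have q0 : 0 < q by exact: lt_trans q1.
(* With this exponent sqrt(ln S) is at most a constant times S^(q-1), which leaves a multiple of
   S^q. *)
pose r := 2 * (q - 1); have r0 : 0 < r by rewrite mulr_gt0// subr_gt0.
pose S w := 1 + `|Y w|.
have S1 w : 1 <= S w by rewrite lerDl.
have S0 w : 0 < S w by exact: lt_le_trans (S1 w).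
have Sq : Lp P q S.
  apply: LpD; [exact: ltW|by apply: Lp_cst; exact: ltW|].
  apply: (Lp_le (ltW q0) _ _ Yq); first exact: measurableT_comp Yq.1.
  by move=> w; rewrite normr_id.
pose k := Num.sqrt r^-1.
have Si := intgZ measurableT k Sq.2.
apply: (@le_lt_trans _ _ (\int[P]_w (k * `|S w| `^ q)%:E)%E); last by rewrite (intgE measurableT Si) ltry.
apply: ge0_le_integral => //.
- apply/measurable_EFinP; apply: measurable_funM; first exact: measurableT_comp Yq.1.
  have ms : measurable_fun setT (@Num.sqrt R) by apply: continuous_measurable_fun; exact: sqrt_continuous.
  apply: (measurableT_comp ms); apply: (measurableT_comp (@measurable_ln R)).
  exact: Sq.1.
- exact: measurable_int Si.
move=> w _; rewrite lee_fin (gtr0_norm (S0 w)) -(mulr_powRB1 (ltW (S0 w)) q0) mulrCA.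
apply: ler_pM => //; first by rewrite lerDr.
pose a := S w `^ (q - 1).
have aE : S w `^ r = a ^+ 2 by rewrite /a /r mulrC powRrM powR_mulrn ?powR_ge0.
have k2 : r^-1 = k ^+ 2 by rewrite sqr_sqrtr// invr_ge0 ltW.
have := ler_wsqrtr (ln_le_powR r0 (S0 w)).
by rewrite aE k2 -exprMn sqrtr_sqr ger0_norm// mulr_ge0 ?sqrtr_ge0 ?powR_ge0.
Qed.

Lemma ae_prod_strip (f : R -> T -> R) : jmeas 1 f ->
  {ae mu, forall s, 0 <= s <= 1 -> {ae P, forall w, f s w = 0}} ->
  {ae (mu \x P)%E, forall z : R * T, 0 <= z.1 <= 1 -> f z.1 z.2 = 0}.
Proof.
move=> mf h; pose D := @strip _ T R 1 `&` (fun z => f z.1 z.2) @^-1` (~` [set 0]).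
have mD : measurable D by apply: mf; [exact: measurable_strip|exact: measurableC].
have DN : (mu \x P)%E.-negligible D.
  apply: ae_prod_ae1 => //; apply: ae_imply h => s hs.
  have [s01|ns] := boolP (0 <= s <= 1).
    by apply: negligibleS (hs s01) => w /= [].
  apply: negligibleS (negligible_set0 P) => w [[/=]].
  by rewrite in_itv/= (negbTE ns).
apply: negligibleS DN => z /= nz; split.
  by split => //=; rewrite in_itv/=; apply: contrapT => h'; apply: nz => z01.
by move=> /= fz; apply: nz.
Qed.

Lemma ae_open01 : {ae mu, forall t : R, 0 <= t <= 1 -> 0 < t < 1}.
Proof.
have h0 : {ae mu, forall t : R, 0 <= t <= 1 -> 0 < t}.
  exists [set 0]; split => //; first exact: lebesgue_measure_set1.
  move=> t /= h; apply: contrapT => /eqP t0; apply: h => /andP[h _].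
  by rewrite lt_neqAle eq_sym t0.
by apply: ae_imply (ae_and h0 (ae_lt1 R)) => t [h1 h2] t01; rewrite h1// h2.
Qed.

(** Identifies the minimum in the statement with the multiplier produced by the equality case of
    weak duality. *)
Lemma lambdaE delta Yt t : 0 <= delta -> 0 < mnorm P Yt t ->
  lambda P delta Yt t = best delta (mnorm P Yt t) / mnorm P Yt t.
Proof.
move=> d0 y0; rewrite /lambda /best -/(mnorm P Yt t); set y := mnorm P Yt t in y0 *.
case: eqP => // /eqP dn0; have dp : 0 < delta by rewrite lt_neqAle eq_sym dn0.
have e : (y / delta) / y = delta^-1 by rewrite mulrAC divff ?mul1r// gt_eqF.
have [h|h] := leP c0 (y / delta).
  by rewrite min_l// -e ler_pM2r ?invr_gt0.
by rewrite min_r ?e// -e ler_pM2r ?invr_gt0// ltW.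
Qed.

Section martingale_continuity.
Variables (Y : T -> R) (Yt : R -> T -> R).
Hypotheses (Yi : pint Y) (YtY : martingale_version P B Y Yt).
Hypothesis fin : (\int[mu]_(t in `[0%R, 1%R]) norm P 2 (Yt t) < +oo)%E.
Hypothesis pos : forall t : R, 0 < t < 1 -> 0 < mnorm P Yt t.
Local Notation y := (mnorm P Yt).

(** Continuity is known for the squared norm; since |y(t) - y(s)| y(t) <= |y(t)^2 - y(s)^2|,
    positivity of y(t) transfers it to the norm. *)
Lemma mnorm_continuous t : 0 < t < 1 -> {for t, continuous y}.
Proof.
move=> t01; have /andP[t0 t1] := t01; have y0 := pos t01.
apply/cvgrPdist_lt => e e0.
(* An intermediate time u < 1 where Y(u) is in L^2, so that the squared norm is continuous up to u
   and hence on both sides of t. *)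
pose u := (t + 1) / 2; have tu : t < u by rewrite /u; lra.
have u1 : u < 1 by rewrite /u; lra.
have u0 : 0 < u by exact: lt_trans tu.
have u01 : 0 <= u <= 1 by rewrite !ltW.
have e2 : 0 < e * y t / 2 by rewrite divr_gt0// mulr_gt0.
have Yu2 := mart_L2 P_complete BM Yi YtY fin (ltW u0) u1.
have [h h0 hc] := condexp_sq_continuous P_complete BM u01 Yi (YtY.2 _ u01) Yu2 e2.
have Ye s : 0 <= s -> s <= u -> is_condexp P (F s) Y (Yt s).
  by move=> s0 su; apply: YtY.2; rewrite s0 (le_trans su)// ltW.
apply/nbhs_ballP; exists (Num.min h (Num.min t (u - t))) => /=.
  by rewrite !lt_min h0 t0 subr_gt0.
move=> s; rewrite /ball/= !lt_min => /and3P[sh st su].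
have s0 : 0 < s by move: st; rewrite ltr_norml => /andP[]; lra.
have su' : s < u by move: su; rewrite ltr_norml => /andP[]; lra.
have s1 : s < 1 by exact: lt_trans u1.
have sq : `|y t ^+ 2 - y s ^+ 2| <= e * y t / 2.
  rewrite (mnorm_sq P_complete BM Yi YtY fin (ltW t0) t1) (mnorm_sq P_complete BM Yi YtY fin (ltW s0) s1).
  have [ts|st'] := leP t s.
    rewrite distrC; apply: (hc t s) => //; [exact: ltW|exact: ltW| |by apply: Ye; exact: ltW|by apply: Ye; exact: ltW].
    by move: sh; rewrite ltr_norml => /andP[]; lra.
  apply: (hc s t) => //; [exact: ltW|exact: ltW|exact: ltW| |by apply: Ye; exact: ltW|by apply: Ye; exact: ltW].
  by move: sh; rewrite ltr_norml => /andP[]; lra.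
have ys := mnorm_ge0 P Yt s.
have : `|y t - y s| * y t <= e * y t / 2.
  apply: le_trans sq; rewrite subr_sqr normrM; apply: ler_wpM2l => //.
  by rewrite ger0_norm ?addr_ge0 ?lerDl// ltW.
rewrite mulrAC ler_pM2r// => le; apply: le_lt_trans le _.
by rewrite ltr_pdivrMr// ltr_pMr// ltr1n.
Qed.

Lemma lambda_continuous delta : {within `]0, 1[, continuous (lambda P delta Yt)}.
Proof.
have cl t : 0 < t < 1 -> {for t, continuous (fun s => c0 / y s)}.
  move=> t01; apply: cvgM; first exact: cvg_cst.
  by apply: cvgV; [rewrite gt_eqF// pos|exact: mnorm_continuous].
have o : open (`]0, 1[%classic : set R) by exact: interval_open.
rewrite (continuous_open_subspace _ o) => t; rewrite inE/= in_itv/= => t01.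
have [dE|dn0] := eqVneq delta 0.
  rewrite (_ : lambda P delta Yt = fun s => c0 / y s); first exact: cl.
  by apply/funext => s; rewrite /lambda dE eqxx.
rewrite (_ : lambda P delta Yt = (fun s => c0 / y s) \min (fun=> delta^-1)).
  by apply: continuous_min; [exact: cl|exact: cvg_cst].
by apply/funext => s; rewrite /lambda (negbTE dn0).
Qed.

End martingale_continuity.
End conclusion.

Theorem proposition5p2 (d : measure_display) (T : measurableType d)
    (R : realType) (P : probability T R) (B : R -> T -> R) (p delta q : R)
    (P_complete : measure_is_complete P)
    (B_brownian : standard_brownian_motion P B)
    (p_ge2 : 2 <= p) (delta_ge0 : 0 <= delta) (qE : q = p / (p - 1)) :
  exists (alpha : R -> T -> R) (Y : T -> R),
    [/\ primal_optimizer P B delta p alpha,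
        forall alpha', primal_optimizer P B delta p alpha' ->
          {ae (@lebesgue_measure R \x P)%E, forall z : R * T,
            0 <= z.1 <= 1 -> alpha' z.1 z.2 = alpha z.1 z.2},
        dual_optimizer P B delta q Y &
        forall Y', dual_optimizer P B delta q Y' ->
          {ae P, forall w, Y' w = Y w}] /\
    (let X := state B alpha in
     [/\ (0 < norm P p (X 1%R) < +oo)%E,
         {ae P, forall w, Y w =
           X 1 w * `|X 1 w| `^ (p - 2) / fine (norm P p (X 1)) `^ (p - 1)},
         exists Yt, martingale_version P B Y Yt &
         forall Yt, martingale_version P B Y Yt ->
           [/\ (\int[@lebesgue_measure R]_(t in `[0%R, 1%R])
                  norm P 2 (Yt t) < +oo)%E,
               forall t : R, 0 < t <= 1 -> (0 < norm P 2 (Yt t))%E,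
               forall t : R, 0 < t < 1 -> 0 < lambda P delta Yt t,
               {ae P, forall w, {ae @lebesgue_measure R, forall t : R,
                 0 < t < 1 -> alpha t w = - lambda P delta Yt t * Yt t w}} &
               {within `]0, 1[, continuous (lambda P delta Yt)} /\
               (0 < delta -> exists M : R, forall t : R, 0 < t < 1 ->
                  lambda P delta Yt t <= M)]]).
Proof.
have p1 : 1 < p by apply: lt_le_trans p_ge2; rewrite ltr1n.
have p0 : 0 < p by exact: lt_trans p1.
have p10 : 0 < p - 1 by rewrite subr_gt0.
have q1 : 1 < q by rewrite qE ltr_pdivlMr// mul1r ltrBlDr ltrDl.
have q0 : 0 < q by exact: lt_trans q1.
have pq : p^-1 + q^-1 = 1 by rewrite qE; field; rewrite !gt_eqF.
have BM := B_brownian.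
have [alpha aa opt] := primal_exists P_complete BM p_ge2 q1 pq delta_ge0.
have [ca Xp] := aa; pose X := state B alpha 1; pose Y := dualn P p X.
have N0 : 0 < pnorm P p X by exact: (pnorm_gt0 P_complete BM ca Xp).
have [Yq YE YN] := dualn_spec p1 q1 pq Xp N0.
have Y1 : Rintegral P setT (fun w => `|Y w| `^ q) <= 1 by rewrite YE.
have Yi : intg P setT Y by exact: Lp_pint (ltW q1) Yq.
have cE beta : admissible P B p beta ->
    primal_cost P B delta p beta = (cost P B p delta beta)%:E.
  by move=> [cb bp]; exact: (costE P_complete BM delta p_ge2 cb bp).
(* The minimizer was found among controls with terminal state in L^p; the remaining controls have
   infinite cost. *)
have primal_min beta : control P B beta ->
    (primal_cost P B delta p alpha <= primal_cost P B delta p beta)%E.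
  move=> cb; have [h|] := ltP (primal_cost P B delta p beta) +oo%E.
    have ab : admissible P B p beta by exact: (conj cb (cost_lty P_complete BM p_ge2 cb h)).
    by rewrite !cE// lee_fin; exact: opt.
  by rewrite leye_eq => /eqP ->; exact: leey.
have alphaV : primal_cost P B delta p alpha = primal_value P B delta p.
  apply: le_anti; apply/andP; split; last by apply: ereal_inf_lbound; exists alpha.
  by apply: le_ereal_inf_tmp => _ [beta cb <-]; exact: primal_min.
have strong Yt : martingale_version P B Y Yt ->
    (primal_cost P B delta p alpha <= dual_gain P B delta Y)%E.
  by move=> YtY; rewrite cE//; exact: (strong_duality P_complete BM p_ge2 q1 pq delta_ge0 aa opt YtY).
have [Yt0 Yt0Y] := martingale_version_exists P_complete BM Yi.
have costY := strong _ Yt0Y.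
have gain_ninfty Y' : (primal_cost P B delta p alpha <= dual_gain P B delta Y')%E ->
    dual_gain P B delta Y' != -oo%E.
  by rewrite cE// => h; apply/negP => /eqP e; move: h; rewrite e.
have feasible Y' : dual_feasible P q Y' ->
    Lp P q Y' /\ Rintegral P setT (fun w => `|Y' w| `^ q) <= 1.
  by move=> [mY' nY' _]; exact: (norm_le1 P q0 mY').1 nY'.
have weak Y' : dual_feasible P q Y' ->
    (dual_gain P B delta Y' <= primal_cost P B delta p alpha)%E.
  move=> /feasible[Y'q Y'1].
  have [->|ninf] := eqVneq (dual_gain P B delta Y') -oo%E; first exact: leNye.
  have [Yt' Yt'Y] := martingale_version_exists P_complete BM (Lp_pint (ltW q1) Y'q).
  have fin' := gain_fin P_complete BM p_ge2 q1 pq delta_ge0 Y'q Yt'Y ninf.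
  exact: (weak_duality P_complete BM p_ge2 q1 pq delta_ge0 Y'q Yt'Y Y'1 fin' ca Xp).
have feasY : dual_feasible P q Y.
  split; [exact: Yq.1|exact: (norm_le1 P q0 Yq.1).2 (conj Yq Y1)|exact: log_integrable q1 Yq].
have YV : dual_gain P B delta Y = dual_value P B delta q.
  apply: le_anti; apply/andP; split; first by apply: ereal_sup_ubound; exists Y.
  by apply: ge_ereal_sup => _ [Y' hY' <-]; apply: le_trans (weak _ hY') costY.
have pos Yt : martingale_version P B Y Yt -> forall t : R, 0 < t <= 1 -> (0 < norm P 2 (Yt t))%E.
  by move=> YtY; exact: (dual_norm_gt0 P_complete BM p_ge2 q1 pq delta_ge0 aa YtY costY).
have finY Yt : martingale_version P B Y Yt ->
    (\int[@lebesgue_measure R]_(t in `[0%R, 1%R]) norm P 2 (Yt t) < +oo)%E.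
  by move=> YtY; exact: (gain_fin P_complete BM p_ge2 q1 pq delta_ge0 Yq YtY (gain_ninfty _ costY)).
have mpos Yt (YtY : martingale_version P B Y Yt) (t : R) : 0 < t < 1 -> 0 < mnorm P Yt t.
  move=> /andP[t0 t1]; rewrite -lte_fin -(mnormE P_complete BM Yi YtY (finY _ YtY) (ltW t0) t1).
  by apply: (pos _ YtY); rewrite t0 ltW.
(* Stated for any control that attains the gain of this one [Y]: applied to two optimal controls
   with the same version of the martingale, it gives uniqueness. *)
have relation beta Yt (YtY : martingale_version P B Y Yt) : admissible P B p beta ->
    (primal_cost P B delta p beta <= dual_gain P B delta Y)%E ->
    {ae @lebesgue_measure R, forall t : R, 0 <= t <= 1 -> 0 < t < 1 /\
      {ae P, forall w, beta t w = - (best delta (mnorm P Yt t) / mnorm P Yt t) * Yt t w}}.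
  move=> [cb bp] h.
  have := optimal_control P_complete BM p_ge2 q1 pq delta_ge0 Yq YtY Y1 (finY _ YtY) cb bp h.
  move=> oc; apply: ae_imply (ae_and oc (ae_open01 R)) => t [h1 h2] t01.
  by have t01' := h2 t01; split => //; apply: h1 => //; exact: mpos.
exists alpha, Y; split.
  split => //.
  - move=> beta [cb bV]; have ab : admissible P B p beta.
      have fb : (primal_cost P B delta p beta < +oo)%E by rewrite bV -alphaV cE// ltry.
      exact: (conj cb (cost_lty P_complete BM p_ge2 cb fb)).
    have hb : (primal_cost P B delta p beta <= dual_gain P B delta Y)%E by rewrite bV -alphaV.
    have j : jmeas 1 (fun s w => beta s w - alpha s w).
      by apply: measurable_funB; apply: (jmeas_prog P_complete BM); [exact: cb.1|exact: ca.1].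
    have := ae_and (relation beta _ Yt0Y ab hb) (relation alpha _ Yt0Y aa costY).
    move=> ae2; have := ae_prod_strip j _; move=> /(_ P) h.
    have h' : {ae @lebesgue_measure R, forall s : R, 0 <= s <= 1 -> {ae P, forall w, beta s w - alpha s w = 0}}.
      apply: ae_imply ae2 => s [h1 h2] s01; have [_ e1] := h1 s01; have [_ e2] := h2 s01.
      by apply: ae_imply (ae_and e1 e2) => w [-> ->]; rewrite subrr.
    by apply: ae_imply (h h') => z hz z01; apply/eqP; rewrite -subr_eq0; apply/eqP; exact: hz.
  - move=> Y' [fY' Y'V]; have [Y'q Y'1] := feasible _ fY'.
    have cY' : (primal_cost P B delta p alpha <= dual_gain P B delta Y')%E by rewrite Y'V -YV.
    (* The competitor brings its own martingale, but its gain equals the cost of the same [alpha],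
       so it is the Hölder dual of the same terminal state. *)
    have [Yt' Yt'Y] := martingale_version_exists P_complete BM (Lp_pint (ltW q1) Y'q).
    have fin' := gain_fin P_complete BM p_ge2 q1 pq delta_ge0 Y'q Yt'Y (gain_ninfty _ cY').
    exact: (optimal_dual P_complete BM p_ge2 q1 pq delta_ge0 Y'q Yt'Y Y'1 fin' ca Xp cY').
have normX : norm P p (state B alpha 1) = (pnorm P p X)%:E by apply: normE => //; rewrite gt_eqF.
split.
- by rewrite normX lte_fin N0 ltry.
- by apply/aeW => w; rewrite normX.
- by exists Yt0.
move=> Yt YtY; have fin := finY _ YtY; have mp := mpos _ YtY; have Yp := pos _ YtY.
have lam_gt0 (t : R) : 0 < t < 1 -> 0 < lambda P delta Yt t.
  by move=> t01; rewrite lambdaE ?mp// divr_gt0 ?best_gt0 ?mp.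
split => //.
- have jY := jmeas_prog P_complete BM YtY.1; have ja := jmeas_prog P_complete BM ca.1.
  (* The multiplier in a form that is measurable in time. Joint measurability of alpha + l Y is
     needed to pass from an almost sure identity at almost every time to one at almost every time
     along almost every path. *)
  pose l t := best delta (mnorm P Yt t) * mnorm P Yt t `^ (-1).
  have ml : measurable_fun (`[0, 1 : R]) l.
    have my := mnorm_measurable P_complete BM YtY.
    apply: measurable_funM; first exact: (measurableT_comp (measurable_best delta) my).
    exact: (measurableT_comp (measurable_powR (-1)) my).
  have jl : jmeas 1 (fun s (_ : T) => l s).
    have mI : measurable (`[0, 1 : R]%classic : set R) by exact: measurable_itv.
    apply: (measurable_comp mI _ ml); first by move=> _ [z [zs _] <-].
    by apply: measurable_funTS; exact: measurable_fst.
  have j : jmeas 1 (fun s w => alpha s w + l s * Yt s w).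
    by exact: (measurable_funD ja (jmeasM jl jY)).
  have h' : {ae @lebesgue_measure R, forall s : R, 0 <= s <= 1 -> {ae P, forall w, alpha s w + l s * Yt s w = 0}}.
    apply: ae_imply (relation alpha _ YtY aa costY) => s h s01; have [s01' e] := h s01.
    apply: ae_imply e => w ->; rewrite /l powR_inv1 ?(ltW (mp _ s01'))//.
    by rewrite mulNr addNr.
  have [_ hw] := ae_prod_sections (ae_prod_strip j h').
  apply: ae_imply hw => w; apply: negligibleS => t /= nh h; apply: nh => t01.
  have t01' : 0 <= t <= 1 by have /andP[t0 t1] := t01; rewrite !ltW.
  have := h t01'; rewrite lambdaE ?mp// /l powR_inv1 ?(ltW (mp _ t01))// => /eqP.
  by rewrite addr_eq0 mulNr => /eqP.
- split; first exact: (lambda_continuous P_complete BM Yi YtY fin mp).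
  move=> d0; exists delta^-1 => t _; rewrite /lambda (gt_eqF d0) /=.
  by rewrite ge_min lexx orbT.
Qed.
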